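(* Let $\mathbb T$ be a complex torus and let $(P,\pi)$ be a connected complex $\mathbb T$-Poisson manifold with an open dense $\mathbb T$-leaf. 1) For every $\mathbb T$-log-canonical system $\Phi$ on $(P,\pi)$, taking lowest degree terms at any $p_0\in P$ one has $$\deg(\mu_\Phi^{\rm low})=-\deg\big({\rm Pf}_{\mathbb T}(\pi)^{\rm low}\big).$$ Consequently, if $\pi(p_0)=0$ and if $$\deg\big({\rm Pf}_{\mathbb T}(\pi)^{\rm low}\big)=-\tfrac12{\rm rk}(\pi_0),\qquad(\ast)$$ where $\pi_0$ is the linearization of $\pi$ at $p_0$, then every $\mathbb T$-log-canonical system $\Phi$ on $(P,\pi)$ has Property $\mathcal I$ at $p_0$. 2) Assume that $\mathbb T$-log-canonical systems on $(P,\pi)$ exist. Then the identity $(\ast)$ automatically holds for every $p_0\in P$ that is a $\mathbb T$-fixed point with $\pi(p_0)=0$. Consequently, all $\mathbb T$-log-canonical systems on $(P,\pi)$ have Property $\mathcal I$ at such a $p_0$.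
   Context: A complex $\mathbb T$-Poisson manifold is a complex Poisson manifold $(P,\pi)$ with a holomorphic action of the complex torus $\mathbb T$ by Poisson automorphisms. Let $n=\dim P$, let $\mathfrak t$ be the Lie algebra of $\mathbb T$ and $\sigma:\mathfrak t\to\mathfrak X^1(P)$ the infinitesimal action. A $\mathbb T$-leaf is a subset of the form $L=\bigcup_{t\in\mathbb T}tS$ with $S$ a symplectic leaf; its tangent space at $p$ is ${\rm im}(\sigma_p)+{\rm im}(\pi(p)^\#)$, where $\sigma_p(x)=\sigma(x)(p)$. The subspace $\mathfrak t_L=\{x\in\mathfrak t:\sigma_p(x)\in{\rm im}(\pi(p)^\#)\}$ does not depend on $p\in L$. $\mathbb T$-Pfaffian. Let $L$ be the open dense $\mathbb T$-leaf, ${\rm rk}(\pi)=2r$ (rank = maximal rank over all points), and let $x_1,\dots,x_{n-2r}$ be a basis of a subspace of $\mathfrak t$ complementary to $\mathfrak t_L$. Then $${\rm Pf}_{\mathbb T}(\pi)=\wedge^r\pi\wedge\sigma(x_1)\wedge\cdots\wedge\sigma(x_{n-2r})\in\mathfrak X^n(P),$$ which is well defined up to non-zero scalars. A $\mathbb T$-log-canonical system on $(P,\pi)$ is a set $\Phi=\{\varphi_1,\dots,\varphi_n\}$ of holomorphic functions on $P$ such that $\{\varphi_i,\varphi_j\}_\pi\in\mathbb C\varphi_i\varphi_j$ for all $i,j$, $d\varphi_1\wedge\cdots\wedge d\varphi_n\ne0$, and each $\varphi_i$ is a weight vector for the induced $\mathbb T$-action on functions. Its log-volume form is $\mu_\Phi=\frac{d\varphi_1\wedge\cdots\wedge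 d\varphi_n}{\varphi_1\cdots\varphi_n}$. Linearization: if $\pi(p_0)=0$, $\pi_0$ is the linear Poisson structure on $T_{p_0}P$ with $\{d_{p_0}\varphi,d_{p_0}\psi\}_{\pi_0}=d_{p_0}\{\varphi,\psi\}_\pi$. $\Phi$ has Property $\mathcal I$ at $p_0$ (where $\pi(p_0)=0$) if $\deg(\mu_\Phi^{\rm low})=\frac12{\rm rk}(\pi_0)$, lowest degree term taken at $p_0$. Lowest degree terms at $p_0$. In local coordinates $z$ with $z(p_0)=0$ (also viewed as linear coordinates on $T_{p_0}P$), $\varphi^{\rm low}$ is the sum of the monomials of smallest total degree in the Taylor expansion of a non-zero holomorphic $\varphi$, and its degree is that total degree. For a non-zero holomorphic $k$-form $\alpha$ (resp. $k$-vector field $\partial$), the lowest degree term keeps the monomials of smallest total degree $e$ occurring among all coefficients; $\deg(\alpha^{\rm low})=e+k$ and $\deg(\partial^{\rm low})=e-k$. For meromorphic $\alpha=\alpha_1/\varphi$, $\alpha^{\rm low}=\alpha_1^{\rm low}/\varphi^{\rm low}$ and $\deg(\alpha^{\rm low})=\deg(\alpha_1^{\rm low})-\deg(\varphi^{\rm low})$. *)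

(* Defs.v *)
From HB Require Import structures.
From mathcomp Require Import all_boot all_order all_algebra.
From mathcomp Require Import complex.
From mathcomp Require Import all_classical all_reals all_analysis.

Set Implicit Arguments.
Unset Strict Implicit.
Unset Printing Implicit Defensive.

Import Order.TTheory GRing.Theory Num.Theory.
Import numFieldNormedType.Exports.

Local Open Scope classical_set_scope.
Local Open Scope ring_scope.

(* Typing R[i] as a numFieldType gives access to the normed-module instances;
   [differentiable] and ['D_v] below are thus over the complex numbers, and
   "holomorphic" is "complex differentiable at every point". *)
Definition cplx (R : realType) : numFieldType := R[i].

(* Exterior algebra of the free module with basis e_0, ..., e_(n-1): [a I] is
   the coefficient of e_i1 /\ ... /\ e_ik, where I = {i1 < ... < ik}.  It is
   used both for multivectors (e_i = d/dz_i) and for forms (e_i = dz_i). *)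
Section Exterior.
Context {C : fieldType} {n : nat}.

Definition ext := {ffun {set 'I_n} -> C}.

Definition ext1 : ext := [ffun I => (I == finset.set0)%:R].

Definition inversions (I J : {set 'I_n}) : nat :=
  #|[set ij : 'I_n * 'I_n | [&& ij.1 \in I, ij.2 \in J & (ij.2 < ij.1)%N]]%SET|.

Definition wedge (a b : ext) : ext :=
  [ffun K : {set 'I_n} => \sum_(I : {set 'I_n} | I \subset K)
     (-1) ^+ inversions I (K :\: I) * a I * b (K :\: I)].

Definition wedge_exp (a : ext) (r : nat) : ext := iter r (wedge a) ext1.

Definition ext_vect (v : 'rV[C]_n) : ext :=
  [ffun I : {set 'I_n} => \sum_(i < n | I == [set i]%SET) v 0 i].

Definition ext_bivect (B : 'M[C]_n) : ext :=
  [ffun I : {set 'I_n} =>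
     \sum_(i < n) \sum_(j < n | (i < j)%N && (I == [set i; j]%SET)) B i j].

End Exterior.
Arguments ext : clear implicits.

Definition max_rank {C : fieldType} {n : nat} (S : set 'M[C]_n) : nat :=
  \max_(k < n.+1 | `[< exists2 A, S A & \rank A = k >]) k.

Section Local.
Context {C : numFieldType} {n : nat}.
Implicit Types (f g : 'rV[C]_n -> C) (u : 'rV[C]_n).

Definition partial (i : 'I_n) f : 'rV[C]_n -> C :=
  fun u => 'D_(delta_mx 0 i) f u.

Definition grad f u : 'rV[C]_n := \row_i partial i f u.

(* [B] is a bivector field: B u i j = {z_i, z_j}(u). *)
Definition bracket (B : 'rV[C]_n -> 'M[C]_n) f g : 'rV[C]_n -> C :=
  fun u => \sum_i \sum_j B u i j * partial i f u * partial j g u.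

Definition mderive (a : 'I_n -> nat) f : 'rV[C]_n -> C :=
  foldr (fun i g => iter (a i) (partial i) g) f (enum 'I_n).

Definition taylor_coef f u (a : 'I_n -> nat) : C :=
  mderive a f u / (\prod_i (a i)`!)%:R.

Definition mdegree (a : 'I_n -> nat) : nat := (\sum_i a i)%N.

(* [e] is the smallest total degree of a monomial occurring in the Taylor
   expansions at [u] of the functions [F j].  This determines [e], and it fails
   for all [e] when the [F j] have zero Taylor expansions at [u]. *)
Definition lowest_degree (J : Type) (F : J -> 'rV[C]_n -> C) u (e : nat) :=
  (exists j a, mdegree a = e /\ taylor_coef (F j) u a != 0) /\
  (forall j a, (mdegree a < e)%N -> taylor_coef (F j) u a = 0).

End Local.

(* A chart; [cinv] is only meaningful on the image of [cdom]. *)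
Record chart (C : numFieldType) (n : nat) (P : topologicalType) := Chart {
  cdom : set P;
  cmap : P -> 'rV[C]_n;
  cinv : 'rV[C]_n -> P;
  cdom_open : open cdom;
  cimg_open : open (cmap @` cdom);
  cmapK : forall p, cdom p -> cinv (cmap p) = p;
  cmap_continuous : {within cdom, continuous cmap};
  cinv_continuous : {within cmap @` cdom, continuous cinv} }.

Record cmanifold (C : numFieldType) (n : nat) := CManifold {
  csort :> topologicalType;
  cman_hausdorff : hausdorff_space csort;
  cman_countable : @second_countable csort;
  atlas : set (chart C n csort);
  atlas_cover : forall p, exists2 z, atlas z & cdom z p;
  atlas_compat : forall z w p, atlas z -> atlas w -> cdom z p -> cdom w p ->
    differentiable (cmap w \o cinv z) (cmap z p) }.

Section Manifolds.
Context {C : numFieldType}.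

Definition chart_at n (P : cmanifold C n) (p : P) (z : chart C n P) :=
  atlas z /\ cdom z p.

Definition in_charts k n (M : cmanifold C k) (P : cmanifold C n)
    (z : chart C k M) (w : chart C n P) (f : M -> P) : 'rV[C]_k -> 'rV[C]_n :=
  fun u => cmap w (f (cinv z u)).

Definition holomorphic_map k n (M : cmanifold C k) (P : cmanifold C n)
    (f : M -> P) :=
  continuous f /\
  forall p z w, chart_at p z -> chart_at (f p) w ->
    differentiable (in_charts z w f) (cmap z p).

Definition holomorphic_fun n (P : cmanifold C n) (f : P -> C) :=
  forall p z, chart_at p z -> differentiable (f \o cinv z) (cmap z p).

(* A tensor field is given by its components in every chart [z] of the atlas,
   as functions of the coordinate vector. *)
Record poisson n (P : cmanifold C n) := Poisson {
  bivect : chart C n P -> 'rV[C]_n -> 'M[C]_n;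
  bivect_holo : forall p z, chart_at p z ->
    differentiable (bivect z) (cmap z p);
  bivect_anti : forall p z, chart_at p z ->
    (bivect z (cmap z p))^T = - bivect z (cmap z p);
  bivect_tensor : forall p z w, chart_at p z -> chart_at p w ->
    let J := 'J (in_charts z w idfun) (cmap z p) in
    bivect w (cmap w p) = J^T *m bivect z (cmap z p) *m J;
  bivect_jacobi : forall p z, chart_at p z -> forall i j k : 'I_n,
    let u := cmap z p in
    let B i j u := bivect z u i j in
    \sum_l (B i l u * partial l (B j k) u + B j l u * partial l (B k i) u
            + B k l u * partial l (B i j) u) = 0 }.

Definition torus m : set 'rV[C]_m := [set t | forall i, t 0 i != 0].

Definition torus_mul m (s t : 'rV[C]_m) : 'rV[C]_m := \row_i (s 0 i * t 0 i).

(* A holomorphic action of (C^* )^m on P by Poisson automorphisms; the values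
   of [act t] for t outside the torus are irrelevant. *)
Record torus_action m n (P : cmanifold C n) (pi : poisson P) := TorusAction {
  act : 'rV[C]_m -> P -> P;
  act_one : forall p, act (const_mx 1) p = p;
  act_mul : forall s t p, torus s -> torus t ->
    act (torus_mul s t) p = act s (act t p);
  act_continuous :
    {within [set tp : 'rV[C]_m * P | torus tp.1],
       continuous (fun tp => act tp.1 tp.2)};
  act_holo : forall t p z w, torus t -> chart_at p z -> chart_at (act t p) w ->
    differentiable
      (fun su : 'rV[C]_m * 'rV[C]_n => cmap w (act su.1 (cinv z su.2)))
      (t, cmap z p);
  act_poisson : forall t p z w, torus t ->
    chart_at p z -> chart_at (act t p) w ->
    let J := 'J (in_charts z w (act t)) (cmap z p) in
    bivect pi w (cmap w (act t p)) = J^T *m bivect pi z (cmap z p) *m J }.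

Section PoissonManifold.
Context {n : nat} {P : cmanifold C n} (pi : poisson P).

(* Connected immersed complex submanifolds with tangent spaces im(pi^#).  In
   the chart z, the image of pi(p)^# is the row space of
   [bivect pi z (cmap z p)], and the image of the differential of a map is the
   row space of its Jacobian matrix 'J. *)
Definition integral_submanifold k (M : cmanifold C k) (iota : M -> P) :=
  [/\ connected [set: M], injective iota, holomorphic_map iota &
      forall q z w, chart_at q z -> chart_at (iota q) w ->
        let J := 'J (in_charts z w iota) (cmap z q) in
        row_free J /\ (J == bivect pi w (cmap w (iota q)))%MS].

Definition symplectic_leaf (S : set P) :=
  (exists k (M : cmanifold C k) (iota : M -> P),
     integral_submanifold iota /\ range iota = S) /\
  (forall k (M : cmanifold C k) (iota : M -> P),
     integral_submanifold iota -> S `<=` range iota -> range iota = S).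

Definition poisson_rank : nat :=
  max_rank [set A | exists p z, chart_at p z /\ A = bivect pi z (cmap z p)].

Definition poisson_zero (p : P) :=
  forall z, chart_at p z -> bivect pi z (cmap z p) = 0.

(* [pi0] is the linearization of pi at p0, on the tangent space at p0
   identified with C^n by the chart z; [fun v => 'D_v f u0] is the linear
   function d_p0 f on this space. *)
Definition is_linearization (p0 : P) (z : chart C n P)
    (pi0 : {linear 'rV[C]_n -> 'M[C]_n}) :=
  let u0 := cmap z p0 in
  forall f g : 'rV[C]_n -> C,
    (\forall u \near u0, differentiable f u) ->
    (\forall u \near u0, differentiable g u) ->
    forall v, bracket pi0 (fun v => 'D_v f u0) (fun v => 'D_v g u0) v
              = 'D_v (bracket (bivect pi z) f g) u0.

(* Components of a form or a multivector field in the charts.  The degrees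
   below are read in a chart z around p0, whose coordinates need not be centered
   at p0: the Taylor expansions are taken at [cmap z p0].  They are relations
   in the degree [d], which hold for at most one [d]. *)
Definition ext_field := chart C n P -> 'rV[C]_n -> ext C n.

Definition low_degree_multivect (k : nat) (D : ext_field)
    (p0 : P) (z : chart C n P) (d : int) :=
  exists e, lowest_degree (fun I u => D z u I) (cmap z p0) e /\
            d = e%:Z - k%:Z.

(* The meromorphic k-form alpha1 / phi. *)
Definition low_degree_mero_form (k : nat) (alpha1 : ext_field) (phi : P -> C)
    (p0 : P) (z : chart C n P) (d : int) :=
  exists e f,
    [/\ lowest_degree (fun I u => alpha1 z u I) (cmap z p0) e,
        lowest_degree (fun _ : unit => phi \o cinv z) (cmap z p0) f &
        d = (e%:Z + k%:Z) - f%:Z].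

Definition d_wedge (Phi : 'I_n -> P -> C) : ext_field := fun z u =>
  \big[wedge/ext1]_(i < n) ext_vect (grad (Phi i \o cinv z) u).

Definition low_degree_log_volume (Phi : 'I_n -> P -> C) :=
  low_degree_mero_form n (d_wedge Phi) (fun p => \prod_i Phi i p).

Definition property_I (Phi : 'I_n -> P -> C) (p0 : P) (z : chart C n P) :=
  poisson_zero p0 /\
  exists2 pi0, is_linearization p0 z pi0 &
  exists2 d, low_degree_log_volume Phi p0 z d &
    d%:~R = 2^-1 * (max_rank (range pi0))%:R :> rat.

Section TPoisson.
Context {m : nat} (T : torus_action m pi).

(* sigma(x)(p), in the chart z; the Lie algebra of the torus is its tangent
   space C^m at the unit. *)
Definition infinitesimal (z : chart C n P) (p : P) (x : 'rV[C]_m) : 'rV[C]_n :=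
  'D_x (fun t => cmap z (act T t p)) (const_mx 1).

Definition T_fixed (p : P) := forall t, torus t -> act T t p = p.

Definition T_leaf (L : set P) :=
  exists2 S, symplectic_leaf S & L = \bigcup_(t in @torus m) (act T t @` S).

Definition lie_stabilizer (L : set P) : set 'rV[C]_m :=
  [set x | forall p z, L p -> chart_at p z ->
     (infinitesimal z p x <= bivect pi z (cmap z p))%MS].

(* The rows of X form a basis of a subspace complementary to V. *)
Definition complement_basis k (X : 'M[C]_(k, m)) (V : set 'rV[C]_m) :=
  [/\ row_free X, forall x, (x <= X)%MS -> V x -> x = 0 &
      forall y, exists2 x, (x <= X)%MS & V (y - x)].

Definition pfaffian (r k : nat) (X : 'M[C]_(k, m)) : ext_field := fun z u =>
  wedge (wedge_exp (ext_bivect (bivect pi z u)) r)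
        (\big[wedge/ext1]_(i < k)
           ext_vect (infinitesimal z (cinv z u) (row i X))).

(* [L] is the open dense T-leaf.  A predicate, since Pf_T(pi) depends on the
   choice of X, up to non-zero scalars. *)
Definition is_T_pfaffian (L : set P) (Pf : ext_field) :=
  exists r, poisson_rank = r.*2 /\
  exists2 X : 'M[C]_(n - r.*2, m),
    complement_basis X (lie_stabilizer L) & Pf = pfaffian r X.

(* [chi] is automatically a holomorphic character when f is a non-zero
   holomorphic function. *)
Definition weight_vector (f : P -> C) :=
  exists chi : 'rV[C]_m -> C, forall t p, torus t ->
    f (act T t p) = chi t * f p.

Definition log_canonical (Phi : 'I_n -> P -> C) :=
  [/\ forall i, holomorphic_fun (Phi i),
      forall i j, exists c : C, forall p z, chart_at p z ->
        bracket (bivect pi z) (Phi i \o cinv z) (Phi j \o cinv z) (cmap z p)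
        = c * (Phi i p * Phi j p),
      exists p z, chart_at p z /\ d_wedge Phi z (cmap z p) <> [ffun=> 0] &
      forall i, weight_vector (Phi i)].

End TPoisson.

(* deg(Pf^low) = - rk(pi_0) / 2 at p0. *)
Definition pfaffian_identity (Pf : ext_field) (p0 : P) (z : chart C n P) :=
  exists2 pi0, is_linearization p0 z pi0 &
  exists2 d, low_degree_multivect n Pf p0 z d &
    d%:~R = - (2^-1 * (max_rank (range pi0))%:R) :> rat.

End PoissonManifold.
End Manifolds.

(* Main.v *)
From HB Require Import structures.
From mathcomp Require Import all_boot all_order all_fingroup all_algebra.
From mathcomp Require Import complex ring zify.
Require Import Defs.
Set Implicit Arguments.
Unset Strict Implicit.
Unset Printing Implicit Defensive.
Import Order.TTheory GRing.Theory Num.Theory.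
Local Open Scope ring_scope.

(** Fix a chart around p0. Write B for the matrix of pi, s for the matrix whose
    rows are the vector fields sigma(x_i), J for the Jacobian matrix of the
    functions phi_j of a log-canonical system (their gradients are its columns)
    and Delta for the diagonal matrix of the phi_j. The brackets and the weights
    of the system say that
      J^T B J = Delta Lam Delta   and   s J = cc Delta
    with constant matrices Lam and cc ([log_canonical_constants]).

    Part 1. The Pfaffian is the top multivector B^r wedged with the rows of s, so
    that a congruence by A multiplies its coefficient by det A ([pfq_congr]).
    Applying this to J and to Delta gives
      det J * Pf = (prod phi_j) * kappa
    where kappa is the coefficient built from Lam and cc. It is nonzero: otherwise
    some nonzero combination sigma(x) of the rows of s would be tangent to the
    symplectic leaf at one regular point; tangency being a condition on Lam and cc
    alone, it would hold at all regular points, and by semicontinuity of the rank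
    on the whole T-leaf, so that x would lie in the stabilizer. As det J is the
    coefficient of d phi_1 ... d phi_n and orders of vanishing are additive
    ([exact_ordM]), the degrees of mu_Phi and of Pf are opposite. That these
    orders are finite everywhere is the identity theorem on the connected
    manifold P ([principal_dense]).

    Part 2. Let rho be the rank of the linearization pi_0 and d the degree of
    mu_Phi, both at the fixed zero p0. The identity 2 d = rho splits in two.
    For rho <= 2 d, restrict to a generic line u + t v through p0 and rescale the
    column j of t J by the power of t with which phi_j vanishes. The limit J0
    satisfies J0^T pi_0(v) J0 = 0, so that it has small rank ([isotropic_rank]),
    and the determinant of a family degenerating to such a matrix vanishes to high
    order ([det_order]). For 2 d <= rho, the square of the Pfaffian identity has a
    variant with the determinant of the bordered matrix with blocks B, s^T, -s, 0
    in place of Pf^2; since p0 is fixed by the torus, this matrix vanishes at p0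
    with a linear part of rank at most rho + 2 (n - 2 r), which bounds the order of
    its determinant from below.

    Holomorphic functions are here complex differentiable functions on normed
    modules. Goursat bisection gives the Cauchy formula on discs, hence Taylor
    expansions with remainder along lines; orders of vanishing are then growth
    conditions ([ord_ge]), and leading forms are studied along generic lines. *)

(** * Signs of reorderings and products of anticommuting elements *)
Section Inversions.
Context {n : nat}.
Implicit Types I J K : {set 'I_n}.

Lemma inversionsE I J : inversions I J = (\sum_(i in I) \sum_(j in J) (j < i)%N)%N.
Proof.
rewrite /inversions -sum1_card pair_big_dep /= -[RHS]big_mkcondr /=.
by apply: eq_bigl => -[i j]; rewrite inE /= andbA.
Qed.

Lemma inversions0l J : inversions set0 J = 0%N.
Proof. by rewrite inversionsE big_set0. Qed.

Lemma inversions0r I : inversions I set0 = 0%N.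
Proof. by rewrite inversionsE big1// => i _; rewrite big_set0. Qed.

Lemma inversionsUl I J K : [disjoint I & J] ->
  inversions (I :|: J) K = (inversions I K + inversions J K)%N.
Proof. by move=> dIJ; rewrite !inversionsE -bigU//; apply: eq_bigl => i; rewrite !inE. Qed.

Lemma inversionsUr I J K : [disjoint J & K] ->
  inversions I (J :|: K) = (inversions I J + inversions I K)%N.
Proof.
move=> dJK; rewrite !inversionsE -big_split /=.
by apply: eq_bigr => i _; rewrite -bigU//; apply: eq_bigl => j; rewrite !inE.
Qed.

Lemma inversions_min (i : 'I_n) J : (forall j, j \in J -> (i < j)%N) -> inversions [set i]%SET J = 0%N.
Proof.
move=> h; rewrite inversionsE big_set1 big1// => j /h; rewrite ltnNge leq_eqVlt negb_or => /andP[_ /negbTE ->] //.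
Qed.

End Inversions.

Section AntiCommuting.
Context {A : nzRingType} {n : nat} (x : 'I_n -> A).
Hypothesis xx : forall i, x i * x i = 0.
Hypothesis xC : forall i j, x i * x j = - (x j * x i).
Implicit Types I J K : {set 'I_n}.

Definition oprod I : A := \prod_(i < n | i \in I) x i.

Lemma oprod0 : oprod set0 = 1.
Proof. by rewrite /oprod big_pred0// => i; rewrite inE. Qed.

Lemma sorted_index_enum : sorted (fun a b : 'I_n => (a < b)%N) (index_enum 'I_n).
Proof.
have := iota_ltn_sorted 0 n; rewrite -val_enum_ord sorted_map => h.
by rewrite -[index_enum _]enumT.
Qed.

Lemma oprod_min (j : 'I_n) J : (forall k, k \in J -> (j < k)%N) -> oprod (j |: J) = x j * oprod J.
Proof.
move=> h; rewrite /oprod -big_filter -[in RHS]big_filter.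
have -> : [seq i <- index_enum 'I_n | i \in j |: J] = j :: [seq i <- index_enum 'I_n | i \in J].
  apply: (@irr_sorted_eq _ (fun a b : 'I_n => (a < b)%N)).
  - by move=> a b c; exact: ltn_trans.
  - by move=> a; rewrite ltnn.
  - by apply: sorted_filter sorted_index_enum => a b c; exact: ltn_trans.
  - rewrite /= path_sortedE; last by move=> a b c; exact: ltn_trans.
    apply/andP; split; last by apply: sorted_filter sorted_index_enum => a b c; exact: ltn_trans.
    by apply/allP => k; rewrite mem_filter => /andP[/h].
  - by move=> k; rewrite mem_filter !inE mem_filter mem_index_enum !andbT.
by rewrite big_cons.
Qed.

(** Adding elements in decreasing order: the induction along which an ordered
    product only ever gains a factor on its left, so that no sign appears. *)
Lemma set_min_ind (P : {set 'I_n} -> Prop) : P set0 ->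
  (forall (j : 'I_n) J, (forall k, k \in J -> (j < k)%N) -> P J -> P (j |: J)) -> forall J, P J.
Proof.
move=> P0 PS J; have [m] := ubnP #|J|; elim: m J => // m IH J Jm.
have [->//|[i iJ]] := set_0Vmem J.
case: (@arg_minnP _ i (mem J) (@nat_of_ord n) iJ) => j jJ0 jmin; have jJ : j \in J := jJ0.
rewrite -(setD1K jJ); apply: PS.
  move=> k; rewrite !inE => /andP[kj kJ]; rewrite ltn_neqAle jmin// andbT.
  by apply: contraNneq kj => /val_inj ->.
by apply: IH; move: Jm; rewrite (cardsD1 j J) jJ.
Qed.

(** Moving both factors across the ones between them produces the same sign
    twice, so that only the final exchange of the two factors counts. *)
Lemma prod_tperm (s : 'I_n -> 'I_n) (i j : 'I_n) : i != j ->
  \prod_(k < n) x (s (tperm i j k)) = - \prod_(k < n) x (s k).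
Proof.
have xP a (l : seq 'I_n) (y : 'I_n -> 'I_n) : x a * \prod_(k <- l) x (y k) =
   (-1) ^+ size l * (\prod_(k <- l) x (y k) * x a).
  elim: l => [|b l IH]; first by rewrite !big_nil mulr1 expr0 !mul1r.
  rewrite !big_cons mulrA (xC a) mulNr -[x (y b) * x a * _]mulrA IH /= exprS mulN1r mulNr; congr (- _).
  by rewrite !mulrA [x (y b) * _]commr_sign.
wlog ij : i j / (i < j)%N.
  move=> h nij; have [|ji|/val_inj e] := ltngtP i j; first by move=> /h; apply.
    by rewrite tpermC; apply: h; rewrite // eq_sym.
  by rewrite e eqxx in nij.
move=> nij; have ue : uniq (index_enum 'I_n) by exact: index_enum_uniq.
have : i \in index_enum 'I_n by exact: mem_index_enum.
have : j \in index_enum 'I_n by exact: mem_index_enum.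
move: (index_enum 'I_n) ue => e ue je ie.
have main a b (s1 s2 s3 : seq 'I_n) : a != b -> uniq (s1 ++ a :: s2 ++ b :: s3) ->
    \prod_(k <- s1 ++ a :: s2 ++ b :: s3) x (s (tperm a b k)) =
    - \prod_(k <- s1 ++ a :: s2 ++ b :: s3) x (s k).
  move=> nab; rewrite cat_uniq => /and3P[_ /hasPn h1 /= /andP[]].
  rewrite mem_cat inE negb_or => /andP[as2 /norP[_ as3]].
  rewrite cat_uniq => /and3P[_ /hasPn h2 /= /andP[bs3 _]].
  have fix_ l : a \notin l -> b \notin l -> \prod_(k <- l) x (s (tperm a b k)) = \prod_(k <- l) x (s k).
    move=> al bl; apply: eq_big_seq => k kl; rewrite tpermD//.
      by apply: contraNneq al => ->.
    by apply: contraNneq bl => ->.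
  have bs2 : b \notin s2 by apply: h2; rewrite inE eqxx.
  have as1 : a \notin s1 by apply: h1; rewrite inE eqxx.
  have bs1 : b \notin s1 by apply: h1; rewrite inE mem_cat inE eqxx !orbT.
  rewrite !big_cat !big_cons !big_cat !big_cons /= tpermL tpermR !fix_//.
  rewrite -mulrN; congr (_ * _).
  rewrite !mulrA -mulNr; congr (_ * _).
  rewrite (xP (s b) s2 s) (xP (s a) s2 s) -!mulrA -mulrN; congr (_ * _).
  by rewrite -mulrN; congr (_ * _); exact: xC.
case/splitPr: ie ue je => s1 s2 ue.
rewrite mem_cat inE eq_sym (negbTE nij) /= => /orP[js1|js2].
  case/splitPr: js1 ue => t1 t2; rewrite -catA /= => ue.
  by rewrite tpermC; apply: main => //; rewrite eq_sym.
by case/splitPr: js2 ue => t1 t2 ue; apply: main.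
Qed.

Lemma prod_perm (s : {perm 'I_n}) : \prod_(k < n) x (s k) = (-1) ^+ s * \prod_(k < n) x k.
Proof.
have [ts -> dts] := prod_tpermP s.
elim: ts dts => [_|[i j] ts IH /= /andP[dij dts]].
  by rewrite big_nil odd_perm1 expr0 mul1r; apply: eq_bigr => k _; rewrite perm1.
rewrite big_cons odd_mul_tperm dij /=; set t := (\prod_(t <- ts) tperm t.1 t.2)%g in IH *.
rewrite signrN mulNr -IH// -(prod_tperm t dij).
by apply: eq_bigr => k _; rewrite permM.
Qed.

Lemma prod_noninj (s : 'I_n -> 'I_n) : ~ injective s -> \prod_(k < n) x (s k) = 0.
Proof.
move=> ninj; have nu : ~~ uniq [seq s k | k <- index_enum 'I_n].
  by apply/negP => u; apply: ninj; apply/injectiveP; rewrite /injectiveb /dinjectiveb enumT.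
have x0 a (l : seq 'I_n) : a \in l -> x a * \prod_(k <- l) x k = 0.
  elim: l => //= b l IH; rewrite inE big_cons mulrA => /orP[/eqP->|/IH h].
    by rewrite xx mul0r.
  by rewrite xC mulNr -mulrA h mulr0 oppr0.
rewrite -(big_map s xpredT x); move: (map s _) nu => l.
elim: l => //= a l IH; rewrite negb_and negbK big_cons => /orP[/x0//|/IH ->].
by rewrite mulr0.
Qed.

End AntiCommuting.

(** * The exterior algebra as a ring *)
Section ExteriorRing.
Context {C : numFieldType} {n : nat}.
Implicit Types I J K : {set 'I_n}.

(** [extR] is [ext] with the wedge product as ring multiplication, so that the
    general theory of iterated products in a ring applies to it. *)
Definition extR : Type := ext C n.
HB.instance Definition _ := GRing.Lmodule.copy extR {ffun {set 'I_n} -> C^o}.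
Implicit Types a b c : extR.

Lemma evZ (k : C) a K : (k *: a) K = k * a K.
Proof. by rewrite ffunE. Qed.

Definition eb I : extR := [ffun K => (K == I)%:R].

Lemma eb_decomp a : a = \sum_I a I *: eb I.
Proof.
apply/ffunP => K; rewrite sum_ffunE (bigD1 K)//= big1 ?addr0.
  by rewrite evZ ffunE eqxx mulr1.
by move=> I IK; rewrite evZ ffunE eq_sym (negbTE IK) mulr0.
Qed.

Lemma ext_ind (P : extR -> Prop) : (forall a b, P a -> P b -> P (a + b)) ->
  (forall k I, P (k *: eb I)) -> forall a, P a.
Proof.
move=> hD hZ a; rewrite (eb_decomp a); elim/big_ind: _ => //.
by rewrite -(scale0r (eb set0)).
Qed.

Lemma ext_wedgeDl a b c : wedge (a + b) c = wedge a c + wedge b c :> extR.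
Proof.
apply/ffunP => K; rewrite !ffunE -big_split /=; apply: eq_bigr => I _.
by rewrite ffunE mulrDr mulrDl.
Qed.

Lemma ext_wedgeDr a b c : wedge c (a + b) = wedge c a + wedge c b :> extR.
Proof.
apply/ffunP => K; rewrite !ffunE -big_split /=; apply: eq_bigr => I _.
by rewrite ffunE mulrDr.
Qed.

Lemma ext_wedgeZl (k : C) a b : wedge (k *: a) b = k *: (wedge a b : extR).
Proof.
apply/ffunP => K; rewrite evZ !ffunE mulr_sumr; apply: eq_bigr => I _.
by rewrite evZ; ring.
Qed.

Lemma ext_wedgeZr (k : C) a b : wedge a (k *: b) = k *: (wedge a b : extR).
Proof.
apply/ffunP => K; rewrite evZ !ffunE mulr_sumr; apply: eq_bigr => I _.
by rewrite evZ; ring.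
Qed.

Lemma ext_wedge0l a : wedge 0 a = 0 :> extR.
Proof. by have := ext_wedgeZl 0 0 a; rewrite !scale0r. Qed.
Lemma ext_wedge0r a : wedge a 0 = 0 :> extR.
Proof. by have := ext_wedgeZr 0 a 0; rewrite !scale0r. Qed.

Lemma eb_wedge I J : wedge (eb I) (eb J) =
  if [disjoint I & J] then (-1) ^+ inversions I J *: eb (I :|: J) else 0 :> extR.
Proof.
apply/ffunP => K; rewrite ffunE big_mkcond (bigD1 I)//= big1 ?addr0; last first.
  by move=> L LI; rewrite /eb ffunE (negbTE LI) mulr0 mul0r; case: ifP.
rewrite !ffunE eqxx mulr1.
have E : (I \subset K) && (K :\: I == J) = [disjoint I & J] && (K == I :|: J).
  apply/andP/andP => -[].
    move=> IK /eqP <-; split; last by apply/eqP/setP => x; rewrite !inE; case: (boolP (x \in I)) => [/(subsetP IK) ->|].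
    by rewrite -setI_eq0 setIDA setDIl setDv set0I.
  move=> dIJ /eqP ->; split; first exact: subsetUl.
  by rewrite setDUl setDv set0U; apply/eqP/setDidPl; rewrite disjoint_sym.
case: ifP E => IK /= E.
  case: ifP E => dIJ /= E; last by rewrite E mulr0 ffunE.
  by rewrite evZ ffunE -E; case: eqP => [->|_]; rewrite ?mulr0.
case: ifP E => dIJ /= E; last by rewrite ffunE.
by rewrite evZ ffunE -E mulr0.
Qed.

Lemma ext1E : ext1 = eb set0 :> extR. Proof. by []. Qed.

(** By trilinearity it is enough to compare basis elements, where both sides
    carry the sign counting the inversions between each pair of the three sets. *)
Lemma ext_wedgeA : associative (wedge : extR -> extR -> extR).
Proof.
move=> a b c; elim/ext_ind: a => [a a'|k I]; first by rewrite !ext_wedgeDl => -> ->.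
elim/ext_ind: b => [b b'|l J]; first by rewrite !(ext_wedgeDl, ext_wedgeDr) => -> ->.
elim/ext_ind: c => [c c'|m K]; first by rewrite !ext_wedgeDr => -> ->.
rewrite !(ext_wedgeZl, ext_wedgeZr) !scalerA; congr (_ *: _); first by ring.
rewrite !eb_wedge.
have -> : [disjoint J & K] = [disjoint K & J] by rewrite disjoint_sym.
case dIJ : [disjoint I & J]; case dJK : [disjoint K & J];
  rewrite ?ext_wedge0l ?ext_wedge0r ?ext_wedgeZl ?ext_wedgeZr ?eb_wedge
    -?setI_eq0 ?setIUl ?setIUr ?setU_eq0 ?setI_eq0 ?dIJ ?(disjoint_sym J K) ?dJK ?andbF ?andbT ?scaler0//=.
case dIK : [disjoint I & K]; last by rewrite !scaler0.
rewrite disjoint_sym in dJK.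
rewrite !scalerA -!exprD setUA inversionsUr// inversionsUl//.
by congr ((-1) ^+ _ *: _); lia.
Qed.

Lemma ext_wedge1l : left_id (ext1 : extR) (wedge : extR -> extR -> extR).
Proof.
elim/ext_ind => [a b|k I]; first by rewrite ext_wedgeDr => -> ->.
by rewrite ext_wedgeZr ext1E eb_wedge -setI_eq0 set0I eqxx inversions0l expr0 scale1r set0U.
Qed.

Lemma ext_wedge1r : right_id (ext1 : extR) (wedge : extR -> extR -> extR).
Proof.
elim/ext_ind => [a b|k I]; first by rewrite ext_wedgeDl => -> ->.
by rewrite ext_wedgeZl ext1E eb_wedge -setI_eq0 setI0 eqxx inversions0r expr0 scale1r setU0.
Qed.

Lemma ext1_neq0 : (ext1 : extR) != 0.
Proof.
by apply/eqP => /ffunP /(_ set0); rewrite !ffunE eqxx => /eqP; rewrite oner_eq0.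
Qed.

HB.instance Definition _ := GRing.Zmodule_isNzRing.Build extR
  ext_wedgeA ext_wedge1l ext_wedge1r (fun a b c => ext_wedgeDl a b c)
  (fun a b c => ext_wedgeDr b c a) ext1_neq0.

Lemma extM a b : a * b = wedge a b. Proof. by []. Qed.

Lemma extZl (k : C) a b : (k *: a) * b = k *: (a * b).
Proof. exact: ext_wedgeZl. Qed.
Lemma extZr (k : C) a b : a * (k *: b) = k *: (a * b).
Proof. exact: ext_wedgeZr. Qed.

Definition vec (v : 'rV[C]_n) : extR := ext_vect v.

Lemma vecE v : vec v = \sum_i v 0 i *: eb [set i].
Proof.
apply/ffunP => I; rewrite ffunE sum_ffunE [LHS]big_mkcond /=; apply: eq_bigr => i _.
by rewrite evZ !ffunE; case: eqP; rewrite ?mulr1 ?mulr0.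
Qed.

Lemma eb1C (i j : 'I_n) : eb [set i] * eb [set j] = - (eb [set j] * eb [set i]).
Proof.
rewrite !extM !eb_wedge [in RHS]disjoint_sym disjoints1 inE setUC.
have [->|ij] := eqVneq i j; first by rewrite oppr0.
rewrite -scaleNr; congr (_ *: _); rewrite !inversionsE !big_set1.
have [_|_|/val_inj e] := ltngtP i j; rewrite ?expr1 ?expr0 ?opprK//.
by rewrite e eqxx in ij.
Qed.

Lemma vecC v w : vec v * vec w = - (vec w * vec v).
Proof.
rewrite !vecE !big_distrl -sumrN /=.
under eq_bigr do rewrite big_distrr /=.
under [RHS]eq_bigr do rewrite big_distrr -sumrN /=.
rewrite exchange_big /=; apply: eq_bigr => i _; apply: eq_bigr => j _.
by rewrite !extZl !extZr eb1C !scalerN !scalerA mulrC.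
Qed.

Lemma vec_sq v : vec v * vec v = 0.
Proof.
have /eqP := vecC v v; rewrite -subr_eq0 opprK -mulr2n -scaler_nat scaler_eq0.
by rewrite pnatr_eq0 => /eqP.
Qed.

Lemma scaler_prod_seq (T : Type) (r : seq T) (k : T -> C) (y : T -> extR) :
  \prod_(i <- r) (k i *: y i) = (\prod_(i <- r) k i) *: \prod_(i <- r) y i.
Proof.
elim: r => [|i r IH]; first by rewrite !big_nil scale1r.
by rewrite !big_cons IH extZl extZr scalerA.
Qed.

Definition e_ (i : 'I_n) : extR := eb [set i].

Lemma vec_delta i : vec (delta_mx 0 i) = e_ i.
Proof.
rewrite vecE (bigD1 i)//= mxE !eqxx scale1r big1 ?addr0// => j ji.
by rewrite mxE (negbTE ji) andbF scale0r.
Qed.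

Lemma e_C i j : e_ i * e_ j = - (e_ j * e_ i).
Proof. exact: eb1C. Qed.

Lemma e_sq i : e_ i * e_ i = 0.
Proof. by rewrite -vec_delta vec_sq. Qed.

Lemma oprod_e J : oprod e_ J = eb J.
Proof.
elim/(@set_min_ind n): J => [|j J hj IH]; first by rewrite oprod0.
rewrite oprod_min// IH extM eb_wedge disjoints1 ifT.
  by rewrite inversions_min// expr0 scale1r.
by apply/negP => /hj; rewrite ltnn.
Qed.

(** Expanding the product over the basis gives the Leibniz formula: the terms
    with a repeated index vanish, and the others are signed reorderings. *)
Lemma top_prod (A : 'M[C]_n) : (\prod_(i < n) vec (row i A)) [set: 'I_n] = \det A.
Proof.
have -> : \prod_(i < n) vec (row i A) = \prod_(i < n) \sum_j A i j *: e_ j.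
  by apply: eq_bigr => i _; rewrite vecE; apply: eq_bigr => j _; rewrite mxE.
rewrite bigA_distr_bigA /= sum_ffunE.
rewrite (bigID (fun f : {ffun 'I_n -> 'I_n} => injectiveb f)) /= addrC big1 ?add0r; last first.
  move=> f /injectiveP ninj; rewrite scaler_prod_seq (prod_noninj e_sq e_C ninj).
  by rewrite scaler0 ffunE.
rewrite (reindex (fun s : {perm 'I_n} => pval s)) /=; last first.
  have s0 := 1%g : {perm 'I_n}; exists (fun f => insubd s0 f) => [s _|f].
    by apply: val_inj; rewrite insubdK// -[_ \in _]/(injectiveb _) (valP s).
  by move=> injf; apply: insubdK.
rewrite (eq_bigl xpredT); last by move=> s; exact: (valP s).
apply: eq_bigr => s _; rewrite scaler_prod_seq evZ.
have -> : \prod_(i < n) e_ ((pval s) i) = \prod_(i < n) e_ (s i).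
  by apply: eq_bigr => i _; rewrite pvalE.
rewrite (prod_perm e_C s).
have -> : \prod_(i < n) e_ i = eb setT.
  by rewrite -oprod_e; apply: eq_bigl => i; rewrite inE.
have sgn k (a : extR) : (-1) ^+ k * a = ((-1) ^+ k : C) *: a.
  elim: k => [|k IH]; first by rewrite !expr0 mul1r scale1r.
  by rewrite !exprS !mulN1r mulNr scaleNr IH.
rewrite sgn !evZ ffunE eqxx mulr1 mulrC; congr (_ * _).
by apply: eq_bigr => i _; rewrite pvalE.
Qed.

Definition homog (k : nat) (a : extR) := forall K, a K != 0 -> #|K| = k.

Lemma homog1 : homog 0 1.
Proof. by move=> K; rewrite ffunE; case: (K =P set0) => [->|_]; rewrite ?cards0 ?eqxx. Qed.

Lemma homogM k l a b : homog k a -> homog l b -> homog (k + l) (a * b).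
Proof.
move=> ha hb K; apply: contraNeq => nK; rewrite ffunE big1// => I IK.
have [aI|/ha aI] := eqVneq (a I) 0; first by rewrite aI mulr0 mul0r.
have [bI|/hb bI] := eqVneq (b (K :\: I)) 0; first by rewrite bI mulr0.
by case/eqP: nK; rewrite -aI -bI cardsDS// subnKC// subset_leq_card.
Qed.

Lemma homogX k a r : homog k a -> homog (k * r) (a ^+ r).
Proof.
move=> ha; elim: r => [|r IH]; first by rewrite expr0 muln0; exact: homog1.
by rewrite exprS mulnS; exact: homogM.
Qed.

Lemma homog_vec v : homog 1 (vec v).
Proof.
move=> K; apply: contraNeq => nK; rewrite ffunE big1// => i /eqP e.
by case/eqP: nK; rewrite e cards1.
Qed.

Lemma homog_bivect B : homog 2 (ext_bivect B).
Proof.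
move=> K; apply: contraNeq => nK; rewrite ffunE big1// => i _; rewrite big1// => j /andP[ij /eqP e].
by case/eqP: nK; rewrite e cards2 neq_ltn ij.
Qed.

Lemma homog_prod k (v : 'I_k -> 'rV[C]_n) : homog k (\prod_(i < k) vec (v i)).
Proof.
elim: k v => [|k IH] v; first by rewrite big_ord0; exact: homog1.
by rewrite big_ord_recl; apply: (@homogM 1) (IH _); exact: homog_vec.
Qed.

Lemma homog_top a K : homog n a -> K != [set: 'I_n] -> a K = 0.
Proof.
move=> ha; apply: contraNeq => /ha cK; rewrite eqEcard finset.subsetT cardsT card_ord cK leqnn //.
Qed.

End ExteriorRing.
Arguments extR : clear implicits.

(** * Skew matrices and the top coefficient of a Pfaffian *)
Section SkewForms.
Context {C : numFieldType}.

Lemma skew_diag n (B : 'M[C]_n) i : B^T = - B -> B i i = 0.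
Proof.
move=> /matrixP /(_ i i); rewrite !mxE => /eqP; rewrite -subr_eq0 opprK -mulr2n mulrn_eq0 /=.
by move/eqP.
Qed.

(** A nonzero entry B p q splits off a hyperbolic plane: subtracting the form
    spanned by the rows p and q of B kills the columns p and q, hence lowers the
    rank, and the induction goes on. *)
Lemma skew_normal_form n (B : 'M[C]_n) : B^T = - B ->
  exists r (a b : 'M[C]_(r, n)),
    [/\ B = a^T *m b - b^T *m a, row_free (col_mx a b) & (col_mx a b <= B)%MS].
Proof.
have [m] := ubnP (\rank B); elim: m B => // m IH B Bm skB.
have [B0|nB0] := eqVneq B 0.
  exists 0%N, 0, 0; rewrite B0 !trmx0 !mul0mx subrr; split => //; last by rewrite col_mx0 sub0mx.
  by rewrite /row_free col_mx0 mxrank0.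
have [p [q Bpq]] : exists p q, B p q != 0.
  exact/matrix0Pn.
set be := B p q in Bpq.
have Bqp : B q p = - be by have /matrixP /(_ p q) := skB; rewrite !mxE.
pose u : 'rV_n := row p B; pose w : 'rV_n := row q B.
pose B' : 'M_n := B - be^-1 *: (u^T *m w - w^T *m u).
have B'E i j : B' i j = B i j - be^-1 * (B p i * B q j - B q i * B p j).
  by rewrite !mxE !big_ord1 !mxE.
have skB' : B'^T = - B'.
  apply/matrixP => i j; rewrite mxE [RHS]mxE !B'E.
  have /matrixP /(_ i j) := skB; rewrite !mxE => ->; ring.
have subB' : (B' <= B)%MS.
  rewrite /B' addmx_sub// eqmx_opp scalemx_sub// addmx_sub ?eqmx_opp//.
    by rewrite mulmx_sub// row_sub.
  by rewrite mulmx_sub// row_sub.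
have col0 (v : 'rV_n) : (v <= B')%MS -> v 0 p = 0 /\ v 0 q = 0.
  have B'p i : B' i p = 0.
    by rewrite B'E (skew_diag _ skB) Bqp; have /matrixP /(_ p i) := skB; rewrite !mxE => ->; field.
  have B'q i : B' i q = 0.
    rewrite B'E (skew_diag _ skB) -/be; have /matrixP /(_ q i) := skB; rewrite !mxE => ->; field; exact: Bpq.
  by move=> /submxP [D ->]; rewrite !mxE !big1// => i _; rewrite ?B'p ?B'q mulr0.
have ltB' : (\rank B' < \rank B)%N.
  rewrite ltn_neqAle mxrankS// andbT; apply/negP => /eqP e.
  have /andP[_ BB'] : (B' == B)%MS by rewrite -(mxrank_leqif_eq subB') e.
  have /col0 [_] : (u <= B')%MS by apply: submx_trans BB'; exact: row_sub.
  by rewrite mxE => /eqP; rewrite (negbTE Bpq).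
have [r [a [b [B'ab free sub]]]] := IH B' (leq_trans ltB' Bm) skB'.
exists (1 + r)%N, (col_mx (be^-1 *: u) a), (col_mx w b); split.
- rewrite !tr_col_mx !mul_row_col opprD addrACA -B'ab /B' linearZ /= -scalemxAl -scalemxAr -scalerBr.
  by rewrite addrC subrK.
- have subV : (col_mx a b <= B')%MS by [].
  apply/row_freeP.
  suff : row_free (col_mx (col_mx (be^-1 *: u) a) (col_mx w b)) by move/row_freeP.
  rewrite -kermx_eq0; apply/rowV0P => x /sub_kermxP.
  rewrite -[x]hsubmxK; set x1 := lsubmx x; set x2 := rsubmx x.
  rewrite -[x1]hsubmxK -[x2]hsubmxK !mul_row_col.
  set x11 := lsubmx x1; set x12 := rsubmx x1; set x21 := lsubmx x2; set x22 := rsubmx x2.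
  rewrite addrACA -[X in _ + X]mul_row_col => h.
  have [v vE] : exists v, v = row_mx x12 x22 *m col_mx a b by exists (row_mx x12 x22 *m col_mx a b).
  rewrite -vE in h.
  have vB' : (v <= B')%MS by rewrite vE mulmx_sub.
  have [vp vq] := col0 _ vB'.
  have hp : x21 0 0 * - be = 0.
    have /matrixP /(_ 0 p) := h; rewrite !mxE !big_ord1 !mxE vp addr0 (skew_diag _ skB) Bqp !mulr0 add0r //.
  have hq : x11 0 0 = 0.
    have /matrixP /(_ 0 q) := h; rewrite !mxE !big_ord1 !mxE vq addr0 (skew_diag _ skB) -/be mulr0 addr0.
    by rewrite mulVf// mulr1.
  have {}hp : x21 0 0 = 0 by apply/eqP; move/eqP: hp; rewrite mulrN oppr_eq0 mulf_eq0 (negbTE Bpq) orbF.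
  have e11 : x11 = 0 by apply/matrixP => i j; rewrite !ord1 hq [RHS]mxE.
  have e21 : x21 = 0 by apply/matrixP => i j; rewrite !ord1 hp [RHS]mxE.
  have v0 : v = 0 by rewrite -h e11 e21 !mul0mx !add0r.
  have : row_mx x12 x22 = 0.
    by apply/eqP; rewrite -(mulmx_free_eq0 _ free) -vE; apply/eqP.
  move=> /eqP; rewrite row_mx_eq0 => /andP[/eqP e12 /eqP e22].
  by rewrite e11 e12 e21 e22 !row_mx0.
- have hu : (u <= B)%MS by exact: row_sub.
  have hw : (w <= B)%MS by exact: row_sub.
  move: sub; rewrite !col_mx_sub => /andP[sa sb].
  by rewrite scalemx_sub//= hw (submx_trans sa subB') (submx_trans sb subB').
Qed.

Lemma skew_normal_rank n r (B : 'M[C]_n) (a b : 'M[C]_(r, n)) :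
  B = a^T *m b - b^T *m a -> row_free (col_mx a b) -> (col_mx a b <= B)%MS ->
  (B :=: col_mx a b)%MS /\ \rank B = (r + r)%N.
Proof.
move=> Bab free sub.
have sB : (B <= col_mx a b)%MS.
  rewrite Bab addmx_sub ?eqmx_opp// mulmx_sub//.
    by rewrite -addsmxE addsmxSr.
  by rewrite -addsmxE addsmxSl.
have e : (B :=: col_mx a b)%MS by apply/eqmxP; rewrite sB sub.
by split => //; rewrite e; apply/eqP.
Qed.

End SkewForms.

Section Pfaffian.
Context {C : numFieldType} {n : nat}.

(** The algebraic form of the Pfaffian multivector: B^r wedged with the rows of
    X. For r + r + k = n only the top coefficient can be nonzero. *)
Definition pfq r k (B : 'M[C]_n) (X : 'M[C]_(k, n)) : extR C n :=
  wedge (wedge_exp (ext_bivect B) r) (\big[wedge/ext1]_(i < k) ext_vect (row i X)).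

Lemma pfqE r k B (X : 'M[C]_(k, n)) :
  pfq r B X = (ext_bivect B : extR C n) ^+ r * \prod_(i < k) vec (row i X).
Proof.
rewrite /pfq; congr wedge.
by elim: r => [|r IH]; rewrite ?expr0// exprS -IH.
Qed.

Lemma homog_pfq r k B (X : 'M[C]_(k, n)) : homog (2 * r + k) (pfq r B X).
Proof.
by rewrite pfqE; apply: homogM; [apply: homogX; exact: homog_bivect|exact: homog_prod].
Qed.

Lemma bivectE (H : 'M[C]_n) :
  ext_bivect H = \sum_(i < n) \sum_(j < n | (i < j)%N) H i j *: (e_ i * e_ j) :> extR C n.
Proof.
apply/ffunP => K; rewrite ffunE sum_ffunE; apply: eq_bigr => i _.
rewrite sum_ffunE big_mkcondr /=; apply: eq_bigr => j ij.
rewrite extM eb_wedge disjoints1 inE (negbTE (_ : i != j)); last by rewrite neq_ltn ij.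
rewrite inversionsE !big_set1 ltnNge (ltnW ij) expr0 scale1r evZ ffunE.
by case: ifP; rewrite ?mulr1 ?mulr0.
Qed.

Lemma bivect_skewsym (G : 'M[C]_n) :
  ext_bivect (G - G^T) = \sum_(i < n) \sum_(j < n) G i j *: (e_ i * e_ j) :> extR C n.
Proof.
rewrite bivectE.
have -> : \sum_(i < n) \sum_(j < n) G i j *: (e_ i * e_ j) =
    \sum_(i < n) \sum_(j < n | (i < j)%N) G i j *: (e_ i * e_ j) +
    \sum_(i < n) \sum_(j < n | (j < i)%N) G i j *: (e_ i * e_ j) :> extR C n.
  rewrite -big_split /=; apply: eq_bigr => i _.
  rewrite (bigID (fun j : 'I_n => (i < j)%N)) /=; congr (_ + _).
  rewrite (bigD1 i) ?ltnn//= e_sq scaler0 add0r; apply: eq_bigl => j.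
  by rewrite -leqNgt ltn_neqAle andbC.
rewrite [X in _ = _ + X](exchange_big_dep xpredT) //= -big_split /=; apply: eq_bigr => i _.
rewrite -big_split /=; apply: eq_bigr => j ij.
by rewrite !mxE scalerBl (e_C j) scalerN.
Qed.

Lemma bivect_normal r (a b : 'M[C]_(r, n)) :
  ext_bivect (a^T *m b - b^T *m a) = \sum_(i < r) vec (row i a) * vec (row i b) :> extR C n.
Proof.
have -> : b^T *m a = (a^T *m b)^T by rewrite trmx_mul trmxK.
rewrite bivect_skewsym.
have E i : vec (row i a) * vec (row i b) = \sum_p \sum_q (a i p * b i q) *: (e_ p * e_ q).
  rewrite !vecE big_distrl; apply: eq_bigr => p _; rewrite big_distrr; apply: eq_bigr => q _.
  by rewrite /= extZl extZr scalerA !mxE.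
under [RHS]eq_bigr do rewrite E.
rewrite [RHS]exchange_big; apply: eq_bigr => p _; rewrite [RHS]exchange_big; apply: eq_bigr => q _.
by rewrite -scaler_suml mxE; congr (_ *: _); apply: eq_bigr => i _; rewrite mxE.
Qed.

End Pfaffian.

Section SquareZeroSums.
Context {A : nzRingType}.

Lemma expr_square_zero (y S : A) m : y * y = 0 -> GRing.comm y S ->
  (y + S) ^+ m.+1 = S ^+ m.+1 + (y * S ^+ m) *+ m.+1.
Proof.
move=> yy yS; elim: m => [|m IH]; first by rewrite !expr1 expr0 mulr1 mulr1n addrC.
rewrite exprS IH mulrDl !mulrDr !mulrnAr mulrA yy mul0r mul0rn addr0.
rewrite -exprS mulrA -yS -mulrA -exprS.
by rewrite [in RHS]mulrS addrCA.
Qed.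

(** In the r-th power of a sum of r commuting elements of square zero only the
    r! orderings of the full product survive. *)
Lemma sum_square_zero r (y : 'I_r -> A) : (forall i, y i * y i = 0) ->
  (forall i j, GRing.comm (y i) (y j)) ->
  (\sum_i y i) ^+ r = (\prod_i y i) *+ r`! /\ (\sum_i y i) ^+ r.+1 = 0.
Proof.
elim: r y => [|r IH] y yy yC; first by rewrite !big_ord0 expr0 fact0 expr1.
have [h1 h2] := IH (fun i => y (lift ord0 i)) (fun i => yy _) (fun i j => yC _ _).
rewrite !big_ord_recl.
have cy : GRing.comm (y ord0) (\sum_(i < r) y (lift ord0 i)).
  by apply: commr_sum => i _; exact: yC.
rewrite !expr_square_zero//; move: h1 h2; set S := \sum_(i < r) _ => h1 h2.
have h3 : S ^+ r.+2 = 0 by rewrite exprS h2 mulr0.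
rewrite h3 h2 mulr0 mul0rn addr0 h1; split=> //.
by rewrite add0r mulrnAr -mulrnA factS mulnC.
Qed.

End SquareZeroSums.

Section PfaffianFormula.
Context {C : numFieldType}.

Lemma vec_prod_move n (v : 'rV[C]_n) r (w : 'I_r -> 'rV[C]_n) :
  vec v * \prod_(i < r) vec (w i) = (-1) ^+ r * (\prod_(i < r) vec (w i) * vec v).
Proof.
elim: r w => [|r IH] w; first by rewrite !big_ord0 mulr1 expr0 !mul1r.
rewrite !big_ord_recl mulrA vecC mulNr -[vec _ * vec v * _]mulrA IH exprS mulN1r mulNr; congr (- _).
by rewrite !mulrA [vec (w ord0) * _]commr_sign.
Qed.

Lemma vec_prod_split r : exists c, forall n (a b : 'I_r -> 'rV[C]_n),
  \prod_(i < r) (vec (a i) * vec (b i)) =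
  (-1) ^+ c * (\prod_(i < r) vec (a i) * \prod_(i < r) vec (b i)).
Proof.
elim: r => [|r [c IH]]; first by exists 0%N => n a b; rewrite !big_ord0 !mul1r.
exists (c + r)%N => n a b; rewrite !big_ord_recl IH.
set A' := \prod_(i < r) vec (a _); set B' := \prod_(i < r) vec (b _).
have e : vec (b ord0) * (A' * B') = (-1) ^+ r * (A' * (vec (b ord0) * B')).
  by rewrite mulrA vec_prod_move -!mulrA.
rewrite [LHS]mulrA commr_sign -!mulrA e exprD -mulrA; congr (_ * _).
by rewrite [LHS]mulrA commr_sign -!mulrA.
Qed.

Lemma vec2_comm n (v w x : 'rV[C]_n) : GRing.comm (vec v * vec w) (vec x).
Proof.
by rewrite /GRing.comm -mulrA (vecC w) mulrN [in LHS]mulrA (vecC v x) mulNr opprK mulrA.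
Qed.

Lemma vec2_sq n (v w : 'rV[C]_n) : vec v * vec w * (vec v * vec w) = 0.
Proof. by rewrite mulrA vec2_comm mulrA vec_sq !mul0r. Qed.

Lemma bivect_power n r (a b : 'M[C]_(r, n)) :
  let S := (ext_bivect (a^T *m b - b^T *m a) : extR C n) in
  S ^+ r = (\prod_i (vec (row i a) * vec (row i b))) *+ r`! /\ S ^+ r.+1 = 0.
Proof.
rewrite bivect_normal; apply: sum_square_zero => [i|i j]; first exact: vec2_sq.
by apply: commrM; exact: vec2_comm.
Qed.

Lemma pfq_small n r s k (a b : 'M[C]_(s, n)) (X : 'M[C]_(k, n)) : (s < r)%N ->
  pfq r (a^T *m b - b^T *m a) X = 0.
Proof.
move=> sr; have [_ h] := bivect_power a b.
by rewrite pfqE -(subnKC sr) exprD h !mul0r.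
Qed.

(** In normal form B^r is r! times the product of the rows of a and b, so that
    the top coefficient is a determinant up to a constant depending on r only. *)
Lemma pfq_det r : exists2 ka : C, ka != 0 & forall k (a b : 'M[C]_(r, r + r + k)) (X : 'M[C]_(k, r + r + k)),
  pfq r (a^T *m b - b^T *m a) X [set: 'I_(r + r + k)] = ka * \det (col_mx (col_mx a b) X).
Proof.
have [c hc] := vec_prod_split r.
exists ((-1) ^+ c * r`!%:R).
  by rewrite mulf_neq0 ?signr_eq0// pnatr_eq0 eqn0Ngt fact_gt0.
move=> k a b X; have [h _] := bivect_power a b.
rewrite pfqE h hc -top_prod mulrnAl.
have -> : \prod_(i < r + r + k) vec (row i (col_mx (col_mx a b) X)) =
   \prod_(i < r) vec (row i a) * \prod_(i < r) vec (row i b) * \prod_(i < k) vec (row i X).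
  rewrite big_split_ord /=; congr (_ * _); last first.
    by apply: eq_bigr => i _; rewrite rowKd.
  rewrite big_split_ord /=; congr (_ * _); apply: eq_bigr => i _; first by rewrite !rowKu.
  by rewrite rowKu rowKd.
have sgn k' (y : extR C (r + r + k)) : (-1) ^+ k' * y = ((-1) ^+ k' : C) *: y.
  elim: k' => [|l IH]; first by rewrite !expr0 mul1r scale1r.
  by rewrite !exprS !mulN1r mulNr scaleNr IH.
rewrite -scaler_nat evZ -[in LHS]mulrA sgn evZ mulrA; congr (_ * _).
by rewrite mulrC.
Qed.

(** The transformation rule of a top multivector. The rank bound lets both sides
    be computed in a normal form of B, where A acts on the rows of one
    determinant; below the bound both sides vanish. *)
Lemma pfq_congr n r k (B A : 'M[C]_n) (X : 'M[C]_(k, n)) : (r + r + k)%N = n ->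
  B^T = - B -> (\rank B <= r + r)%N ->
  pfq r (A^T *m B *m A) (X *m A) [set: 'I_n] = \det A * pfq r B X [set: 'I_n].
Proof.
move=> e; subst n => skB rB.
have [s [a [b [Bab free sub]]]] := skew_normal_form skB.
have [_ rs] := skew_normal_rank Bab free sub.
have E : A^T *m B *m A = (a *m A)^T *m (b *m A) - (b *m A)^T *m (a *m A).
  by rewrite Bab mulmxBr mulmxBl !trmx_mul !mulmxA.
rewrite E; have [sr|sr] := ltnP s r; first by rewrite Bab !pfq_small// !ffunE mulr0.
have {}sr : s = r by lia.
subst s; have [ka _ hka] := pfq_det r.
by rewrite Bab !hka -!mul_col_mx det_mulmx; ring.
Qed.

Lemma pfq_neq0 n r k (B : 'M[C]_n) (X : 'M[C]_(k, n)) : (r + r + k)%N = n ->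
  B^T = - B -> \rank B = (r + r)%N -> \rank (col_mx B X) = n ->
  pfq r B X [set: 'I_n] != 0.
Proof.
move=> e; subst n => skB rB rBX.
have [s [a [b [Bab free sub]]]] := skew_normal_form skB.
have [eB rs] := skew_normal_rank Bab free sub.
have sr : s = r by lia.
subst s; have [ka ka0 hka] := pfq_det r.
rewrite Bab hka mulf_neq0//.
suff : col_mx (col_mx a b) X \in unitmx by rewrite unitmxE unitfE.
rewrite -row_full_unit /row_full eqn_leq rank_leq_row /= -{1}rBX mxrankS//.
have sB : (B <= col_mx a b)%MS by rewrite eB.
rewrite col_mx_sub; apply/andP; split; last by rewrite -addsmxE addsmxSr.
by apply: submx_trans sB _; rewrite -(addsmxE (col_mx a b) X) addsmxSl.
Qed.

End PfaffianFormula.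

(** * Ranks of congruent and bordered matrices *)
Section MatrixRank.
Context {C : fieldType}.

(** The image of J is isotropic for B, and an isotropic subspace has dimension
    at most n - rank B / 2. *)
Lemma isotropic_rank n (B J : 'M[C]_n) : J^T *m B *m J = 0 ->
  (\rank B + (\rank J).*2 <= n.*2)%N.
Proof.
rewrite -mulmxA => /mulmx0_rank_max; rewrite mxrank_tr => h1.
by have h2 := mxrank_mul_min B J; lia.
Qed.

Lemma rank_col_mx n k (B : 'M[C]_n) (s : 'M[C]_(k, n)) :
  (forall y : 'rV_k, (y *m s <= B)%MS -> y = 0) -> \rank (col_mx B s) = (\rank B + k)%N.
Proof.
move=> h; rewrite -addsmxE.
have fs : \rank s = k.
  apply/eqP; rewrite -[_ == _]/(row_free s) -kermx_eq0; apply/rowV0P => y /sub_kermxP ys.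
  by apply: h; rewrite ys sub0mx.
have /eqP c0 : (B :&: s)%MS == 0.
  apply/rowV0P => v; rewrite sub_capmx => /andP[vB /submxP [y vE]].
  by rewrite vE (h y) ?mul0mx// -vE.
by have := mxrank_sum_cap B s; rewrite c0 mxrank0 addn0 fs.
Qed.

(** The determinant of this matrix stands for the square of the Pfaffian
    coefficient. Unlike that coefficient, it is a determinant whose order of
    vanishing can be bounded by the rank of its linear part. *)
Definition bordered n k (B : 'M[C]_n) (s : 'M[C]_(k, n)) : 'M[C]_(n + k) :=
  block_mx B s^T (- s) 0.

Lemma det_bordered_congr n k (B A : 'M[C]_n) (s : 'M[C]_(k, n)) :
  \det (bordered (A^T *m B *m A) (s *m A)) = \det A ^+ 2 * \det (bordered B s).
Proof.
have -> : bordered (A^T *m B *m A) (s *m A) =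
    block_mx A^T 0 0 1%:M *m bordered B s *m block_mx A 0 0 1%:M.
  rewrite /bordered !mulmx_block !(mul0mx, mulmx0, mul1mx, mulmx1, addr0, add0r).
  by rewrite trmx_mul mulNmx.
by rewrite !det_mulmx !det_ublock !det1 !mulr1 det_tr; ring.
Qed.

(** A vector (a, b) in the kernel satisfies a B = b s and a s^T = 0. The last
    hypothesis gives b = 0, and then a is orthogonal to all rows of B and s. *)
Lemma det_bordered_neq0 n k (B : 'M[C]_n) (s : 'M[C]_(k, n)) : B^T = - B ->
  \rank (col_mx B s) = n -> (forall y : 'rV_k, (y *m s <= B)%MS -> y = 0) ->
  \det (bordered B s) != 0.
Proof.
move=> skB rBs h; rewrite -unitfE -unitmxE -row_free_unit -kermx_eq0.
apply/rowV0P => x /sub_kermxP; rewrite -[x]hsubmxK mul_row_block mulmx0 addr0.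
move: (lsubmx x) (rsubmx x) => a b.
move=> /eqP; rewrite row_mx_eq0 => /andP[/eqP h1 /eqP h2].
have b0 : b = 0.
  apply: h; apply/submxP; exists a.
  by move/eqP: h1; rewrite mulmxN subr_eq0 => /eqP <-.
have aB : a *m B = 0 by move: h1; rewrite b0 mul0mx addr0.
suff a0 : a = 0 by rewrite a0 b0 row_mx0.
apply: trmx_inj; rewrite trmx0; apply/eqP.
have full : row_full (col_mx B s) by rewrite /row_full rBs.
rewrite -(inj_eq trmx_inj) trmxK trmx0.
have e : a *m (col_mx B s)^T = 0.
  rewrite tr_col_mx mul_mx_row h2 skB mulmxN aB oppr0 row_mx0 //.
have free : row_free (col_mx B s)^T by rewrite /row_free mxrank_tr rBs.
by rewrite -(mulmx_free_eq0 _ free) e.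
Qed.

Lemma rank_bordered n k (B : 'M[C]_n) (s : 'M[C]_(k, n)) :
  (\rank (bordered B s) <= \rank B + k.*2)%N.
Proof.
have -> : bordered B s = (col_mx 1%:M 0 *m B *m row_mx 1%:M 0 +
    col_mx s^T 0 *m row_mx 0 1%:M) + col_mx 0 1%:M *m row_mx (- s) 0.
  rewrite -mulmxA mul_mx_row mulmx1 mulmx0 !mul_col_row.
  rewrite !(mul1mx, mul0mx, mulmx0, mulmx1) !add_block_mx !(addr0, add0r).
  by [].
apply: leq_trans (mxrank_add _ _) _; rewrite -addnn addnA leq_add//.
  apply: leq_trans (mxrank_add _ _) _; apply: leq_add.
    by apply: leq_trans (mxrankM_maxl _ _) (mxrankM_maxr _ _).
  by apply: leq_trans (mxrankM_maxl _ _) (rank_leq_col _).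
by apply: leq_trans (mxrankM_maxr _ _) (rank_leq_row _).
Qed.

(** A nonvanishing minor of maximal size, in a basis-free form. *)
Lemma full_minor m n (M : 'M[C]_(m, n)) :
  exists (A : 'M[C]_(\rank M, m)) (A' : 'M[C]_(n, \rank M)), A *m M *m A' = 1%:M.
Proof.
exists (pid_mx (\rank M) *m invmx (col_ebase M)), (invmx (row_ebase M) *m pid_mx (\rank M)).
set L := col_ebase M; set U := row_ebase M.
transitivity ((pid_mx (\rank M) : 'M[C]_(\rank M, m)) *m invmx L *m
  (L *m pid_mx (\rank M) *m U) *m (invmx U *m (pid_mx (\rank M) : 'M[C]_(n, \rank M)))).
  by rewrite mulmx_ebase.
rewrite !mulmxA mulmxKV ?col_ebase_unit//.
by rewrite mulmxK ?row_ebase_unit// !pid_mx_id ?pid_mx_1 ?rank_leq_row ?rank_leq_col.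
Qed.

Lemma rank_ge_minor l m n (A : 'M[C]_(l, m)) (M : 'M[C]_(m, n)) (A' : 'M[C]_(n, l)) :
  \det (A *m M *m A') != 0 -> (l <= \rank M)%N.
Proof.
rewrite -unitfE -unitmxE => /mxrank_unit {1}<-.
by apply: leq_trans (mxrankM_maxl _ _) (mxrankM_maxr _ _).
Qed.

End MatrixRank.

From mathcomp Require Import lra.
From mathcomp Require Import all_classical all_reals all_analysis.
Import numFieldNormedType.Exports.
Local Open Scope classical_set_scope.
Local Open Scope ring_scope.

(** * Complex normed modules with a real-valued norm *)
Section RealNorm.
Context {R : realType}.
Local Notation C := (cplx R).

(** The norm of a complex normed module takes its values in the complex numbers;
    estimates are carried out on its real part, where the order is total. *)
Definition nr (V : normedModType C) (v : V) : R := complex.Re (`|v| : R[i]).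

Lemma nrE (V : normedModType C) (v : V) : `|v| = (nr v)%:C%C :> R[i].
Proof.
have := normr_ge0 v; rewrite /nr; case: (`|v|) => a b /=.
by rewrite lecE /= => /andP[/eqP-> _].
Qed.

Lemma nr_ge0 (V : normedModType C) (v : V) : 0 <= nr v.
Proof. by have := normr_ge0 v; rewrite nrE lecE /= => /andP[]. Qed.

Lemma nrD (V : normedModType C) (v w : V) : nr (v + w) <= nr v + nr w.
Proof. by have := ler_normD v w; rewrite !nrE -rmorphD lecR. Qed.

Lemma nrN (V : normedModType C) (v : V) : nr (- v) = nr v.
Proof. by rewrite /nr normrN. Qed.

Lemma nrB (V : normedModType C) (v w : V) : nr (v - w) <= nr v + nr w.
Proof. by rewrite -(nrN w) nrD. Qed.

Lemma nrBC (V : normedModType C) (v w : V) : nr (v - w) = nr (w - v).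
Proof. by rewrite -nrN opprB. Qed.

Lemma nr0 (V : normedModType C) : nr (0 : V) = 0.
Proof. by rewrite /nr normr0. Qed.

Lemma nr0_eq0 (V : normedModType C) (v : V) : nr v = 0 -> v = 0.
Proof. by move=> h; apply/normr0_eq0; rewrite nrE h. Qed.

Lemma nrC0_eq0 (z : C) : nr z = 0 -> z = 0.
Proof. exact: nr0_eq0. Qed.

Lemma nr_gt0 (V : normedModType C) (v : V) : (0 < nr v) = (v != 0).
Proof.
rewrite lt_neqAle nr_ge0 andbT eq_sym; congr negb; apply/eqP/eqP; first exact: nr0_eq0.
by move=> ->; rewrite nr0.
Qed.

Lemma nrZ (V : normedModType C) (a : C) (v : V) : nr (a *: v) = nr (a : C) * nr v.
Proof.
by apply/complexI; rewrite -nrE normrZ rmorphM /= -!nrE.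
Qed.

Lemma nrM (a b : C) : nr (a * b) = nr a * nr b.
Proof. by apply/complexI; rewrite -nrE normrM rmorphM /= -!nrE. Qed.

Lemma nr1 : nr (1 : C) = 1.
Proof. by rewrite /nr normr1. Qed.

Lemma nrV (a : C) : nr (a^-1) = (nr a)^-1.
Proof. by apply/complexI; rewrite -nrE normfV fmorphV /= -!nrE. Qed.

Lemma nrX (a : C) n : nr (a ^+ n) = nr a ^+ n.
Proof. by apply/complexI; rewrite -nrE normrX rmorphXn /= -!nrE. Qed.

Lemma nr_real (x : R) : nr (x%:C%C : C) = `|x|.
Proof.
by rewrite /nr (normc_def (x%:C)%C) /= expr0n addr0 sqrtr_sqr.
Qed.

Lemma nr_nbhs (V : normedModType C) (u : V) (A : set V) :
  nbhs u A <-> exists2 d : R, 0 < d & forall x, nr (x - u) < d -> A x.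
Proof.
split.
  move/nbhs_normP => [e /= e0 H].
  have [ie re] : complex.Im (e : R[i]) = 0 /\ 0 < complex.Re (e : R[i]).
    by move: e0; rewrite (ltcE (0 : R[i]) e) => /andP[/eqP -> ->].
  have eE : e = (complex.Re (e : R[i]))%:C%C :> R[i] by move: ie; case: (e) => a b /= ->.
  exists (complex.Re (e : R[i])) => // x hx; apply: H.
  by rewrite /ball_ /= distrC nrE [X in _ < X]eE ltcR.
move=> [d d0 H]; apply/nbhs_normP; exists (d%:C%C : C) => /=.
  by rewrite ltcR.
by move=> x; rewrite /ball_ /= distrC nrE ltcR => /H.
Qed.

Lemma nr_near (V : normedModType C) (u : V) (P : V -> Prop) :
  (\forall x \near u, P x) <-> exists2 d : R, 0 < d & forall x, nr (x - u) < d -> P x.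
Proof. exact: nr_nbhs. Qed.

Lemma nr_cvg (T : Type) (F : set_system T) {FF : Filter F} (V : normedModType C) (f : T -> V) (l : V) :
  f @ F --> l <-> forall e : R, 0 < e -> \forall x \near F, nr (f x - l) < e.
Proof.
split.
  move=> h e e0; apply: (h [set y | nr (y - l) < e]); apply/nr_nbhs; by exists e.
move=> h A /nr_nbhs [d d0 H]; rewrite /fmap /=; near=> x; apply: H; near: x.
exact: h.
Unshelve. all: by end_near. Qed.

Lemma nr_continuous_at (V W : normedModType C) (f : V -> W) (u : V) :
  {for u, continuous f} <-> forall e : R, 0 < e ->
    exists2 d : R, 0 < d & forall x, nr (x - u) < d -> nr (f x - f u) < e.
Proof.
split.
  by move=> /nr_cvg h e /h /nr_near.
by move=> h; apply/nr_cvg => e /h /nr_near.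
Qed.

Lemma Re_le_nr (z : C) : `|complex.Re (z : R[i])| <= nr z.
Proof.
rewrite /nr (normc_def z) /= -sqrtr_sqr ler_wsqrtr// lerDl sqr_ge0 //.
Qed.
Lemma Im_le_nr (z : C) : `|complex.Im (z : R[i])| <= nr z.
Proof.
rewrite /nr (normc_def z) /= -sqrtr_sqr ler_wsqrtr// lerDr sqr_ge0 //.
Qed.
Lemma nr_le_ReIm (z : C) : nr z <= `|complex.Re (z : R[i])| + `|complex.Im (z : R[i])|.
Proof.
rewrite {1}(_ : z = ((complex.Re (z : R[i]))%:C%C : C) + ('i%C : C) * ((complex.Im (z : R[i]))%:C%C : C)); last exact: complexE.
apply: le_trans (nrD _ _) _; rewrite nrM !nr_real.
suff -> : nr ('i%C : C) = 1 by rewrite mul1r.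
by rewrite /nr (normc_def 'i%C) /= expr0n add0r expr1n sqrtr1.
Qed.

End RealNorm.

(** * Primitives and integrals of complex functions of a real variable *)
Section ComplexValued.
Context {R : realType}.
Local Notation C := (cplx R).
Local Notation ReC := (@complex.Re R).
Local Notation ImC := (@complex.Im R).

(** Defined by components, so that real calculus applies to each of them. *)
Definition rderiv (g : R -> C) (t : R) (l : C) :=
  is_derive t 1 (fun x => ReC (g x)) (ReC l) /\ is_derive t 1 (fun x => ImC (g x)) (ImC l).

Lemma rderivD g h t l k : rderiv g t l -> rderiv h t k -> rderiv (fun x => g x + h x) t (l + k).
Proof.
move=> [gr gi] [hr hi]; split.
  rewrite (_ : (fun x => _) = (fun x => ReC (g x)) + (fun x => ReC (h x))); last first.
    by apply/funext => x /=; rewrite raddfD.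
  by rewrite raddfD; exact: is_deriveD.
rewrite (_ : (fun x => _) = (fun x => ImC (g x)) + (fun x => ImC (h x))); last first.
  by apply/funext => x /=; rewrite raddfD.
by rewrite raddfD; exact: is_deriveD.
Qed.

Lemma ReM (a b : C) : ReC (a * b) = ReC a * ReC b - ImC a * ImC b.
Proof. by case: a => a a'; case: b. Qed.
Lemma ImM (a b : C) : ImC (a * b) = ReC a * ImC b + ImC a * ReC b.
Proof. by case: a => a a'; case: b. Qed.

Lemma ReD (a b : C) : ReC (a + b) = ReC a + ReC b.
Proof. by case: a => a a'; case: b. Qed.
Lemma ImD (a b : C) : ImC (a + b) = ImC a + ImC b.
Proof. by case: a => a a'; case: b. Qed.

Lemma rderivM g h t l k : rderiv g t l -> rderiv h t k ->
  rderiv (fun x => g x * h x) t (l * h t + g t * k).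
Proof.
move=> [gr gi] [hr hi]; split.
  rewrite (_ : (fun x => _) = (fun x => ReC (g x)) * (fun x => ReC (h x)) - (fun x => ImC (g x)) * (fun x => ImC (h x))); last first.
    by apply/funext => x /=; rewrite ReM.
  by apply: is_derive_eq; rewrite ReD !ReM /GRing.scale /=; ring.
rewrite (_ : (fun x => _) = (fun x => ReC (g x)) * (fun x => ImC (h x)) + (fun x => ImC (g x)) * (fun x => ReC (h x))); last first.
  by apply/funext => x /=; rewrite ImM.
apply: is_derive_eq; rewrite ImD !ImM /GRing.scale /=; ring.
Qed.

Lemma rderiv_cst (c : C) t : rderiv (fun=> c) t 0.
Proof. by split; exact: is_derive_cst. Qed.

Lemma rderivZ (c : C) g t l : rderiv g t l -> rderiv (fun x => c * g x) t (c * l).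
Proof.
move=> h; have := rderivM (rderiv_cst c t) h; by rewrite mul0r add0r.
Qed.

Lemma rderivN g t l : rderiv g t l -> rderiv (fun x => - g x) t (- l).
Proof.
move=> /(rderivZ (-1)); rewrite mulN1r.
by under [X in rderiv X]eq_fun do rewrite mulN1r.
Qed.

Lemma rderivB g h t l k : rderiv g t l -> rderiv h t k -> rderiv (fun x => g x - h x) t (l - k).
Proof. by move=> hg hh; apply: rderivD => //; apply: rderivN. Qed.

Lemma rderiv_real (f : R -> R) (t l : R) : is_derive t 1 f l ->
  rderiv (fun x => (f x)%:C%C) t (l%:C)%C.
Proof. by move=> h; split => /=; [exact: h|exact: is_derive_cst]. Qed.

Lemma rderiv_eq g t l k : rderiv g t l -> l = k -> rderiv g t k.
Proof. by move=> ? <-. Qed.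

Definition primitive_on (a b : R) (F g : R -> C) := forall t, a <= t <= b -> rderiv F t (g t).

Lemma is_derive_within (f df : R -> R) (a b : R) :
  (forall t, a <= t <= b -> is_derive t 1 f (df t)) -> {within `[a, b], continuous f}.
Proof.
move=> h; apply/continuous_in_subspaceT => x; rewrite inE /= in_itv /= => xab.
have [d _] := h _ xab.
by apply: differentiable_continuous; apply/derivable1_diffP.
Qed.

Lemma real_mvt (f df : R -> R) (a b M : R) : a <= b ->
  (forall t, a <= t <= b -> is_derive t 1 f (df t)) ->
  (forall t, a <= t <= b -> `|df t| <= M) -> `|f b - f a| <= M * (b - a).
Proof.
move=> ab h hM.
have [|c] := @MVT_segment R f df a b ab _ (is_derive_within h).
  by move=> x; rewrite in_itv /= => /andP[h1 h2]; apply: h; rewrite !ltW.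
rewrite in_itv /= => cab ->; rewrite normrM (ger0_norm (_ : 0 <= b - a)) ?subr_ge0//.
by rewrite ler_wpM2r ?subr_ge0// hM.
Qed.

(** The factor 2 comes from applying the mean value theorem to the real and the
    imaginary part separately; it is harmless in all the estimates below. *)
Lemma complex_mvt (F g : R -> C) (a b M : R) : a <= b -> primitive_on a b F g ->
  (forall t, a <= t <= b -> nr (g t) <= M) -> nr (F b - F a) <= 2 * M * (b - a).
Proof.
move=> ab h hM; apply: le_trans (nr_le_ReIm _) _.
rewrite -mulrA mulr_natl mulr2n lerD//.
  rewrite raddfB /=; apply: (@real_mvt (fun x => ReC (F x)) (fun x => ReC (g x))) => // t tab.
    by have [] := h _ tab.
  by apply: le_trans (Re_le_nr _) (hM _ tab).
rewrite raddfB /=; apply: (@real_mvt (fun x => ImC (F x)) (fun x => ImC (g x))) => // t tab.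
  by have [] := h _ tab.
by apply: le_trans (Im_le_nr _) (hM _ tab).
Qed.

Lemma real_primitive (g : R -> R) (a b : R) : continuous g ->
  exists F : R -> R, forall t, a <= t <= b -> is_derive t 1 F (g t).
Proof.
move=> cg.
exists (fun x => (\int[lebesgue_measure]_(t in [set` `[a - 1, x]]) (g t))%R) => t /andP[ta tb].
have [||||] := @continuous_FTC1_closed R g (a - 1) t (b + 1).
- by lra.
- apply: continuous_compact_integrable; first exact: segment_compact.
  exact: continuous_subspaceT.
- by lra.
- exact: cg.
by move=> dF F'; split; [exact: dF | rewrite -derive1E; exact: F'].
Qed.

Lemma continuous_Re (g : R -> C) : continuous g -> continuous (fun x => ReC (g x)).
Proof.
move=> cg x; apply/cvgrPdist_lt => e e0.
have /nr_cvg /(_ e e0) h := cg x.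
near=> y; rewrite distrC -raddfB; apply: le_lt_trans (Re_le_nr _) _; near: y; exact: h.
Unshelve. all: by end_near. Qed.

Lemma continuous_Im (g : R -> C) : continuous g -> continuous (fun x => ImC (g x)).
Proof.
move=> cg x; apply/cvgrPdist_lt => e e0.
have /nr_cvg /(_ e e0) h := cg x.
near=> y; rewrite distrC -raddfB; apply: le_lt_trans (Im_le_nr _) _; near: y; exact: h.
Unshelve. all: by end_near. Qed.

Lemma continuous_real (f : R -> R) : continuous f -> continuous (fun x => (f x)%:C%C : C).
Proof.
move=> cf x; apply/nr_cvg => e e0.
have /cvgrPdist_lt /(_ e e0) h := cf x.
near=> y; rewrite -rmorphB nr_real distrC; near: y; exact: h.
Unshelve. all: by end_near. Qed.

Lemma complex_primitive (g : R -> C) a b : continuous g -> exists F, primitive_on a b F g.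
Proof.
move=> cg.
have [F hF] := real_primitive a b (continuous_Re cg).
have [G hG] := real_primitive a b (continuous_Im cg).
by exists (fun x => (Complex (F x) (G x) : R[i])) => t tab; split; [exact: hF|exact: hG].
Qed.

(** Integrals are increments of primitives: additivity and bounds then follow
    from the rules for derivatives and the mean value theorem. *)
Definition cint (g : R -> C) (a b : R) : C :=
  let F := xget (fun=> 0) [set F | primitive_on a b F g] in F b - F a.

Lemma cint_prim g a b F : a <= b -> primitive_on a b F g -> cint g a b = F b - F a.
Proof.
move=> ab hF; rewrite /cint; case: xgetP => [G _ hG|/(_ F)//] /=.
apply/eqP; rewrite -subr_eq0; apply/eqP/nrC0_eq0/le_anti; rewrite nr_ge0 andbT.
have := @complex_mvt (fun x => G x - F x) (fun=> 0) a b 0 ab.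
rewrite mulr0 mul0r (_ : G b - F b - (G a - F a) = G b - G a - (F b - F a)); last by ring.
apply => t tab; last by rewrite nr0.
by apply: rderiv_eq (rderivB (hG _ tab) (hF _ tab)) _; rewrite subrr.
Qed.

Lemma cint_add g a b c : continuous g -> a <= c -> c <= b ->
  cint g a b = cint g a c + cint g c b.
Proof.
move=> cg ac cb.
have [F hF] := complex_primitive a b cg.
rewrite !(@cint_prim g _ _ F) ?(le_trans ac cb)//; first by ring.
- by move=> t /andP[h1 h2]; apply: hF; rewrite (le_trans ac h1).
- by move=> t /andP[h1 h2]; apply: hF; rewrite h1 (le_trans h2 cb).
Qed.

Lemma cintD g h a b : a <= b -> continuous g -> continuous h ->
  cint (fun x => g x + h x) a b = cint g a b + cint h a b.
Proof.
move=> ab cg ch.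
have [F hF] := complex_primitive a b cg; have [G hG] := complex_primitive a b ch.
rewrite (cint_prim ab hF) (cint_prim ab hG) (@cint_prim _ _ _ (fun x => F x + G x))//.
  by ring.
by move=> t tab; apply: rderivD; [exact: hF|exact: hG].
Qed.

Lemma cintZ (k : C) g a b : a <= b -> continuous g ->
  cint (fun x => k * g x) a b = k * cint g a b.
Proof.
move=> ab cg.
have [F hF] := complex_primitive a b cg.
rewrite (cint_prim ab hF) (@cint_prim _ _ _ (fun x => k * F x))//.
  by ring.
by move=> t tab; apply: rderivZ; exact: hF.
Qed.

Lemma cint_bound g a b M : a <= b -> continuous g ->
  (forall t, a <= t <= b -> nr (g t) <= M) -> nr (cint g a b) <= 2 * M * (b - a).
Proof.
move=> ab cg hM; have [F hF] := complex_primitive a b cg.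
by rewrite (cint_prim ab hF); apply: complex_mvt hM.
Qed.

End ComplexValued.

(** * Goursat bisection *)
Section Goursat.
Context {R : realType}.
Local Notation C := (cplx R).

Section Bisection.
Variable E : R -> R -> R -> R -> C.
Hypothesis Esplit1 : forall a m b c d, a <= m -> m <= b -> c <= d ->
  E a b c d = E a m c d + E m b c d.
Hypothesis Esplit2 : forall a b c m d, a <= b -> c <= m -> m <= d ->
  E a b c d = E a b c m + E a b m d.

Let Er (q : (R * R) * (R * R)) : R := nr (E q.1.1 q.1.2 q.2.1 q.2.2).
Let mid (x : R * R) := (x.1 + x.2) / 2.
Let lo (x : R * R) := (x.1, mid x).
Let hi (x : R * R) := (mid x, x.2).
Let quarter q :=
  if Er q <= 4 * Er (lo q.1, lo q.2) then (lo q.1, lo q.2) else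
  if Er q <= 4 * Er (lo q.1, hi q.2) then (lo q.1, hi q.2) else
  if Er q <= 4 * Er (hi q.1, lo q.2) then (hi q.1, lo q.2) else (hi q.1, hi q.2).

Lemma quarter_large q : q.1.1 <= q.1.2 -> q.2.1 <= q.2.2 -> Er q <= 4 * Er (quarter q).
Proof.
case: q => -[a b] [c d] /= ab cd; rewrite /quarter.
case: ifPn => //; rewrite -ltNge => /ltW h1; case: ifPn => //; rewrite -ltNge => /ltW h2.
case: ifPn => //; rewrite -ltNge => /ltW h3.
have h0 : Er ((a, b), (c, d)) <= Er (lo (a, b), lo (c, d)) + Er (lo (a, b), hi (c, d)) +
    (Er (hi (a, b), lo (c, d)) + Er (hi (a, b), hi (c, d))).
  rewrite /Er /= (@Esplit1 a (mid (a, b)) b) ?(@Esplit2 _ _ c (mid (c, d)) d) /mid /=; try lra.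
  by apply: le_trans (nrD _ _) _; apply: lerD; apply: nrD.
move: h0 h1 h2 h3; rewrite /=.
set x := Er _; set y := Er _; set z := Er _; set t := Er _; set w := Er _; lra.
Qed.

Lemma quarter_cases q : exists i j : bool,
  quarter q = (if i then lo q.1 else hi q.1, if j then lo q.2 else hi q.2).
Proof.
rewrite /quarter; case: ifP => _; first by exists true, true.
case: ifP => _; first by exists true, false.
case: ifP => _; first by exists false, true.
by exists false, false.
Qed.

(** For an additive function E of rectangles: some quarter carries at least a
    quarter of the absolute value of E, so that nested quarters shrink to a point
    near which E is of order o(size^2); hence E vanishes. *)
Lemma goursat_bisection (a0 b0 c0 d0 : R) : a0 <= b0 -> c0 <= d0 ->
  (forall s t, a0 <= s <= b0 -> c0 <= t <= d0 -> forall e : R, 0 < e ->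
     exists2 del : R, 0 < del & forall a b c d, a0 <= a -> b <= b0 -> c0 <= c -> d <= d0 ->
       a <= s <= b -> c <= t <= d -> b - a < del -> d - c < del ->
       nr (E a b c d) <= e * ((b - a) + (d - c)) ^+ 2) ->
  E a0 b0 c0 d0 = 0.
Proof.
move=> ab cd loc; apply: nrC0_eq0; apply/le_anti; rewrite nr_ge0 andbT leNgt; apply/negP => Epos.
pose q n := iter n quarter ((a0, b0), (c0, d0)).
have qS n : q n.+1 = quarter (q n) by [].
have inv n : [/\ (q n).1.1 <= (q n).1.2, (q n).2.1 <= (q n).2.2,
    (q n).1.2 - (q n).1.1 = (b0 - a0) / 2 ^+ n & (q n).2.2 - (q n).2.1 = (d0 - c0) / 2 ^+ n].
  elim: n => [|n [h1 h2 h3 h4]]; first by split => //=; rewrite expr0 divr1.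
  rewrite qS exprSr invfM !mulrA -h3 -h4.
  have [i [j ->]] := quarter_cases (q n); rewrite /lo /hi /mid.
  by case: i; case: j; split => /=; lra.
have mono n : [/\ (q n).1.1 <= (q n.+1).1.1, (q n.+1).1.2 <= (q n).1.2,
    (q n).2.1 <= (q n.+1).2.1 & (q n.+1).2.2 <= (q n).2.2].
  have [h1 h2 _ _] := inv n; rewrite qS.
  have [i [j ->]] := quarter_cases (q n); rewrite /lo /hi /mid.
  by case: i; case: j; split => /=; lra.
have big n : Er (q 0%N) <= 4 ^+ n * Er (q n).
  elim: n => [|n IH]; first by rewrite expr0 mul1r.
  apply: le_trans IH _; rewrite exprSr -mulrA ler_pM2l ?exprn_gt0// qS.
  by have [h1 h2 _ _] := inv n; apply: quarter_large.
have nested (l r : nat -> R) : (forall n, l n <= l n.+1) -> (forall n, r n.+1 <= r n) ->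
    (forall n, l n <= r n) -> exists x, forall n, l n <= x <= r n.
  move=> hl hr hlr.
  have ml i j : (i <= j)%N -> l i <= l j by apply: (@homo_leq _ l Order.le); [exact: lexx|move=> ???; exact: le_trans|].
  have mr i j : (i <= j)%N -> r j <= r i.
    by apply: (@homo_leq _ r (fun x y => y <= x)); [move=> ?; exact: lexx|move=> ? ? ? h1 h2; exact: le_trans h2 h1|].
  exists (sup (range l)) => n; apply/andP; split.
    apply: ub_le_sup; last by exists n.
    by exists (r 0%N) => _ [k _ <-]; apply: le_trans (hlr k) (mr _ _ _).
  apply: ge_sup; first by exists (l 0%N), 0%N.
  move=> _ [k _ <-]; have [kn|/ltnW nk] := leqP k n.
    by apply: le_trans (ml _ _ kn) (hlr n).
  by apply: le_trans (hlr k) (mr _ _ nk).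
have [|||s hs] := @nested (fun n => (q n).1.1) (fun n => (q n).1.2).
- by move=> n; have [] := mono n.
- by move=> n; have [] := mono n.
- by move=> n; have [] := inv n.
have [|||t ht] := @nested (fun n => (q n).2.1) (fun n => (q n).2.2).
- by move=> n; have [] := mono n.
- by move=> n; have [] := mono n.
- by move=> n; have [] := inv n.
set w := (b0 - a0) + (d0 - c0).
have w0 : 0 <= w by rewrite /w; lra.
have e0 : 0 < nr (E a0 b0 c0 d0) / (2 * (w ^+ 2 + 1)).
  by rewrite divr_gt0// mulr_gt0// ltr_wpDl ?sqr_ge0.
have [del del0 hdel] := loc s t (hs 0%N) (ht 0%N) _ e0.
have [n hn] : exists n : nat, w < del * 2 ^+ n.
  exists (Num.bound (w / del)).
  rewrite mulrC -ltr_pdivrMr//; apply: lt_trans (archi_boundP _) _; first by rewrite divr_ge0// ltW.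
  by rewrite -natrX ltr_nat ltn_expl.
have [h1 h2 h3 h4] := inv n.
have {}hdel : Er (q n) <= nr (E a0 b0 c0 d0) / (2 * (w ^+ 2 + 1)) * ((b0 - a0) / 2 ^+ n + (d0 - c0) / 2 ^+ n) ^+ 2.
  have lom k : [/\ a0 <= (q k).1.1, (q k).1.2 <= b0, c0 <= (q k).2.1 & (q k).2.2 <= d0].
    by elim: k => [|k [? ? ? ?]]; [split|have [? ? ? ?] := mono k; split; lra].
  have [? ? ? ?] := lom n.
  rewrite -h3 -h4; apply: hdel => //; rewrite ?hs ?ht// ?h3 ?h4 ltr_pdivrMr ?exprn_gt0//.
    by apply: le_lt_trans hn; rewrite /w; lra.
  by apply: le_lt_trans hn; rewrite /w; lra.
have := big n; rewrite leNgt => /negP; apply.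
apply: le_lt_trans (_ : nr (E a0 b0 c0 d0) / (2 * (w ^+ 2 + 1)) * w ^+ 2 < _).
  rewrite -mulrDl -/w expr_div_n in hdel.
  rewrite mulrC -ler_pdivlMr ?exprn_gt0// (le_trans hdel)// -exprM mulnC exprM.
  by rewrite -[2 ^+ 2]natrX mulrA.
rewrite [Er _]/(nr (E a0 b0 c0 d0)) -[X in _ < X]mulr1 -mulrA ltr_pM2l// mulrC ltr_pdivrMr ?mul1r.
  by have := sqr_ge0 w; lra.
by have := sqr_ge0 w; lra.
Qed.
End Bisection.

(** The form P ds + Q dt integrates to zero around a rectangle as soon as, near
    every point, it differs from an exact form dH by an arbitrarily small multiple
    of the distance to this point. *)
Lemma goursat (P Q : R -> R -> C) (a0 b0 c0 d0 : R) : a0 <= b0 -> c0 <= d0 ->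
  (forall t, continuous (P ^~ t)) -> (forall s, continuous (Q s)) ->
  (forall s0 t0, a0 <= s0 <= b0 -> c0 <= t0 <= d0 -> forall e : R, 0 < e ->
    exists2 del : R, 0 < del & exists H Hs Ht : R -> R -> C,
     forall s t, a0 <= s <= b0 -> c0 <= t <= d0 ->
      [/\ rderiv (H ^~ t) s (Hs s t), rderiv (H s) t (Ht s t) &
       `|s - s0| < del -> `|t - t0| < del ->
       nr (P s t - Hs s t) <= e * (`|s - s0| + `|t - t0|) /\
       nr (Q s t - Ht s t) <= e * (`|s - s0| + `|t - t0|)]) ->
  cint (P ^~ c0) a0 b0 + cint (Q b0) c0 d0 = cint (P ^~ d0) a0 b0 + cint (Q a0) c0 d0.
Proof.
move=> ab cd cP cQ loc.
pose E a b c d := cint (P ^~ c) a b + cint (Q b) c d - cint (P ^~ d) a b - cint (Q a) c d.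
suff : E a0 b0 c0 d0 = 0 by rewrite /E => /eqP; rewrite subr_eq0 => /eqP <-; ring.
refine (@goursat_bisection E _ _ a0 b0 c0 d0 ab cd _).
- move=> a m b c d am mb cd'; rewrite /E !(@cint_add _ (P ^~ _) a b m)//; ring.
- move=> a b c m d ab' cm md; rewrite /E !(@cint_add _ (Q _) c d m)//; ring.
move=> s0 t0 hs0 ht0 e e0.
have e40 : 0 < e / 4 by lra.
have [del del0 [H [Hs [Ht hH]]]] := loc s0 t0 hs0 ht0 _ e40.
exists del => // a b c d a0a bb0 c0c dd0 /andP[as0 s0b] /andP[ct0 t0d] hab hcd.
set r := (b - a) + (d - c).
have bs s t : a <= s <= b -> c <= t <= d ->
   [/\ rderiv (H ^~ t) s (Hs s t), rderiv (H s) t (Ht s t),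
     nr (P s t - Hs s t) <= e / 4 * r & nr (Q s t - Ht s t) <= e / 4 * r].
  move=> /andP[s1 s2] /andP[t1 t2].
  have [||h1 h2 h3] := hH s t; [lra|lra|].
  have hs : `|s - s0| <= b - a by rewrite ler_norml; lra.
  have ht : `|t - t0| <= d - c by rewrite ler_norml; lra.
  have [||h4 h5] := h3; [lra|lra|].
  split => //; first by apply: le_trans h4 _; rewrite ler_pM2l// lerD.
  by apply: le_trans h5 _; rewrite ler_pM2l// lerD.
have intP t : c <= t <= d -> nr (cint (P ^~ t) a b - (H b t - H a t)) <= 2 * (e / 4 * r) * (b - a).
  move=> tcd; have abl : a <= b by lra.
  have [F hF] := complex_primitive a b (cP t).
  rewrite (cint_prim abl hF) (_ : _ - _ = (F b - H b t) - (F a - H a t)); last by ring.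
  apply: (@complex_mvt _ (fun s => F s - H s t) (fun s => P s t - Hs s t)) => //.
    by move=> s sab; apply: rderivB; [exact: hF|have [] := bs s t sab tcd].
  by move=> s sab; have [] := bs s t sab tcd.
have intQ s : a <= s <= b -> nr (cint (Q s) c d - (H s d - H s c)) <= 2 * (e / 4 * r) * (d - c).
  move=> sab; have cdl : c <= d by lra.
  have [F hF] := complex_primitive c d (cQ s).
  rewrite (cint_prim cdl hF) (_ : _ - _ = (F d - H s d) - (F c - H s c)); last by ring.
  apply: (@complex_mvt _ (fun t => F t - H s t) (fun t => Q s t - Ht s t)) => //.
    by move=> t tcd; apply: rderivB; [exact: hF|have [] := bs s t sab tcd].
  by move=> t tcd; have [] := bs s t sab tcd.
have hc : c <= c <= d by lra.
have hd : c <= d <= d by lra.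
have ha : a <= a <= b by lra.
have hb : a <= b <= b by lra.
have -> : E a b c d = (cint (P ^~ c) a b - (H b c - H a c)) + (cint (Q b) c d - (H b d - H b c))
   - (cint (P ^~ d) a b - (H b d - H a d)) - (cint (Q a) c d - (H a d - H a c)) by rewrite /E; ring.
apply: le_trans (nrB _ _) _; apply: le_trans (lerD (nrB _ _) (lexx _)) _.
apply: le_trans (lerD (lerD (nrD _ _) (lexx _)) (lexx _)) _.
have := intP _ hc; have := intP _ hd; have := intQ _ ha; have := intQ _ hb.
rewrite (_ : e * r ^+ 2 = 2 * (e / 4 * r) * (d - c) + 2 * (e / 4 * r) * (d - c)
   + (2 * (e / 4 * r) * (b - a) + 2 * (e / 4 * r) * (b - a))); last by rewrite /r; field.
lra.
Qed.

End Goursat.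

(** * The Cauchy formula for a disc *)
Section Cauchy.
Context {R : realType}.
Local Notation C := (cplx R).
Local Notation ReC := (@complex.Re R).
Local Notation ImC := (@complex.Im R).

Lemma rderiv_continuous (g : R -> C) t l : rderiv g t l -> {for t, continuous g}.
Proof.
move=> [[dr _] [di _]]; apply/nr_cvg => e e0.
have /cvgrPdist_lt hr : {for t, continuous (fun x => ReC (g x))}.
  by apply: differentiable_continuous; apply/derivable1_diffP.
have /cvgrPdist_lt hi : {for t, continuous (fun x => ImC (g x))}.
  by apply: differentiable_continuous; apply/derivable1_diffP.
have e20 : 0 < e / 2 by lra.
near=> y.
apply: le_lt_trans (nr_le_ReIm _) _.
have h1 : `|ReC (g t) - ReC (g y)| < e / 2 by near: y; exact: hr.
have h2 : `|ImC (g t) - ImC (g y)| < e / 2 by near: y; exact: hi.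
rewrite !raddfB /= distrC (distrC (ImC (g y))); lra.
Unshelve. all: by end_near. Qed.

Lemma ccC {c : C} : continuous (fun _ : R => c).
Proof. by move=> t; exact: cvg_cst. Qed.
Lemma ccM (g h : R -> C) : continuous g -> continuous h -> continuous (fun t => g t * h t).
Proof. by move=> cg ch t; apply: cvgM; [exact: cg|exact: ch]. Qed.
Lemma ccB (g h : R -> C) : continuous g -> continuous h -> continuous (fun t => g t - h t).
Proof. by move=> cg ch t; apply: cvgB; [exact: cg|exact: ch]. Qed.
Lemma ccX (g : R -> C) k : continuous g -> continuous (fun t => g t ^+ k).
Proof.
move=> cg; elim: k => [|k IH]; first by under eq_fun do rewrite expr0; exact: ccC.
by under eq_fun do rewrite exprS; exact: ccM.
Qed.

(** Pointwise complex differentiability in epsilon-delta form, without any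
    continuity of the derivative. *)
Definition cdiff (f : C -> C) (w l : C) := forall e : R, 0 < e -> exists2 d : R, 0 < d &
  forall w', nr (w' - w) < d -> nr (f w' - f w - l * (w' - w)) <= e * nr (w' - w).

Lemma cdiff_continuous (f : C -> C) w l : cdiff f w l -> {for w, continuous f}.
Proof.
move=> /(_ 1 ltr01) [d d0 hd]; apply/(@nr_continuous_at R C C) => e e0.
have K0 : 0 < 1 + nr l by have := nr_ge0 l; lra.
exists (Num.min d (e / (1 + nr l))); first by rewrite lt_min d0 divr_gt0.
move=> x; rewrite lt_min => /andP[xd xe].
rewrite (_ : f x - f w = (f x - f w - l * (x - w)) + l * (x - w)); last by ring.
apply: le_lt_trans (nrD _ _) _; rewrite nrM.
rewrite ltr_pdivlMr// in xe; have := hd _ xd; rewrite mul1r; lra.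
Qed.

Definition cis (t : R) : C := (Complex (cos t) (sin t) : R[i]).
Definition icis (t : R) : C := (Complex (cos t) (- sin t) : R[i]).

Lemma cisK t : cis t * icis t = 1.
Proof.
apply/eqP; rewrite eq_complex /= mulrN opprK -!expr2 cos2Dsin2 eqxx /=; apply/eqP; ring.
Qed.

Lemma nr_cis t : nr (cis t) = 1.
Proof. by rewrite /nr (normc_def (cis t)) /= cos2Dsin2 sqrtr1. Qed.

Lemma cis_neq0 t : cis t != 0.
Proof. by rewrite -nr_gt0 nr_cis. Qed.

Lemma cisV t : (cis t)^-1 = icis t.
Proof. by apply: (mulfI (cis_neq0 t)); rewrite divff ?cis_neq0// cisK. Qed.

Lemma rderiv_cis t : rderiv cis t ('i%C * cis t).
Proof.
split; rewrite /cis /=.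
  by rewrite mul0r mul1r sub0r; exact: is_derive_cos.
by rewrite mul0r mul1r add0r; exact: is_derive_sin.
Qed.

Lemma rderiv_icis t : rderiv icis t (- 'i%C * icis t).
Proof.
split; rewrite /icis /=.
  by rewrite oppr0 mul0r mulrNN mul1r sub0r; exact: is_derive_cos.
rewrite oppr0 mul0r mulN1r add0r; apply: is_deriveN; exact: is_derive_sin.
Qed.

Definition twopi : R := locked (pi *+ 2).

Lemma cis2pi : cis twopi = cis 0.
Proof. by rewrite /twopi -lock /cis cos2pi sin2pi cos0 sin0. Qed.
Lemma icis2pi : icis twopi = icis 0.
Proof. by rewrite /twopi -lock /icis cos2pi sin2pi cos0 sin0. Qed.

Lemma twopi_gt0 : 0 < twopi.
Proof. by rewrite /twopi -lock mulrn_wgt0// pi_gt0. Qed.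
Lemma twopi_ge0 : 0 <= twopi.
Proof. exact/ltW/twopi_gt0. Qed.

Definition avg (g : R -> C) : C := (twopi^-1)%:C%C * cint g 0 twopi.

Lemma avgD (g h : R -> C) : continuous g -> continuous h -> avg (fun t => g t + h t) = avg g + avg h.
Proof. move=> cg ch; rewrite /avg.
rewrite (cintD twopi_ge0 cg ch).
by rewrite mulrDr. Qed.

Lemma avgZ (k : C) (g : R -> C) : continuous g -> avg (fun t => k * g t) = k * avg g.
Proof. by move=> cg; rewrite /avg (cintZ _ twopi_ge0 cg) mulrCA. Qed.

Lemma avgB (g h : R -> C) : continuous g -> continuous h -> avg (fun t => g t - h t) = avg g - avg h.
Proof.
move=> cg ch; rewrite -mulN1r -(avgZ _ ch) -(avgD cg (ccM ccC ch)).
by congr avg; apply/funext => t; rewrite mulN1r.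
Qed.

Lemma avg_bound (g : R -> C) (M : R) : continuous g -> (forall t, nr (g t) <= M) -> nr (avg g) <= 2 * M.
Proof.
move=> cg hM; rewrite /avg nrM nr_real ger0_norm ?invr_ge0 ?twopi_ge0//.
rewrite mulrC ler_pdivrMr ?twopi_gt0//.
by have := cint_bound twopi_ge0 cg (fun t _ => hM t); rewrite subr0.
Qed.

Lemma avg_cst c : avg (fun=> c) = c.
Proof.
rewrite /avg (@cint_prim _ _ _ _ (fun t => c * t%:C%C)) ?twopi_ge0//.
  by rewrite rmorph0 mulr0 subr0 mulrCA -rmorphM mulVf ?mulr1// gt_eqF ?twopi_gt0.
move=> t _; apply: rderiv_eq (rderivZ _ (rderiv_real (is_derive_id _ _))) _.
by rewrite mulr1.
Qed.

Lemma rderiv_icisX k t : rderiv (fun t => icis t ^+ k) t (- (k%:R * 'i%C) * icis t ^+ k).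
Proof.
elim: k => [|k IH].
  apply: rderiv_eq (rderiv_cst _ _) _; by rewrite mul0r oppr0 mul0r.
rewrite (_ : (fun t => _) = (fun t => icis t * icis t ^+ k)); last by apply/funext => ?; rewrite exprS.
apply: rderiv_eq (rderivM (rderiv_icis t) IH) _.
by rewrite -natr1 exprS; ring.
Qed.

Lemma avg_icisX k : avg (fun t => icis t ^+ k) = (k == 0%N)%:R.
Proof.
case: k => [|k] /=; first by under eq_fun do rewrite expr0; rewrite avg_cst.
rewrite /avg.
have k0 : (k.+1%:R * 'i%C : C) != 0.
  by rewrite mulf_eq0 negb_or pnatr_eq0 /= eq_complex /= oner_eq0 andbF.
have h := rderiv_icisX k.+1.
rewrite (@cint_prim _ _ _ _ (fun t => - (k.+1%:R * 'i%C)^-1 * icis t ^+ k.+1)) ?twopi_ge0//.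
  by rewrite icis2pi subrr mulr0.
move=> t _; apply: rderiv_eq (rderivZ _ (h t)) _.
by rewrite mulrA mulrNN mulVf// mul1r.
Qed.

Section Kernel.
Variables (r : R) (z : C).
Hypothesis (zr : nr z < r).
Let ze t : C := r%:C%C * cis t.

Let r0 : 0 < r. Proof. by apply: le_lt_trans (nr_ge0 z) zr. Qed.

Lemma nr_ze t : nr (ze t) = r.
Proof. by rewrite nrM nr_cis mulr1 nr_real gtr0_norm. Qed.

Lemma zez_ge t : r - nr z <= nr (ze t - z).
Proof. by have := nrD (ze t - z) z; rewrite subrK nr_ze; lra. Qed.

Lemma zez_neq0 t : ze t - z != 0.
Proof. by rewrite -nr_gt0; apply: lt_le_trans (zez_ge t); rewrite subr_gt0. Qed.

Lemma rderiv_ze t : rderiv ze t ('i%C * ze t).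
Proof. by apply: rderiv_eq (rderivZ _ (rderiv_cis t)) _; rewrite mulrCA. Qed.

Lemma continuous_ze : continuous ze.
Proof. by move=> t; apply: rderiv_continuous (rderiv_ze t). Qed.

Definition kernel t : C := ze t / (ze t - z).

Lemma continuous_kernel : continuous kernel.
Proof.
move=> t; apply: cvgM; first exact: continuous_ze.
apply: cvgV; first exact: zez_neq0.
by apply: cvgB; [exact: continuous_ze|exact: cvg_cst].
Qed.

Lemma kernel_bound t : nr (kernel t) <= r / (r - nr z).
Proof.
by rewrite nrM nrV nr_ze ler_pM2l// lef_pV2 ?zez_ge// posrE ?subr_gt0// (lt_le_trans _ (zez_ge t)) ?subr_gt0.
Qed.

(** The geometric expansion of the Cauchy kernel, truncated at N, with an
    explicit remainder: this is what turns the Cauchy formula into a Taylor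
    expansion. *)
Lemma avg_kernel_expansion (g : R -> C) (M : R) N : continuous g -> (forall t, nr (g t) <= M) ->
  nr (avg (fun t => g t * kernel t) - \sum_(k < N) z ^+ k * avg (fun t => g t * (ze t)^-1 ^+ k))
   <= 2 * (M * (nr z / r) ^+ N * (r / (r - nr z))).
Proof.
move=> cg hM.
have ze0 t : ze t != 0 by rewrite -nr_gt0 nr_ze.
have cze k : continuous (fun t => (ze t)^-1 ^+ k : C).
  by apply: ccX => t; apply: cvgV; [exact: ze0|exact: continuous_ze].
have -> : avg (fun t => g t * kernel t) - \sum_(k < N) z ^+ k * avg (fun t => g t * (ze t)^-1 ^+ k)
   = avg (fun t => g t * (z ^+ N * (ze t)^-1 ^+ N) * kernel t).
  elim: N => [|N IH].
    rewrite big_ord0 subr0; congr avg; apply/funext => t; by rewrite !expr0 !mulr1.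
  rewrite big_ord_recr /= opprD addrA IH -(avgZ _ (ccM cg (cze _))).
  rewrite -(avgB (ccM (ccM cg (ccM ccC (cze _))) continuous_kernel) (ccM ccC (ccM cg (cze _)))).
  congr avg; apply/funext => t; rewrite /kernel !exprSr.
  by field; rewrite ze0 zez_neq0.
apply: avg_bound.
  by apply: ccM continuous_kernel; apply: ccM cg _; apply: ccM ccC (cze _).
move=> t; rewrite 3!nrM !nrX nrV nr_ze -exprMn.
apply: ler_pM => //; rewrite ?mulr_ge0 ?nr_ge0 ?exprn_ge0 ?divr_ge0 ?nr_ge0 ?(ltW r0)//.
  by rewrite ler_wpM2r ?exprn_ge0 ?divr_ge0 ?nr_ge0 ?(ltW r0).
exact: kernel_bound.
Qed.

Lemma pow_small (q K e : R) : 0 <= q < 1 -> 0 < e -> exists N : nat, K * q ^+ N < e.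
Proof.
move=> /andP[q0 q1] e0.
have /cvgrPdist_lt /(_ e e0) [N _ /(_ N (leqnn N))] : ((fun n => K * q ^+ n) @ \oo --> (0 : R)).
  rewrite -(mulr0 K); apply: cvgM; [exact: cvg_cst|apply: cvg_expr; by rewrite ger0_norm].
rewrite sub0r normrN => h; exists N; exact: le_lt_trans (ler_norm _) h.
Qed.

Lemma avg_kernel : avg kernel = 1.
Proof.
apply/eqP; rewrite -subr_eq0; apply/eqP/nrC0_eq0/le_anti; rewrite nr_ge0 andbT.
apply/ler_addgt0Pr => e e0; rewrite add0r.
have [|N hN] := @pow_small (nr z / r) (2 * (r / (r - nr z))) e _ e0.
  by rewrite divr_ge0 ?nr_ge0 ?(ltW r0)//= ltr_pdivrMr ?mul1r.
have n11 (t : R) : nr (1 : C) <= 1 by rewrite nr1.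
have := @avg_kernel_expansion (fun=> 1) 1 N.+1 ccC n11.
rewrite big_ord_recl /= expr0 mul1r big1 ?addr0; last first.
  move=> i _; under eq_fun do rewrite mul1r /ze invfM cisV exprMn mulrC.
  rewrite (_ : (fun t => _) = (fun t => ((r%:C%C)^-1 : C) ^+ (bump 0 i) * icis t ^+ (bump 0 i))); last first.
    by apply/funext => t; exact: mulrC.
  rewrite avgZ; last by move=> t; apply: rderiv_continuous (rderiv_icisX _ _).
  by rewrite avg_icisX /= !mulr0.
rewrite (_ : (fun t => 1 * kernel t) = kernel); last by apply/funext => t; rewrite mul1r.
rewrite (_ : (fun t => 1 * _ ^+ 0) = (fun=> 1)); last by apply/funext => t; rewrite mul1r expr0.
rewrite avg_cst => /le_trans; apply.
rewrite (_ : 2 * (1 * (nr z / r) ^+ N.+1 * (r / (r - nr z))) = (nr z / r) * (2 * (r / (r - nr z)) * (nr z / r) ^+ N)); last first.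
  by rewrite exprS; ring.
apply: le_trans (ltW hN); rewrite ler_piMl//.
  rewrite !mulr_ge0 ?exprn_ge0 ?divr_ge0 ?nr_ge0 ?(ltW r0) ?invr_ge0 ?subr_ge0 ?ltW//.
by rewrite ler_pdivrMr// mul1r ltW.
Qed.

End Kernel.

Section CauchyFormula.
Variables (f : C -> C) (r : R) (z : C).
Hypothesis (zr : nr z < r).
Hypothesis hf : forall w, nr w <= r -> exists l, cdiff f w l.

Let r0 : 0 < r. Proof. by apply: le_lt_trans (nr_ge0 z) zr. Qed.
Let ze t : C := r%:C%C * cis t.
(* The circle is contracted to z along G s t = z + la s * (ze t - z), where s
   runs over the half line; mu is the logarithmic derivative of la, and K that
   of ze - z. *)
Let la (s : R) : R := (1 + s ^+ 2)^-1.
Let mu (s : R) : R := - (2 * s) / (1 + s ^+ 2).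
Let G (s t : R) : C := z + (la s)%:C%C * (ze t - z).
Let K t : C := 'i%C * kernel r z t.

Let nrze t : nr (ze t) = r. Proof. exact: (nr_ze zr). Qed.
Let zez0 t : ze t - z != 0. Proof. exact: (zez_neq0 zr). Qed.

Let nrzez t : nr (ze t - z) <= 2 * r.
Proof. by apply: le_trans (nrB _ _) _; rewrite nrze; have := ltW zr => h; apply: le_trans (lerD (lexx _) h) _; lra. Qed.

Let D0 s : 0 < 1 + s ^+ 2 :> R. Proof. by have := sqr_ge0 s; lra. Qed.

Let is_derive_la (s : R) : is_derive s 1 la (mu s * la s).
Proof.
have h : is_derive s 1 (fun s : R => 1 + s ^+ 2) (2 * s).
  by apply: is_derive_eq; rewrite /GRing.scale /=; ring.
have -> : mu s * la s = - (1 + s ^+ 2) ^- 2 * (2 * s).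
  by rewrite /mu /la; field; rewrite gt_eqF.
split.
  by apply: derivableV => //; rewrite gt_eqF.
rewrite deriveV ?gt_eqF//; have [_ ->] := h; by rewrite /GRing.scale.
Qed.

Let la01 s : 0 < la s <= 1.
Proof. by rewrite /la invr_gt0 D0/= invf_le1// lerDl sqr_ge0. Qed.

Let mu_bound s : `|mu s| <= 1.
Proof.
rewrite /mu normrM normfV (gtr0_norm (D0 s)) ler_pdivrMr// mul1r ler_norml.
by have := sqr_ge0 (s - 1); have := sqr_ge0 (s + 1); rewrite sqrrB sqrrD; lra.
Qed.

Let la_lip s s' : `|la s - la s'| <= `|s - s'|.
Proof.
wlog ss' : s s' / s' <= s.
  move=> h; have [ss'|/ltW ss'] := leP s' s; first exact: h.
  by rewrite distrC (distrC s); exact: h.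
rewrite [`|s - s'|]ger0_norm ?subr_ge0// -[X in _ <= X]mul1r.
apply: (real_mvt ss' (fun t _ => is_derive_la t)) => t _.
have /andP[l0 l1] := la01 t.
by rewrite normrM mulr_ile1// gtr0_norm.
Qed.

Let nrG s t : nr (G s t) <= r.
Proof.
have /andP[l0 l1] := la01 s.
have -> : G s t = (1 - la s)%:C%C * z + (la s)%:C%C * ze t.
  by rewrite /G rmorphB rmorph1; ring.
apply: le_trans (nrD _ _) _; rewrite !nrM !nr_real nr_cis mulr1 !ger0_norm ?subr_ge0 ?(ltW r0) ?(ltW l0)//.
have := zr; move: (nr z) (la s) l0 l1 => x y y0 y1 xr.
by have : 0 <= (1 - y) * (r - x); [apply: mulr_ge0; lra|nra].
Qed.

Let GE s t : G s t - z = (la s)%:C%C * (ze t - z).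
Proof. by rewrite /G [z + _]addrC addrK. Qed.

Let rG1 s t : rderiv (G ^~ t) s ((mu s)%:C%C * (G s t - z)).
Proof.
apply: rderiv_eq (rderivD (rderiv_cst z s) (rderivM (rderiv_real (is_derive_la s)) (rderiv_cst (ze t - z) s))) _.
by rewrite mulr0 addr0 add0r GE mulrA rmorphM.
Qed.

Let rG2 s t : rderiv (G s) t (K t * (G s t - z)).
Proof.
apply: rderiv_eq (rderivD (rderiv_cst z t) (rderivZ _ (rderivB (rderiv_ze r t) (rderiv_cst z t)))) _.
rewrite subr0 add0r GE /K /kernel [in RHS]mulrCA; congr (_ * _).
by rewrite -[in RHS]mulrA divfK ?zez0.
Qed.

Let cfG1 t : continuous (fun s => f (G s t)).
Proof.
move=> s; apply: (@continuous_comp _ _ _ (G ^~ t) f); first exact: rderiv_continuous (rG1 _ _).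
by have [l /cdiff_continuous] := hf (nrG s t).
Qed.

Let cfG2 s : continuous (fun t => f (G s t)).
Proof.
move=> t; apply: (@continuous_comp _ _ _ (G s) f); first exact: rderiv_continuous (rG2 _ _).
by have [l /cdiff_continuous] := hf (nrG s t).
Qed.

Let cmu : continuous mu.
Proof.
move=> s; apply: cvgM.
  by apply: cvgN; apply: cvgM; [exact: cvg_cst|exact: cvg_id].
apply: cvgV; first by rewrite gt_eqF.
by apply: cvgD; [exact: cvg_cst|exact: exprn_continuous].
Qed.

Let cK : continuous K.
Proof. by move=> t; apply: cvgM; [exact: cvg_cst|exact: continuous_kernel]. Qed.

Let P s t : C := f (G s t) * (mu s)%:C%C.
Let Q s t : C := f (G s t) * K t.

Let cP t : continuous (P ^~ t).
Proof. by move=> s; apply: cvgM; [exact: cfG1|exact: continuous_real]. Qed.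
Let cQ s : continuous (Q s).
Proof. by move=> t; apply: cvgM; [exact: cfG2|exact: cK]. Qed.

Let G_lip s t s' t' : nr (G s t - G s' t') <= 2 * r * (`|s - s'| + `|t - t'|).
Proof.
have -> : G s t - G s' t' = (la s - la s')%:C%C * (ze t - z) + (la s')%:C%C * (ze t - ze t').
  by rewrite /G rmorphB; ring.
apply: le_trans (nrD _ _) _; rewrite !nrM !nr_real mulrDr; apply: lerD.
  rewrite mulrC; apply: (ler_pM (nr_ge0 _) (normr_ge0 _) (nrzez t) (la_lip s s')).
have /andP[l0 l1] := la01 s'.
apply: le_trans (_ : nr (ze t - ze t') <= _); first by rewrite ler_piMl ?nr_ge0// gtr0_norm.
wlog tt' : t t' / t' <= t.
  move=> h; have [tt'|/ltW tt'] := leP t' t; first exact: h.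
  by have := h _ _ tt'; rewrite (nrBC (ze t)) (distrC t).
rewrite ger0_norm ?subr_ge0//.
apply: (@complex_mvt _ ze (fun t => 'i%C * ze t)) => //.
  by move=> u _; exact: rderiv_ze.
move=> u _; rewrite nrM nrze (_ : nr ('i%C : C) = 1) ?mul1r//.
by rewrite /nr (normc_def 'i%C) /= expr0n add0r expr1n sqrtr1.
Qed.

Let K_bound t : nr (K t) <= r / (r - nr z).
Proof.
rewrite nrM (_ : nr ('i%C : C) = 1) ?mul1r ?kernel_bound//.
by rewrite /nr (normc_def 'i%C) /= expr0n add0r expr1n sqrtr1.
Qed.

(* f(w) dw / (w - z) pulled back by G is the form P ds + Q dt. It is locally
   close to an exact form because f is close to its first order expansion, and
   its integrals over t = 0 and t = twopi cancel. *)
Let cint_const S : 0 <= S -> cint (Q S) 0 twopi = cint (Q 0) 0 twopi.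
Proof.
move=> S0.
suff : cint (P ^~ 0) 0 S + cint (Q S) 0 twopi = cint (P ^~ twopi) 0 S + cint (Q 0) 0 twopi.
  rewrite (_ : P ^~ twopi = P ^~ 0); first by move/addrI.
  by apply/funext => s; rewrite /P /G /ze cis2pi.
apply: goursat => //; first exact: twopi_ge0.
move=> s0 t0 hs0 ht0 e e0.
set w0 := G s0 t0.
have [f1 hf1] := hf (nrG s0 t0).
pose B := r / (r - nr z) + 1.
have B1 : 1 <= B by rewrite lerDr divr_ge0 ?subr_ge0 ?ltW.
have e'0 : 0 < e / (2 * r * B) by rewrite divr_gt0// !mulr_gt0//; lra.
have [d d0 hd] := hf1 _ e'0.
exists (d / (4 * r)); first by rewrite divr_gt0 ?mulr_gt0.
have [Lm hLm] := complex_primitive 0 S (continuous_real cmu).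
have [ka hka] := complex_primitive 0 twopi cK.
pose c0 := f w0 + f1 * (z - w0).
exists (fun s t => c0 * (Lm s + ka t) + f1 * G s t).
exists (fun s t => c0 * (mu s)%:C%C + f1 * ((mu s)%:C%C * (G s t - z))).
exists (fun s t => c0 * K t + f1 * (K t * (G s t - z))).
move=> s t sS tT; split.
- apply: rderiv_eq (rderivD (rderivZ _ (rderivD (hLm _ sS) (rderiv_cst _ _))) (rderivZ _ (rG1 _ _))) _.
  by rewrite addr0.
- apply: rderiv_eq (rderivD (rderivZ _ (rderivD (rderiv_cst _ _) (hka _ tT))) (rderivZ _ (rG2 _ _))) _.
  by rewrite add0r.
move=> ss0 tt0.
have Gd : nr (G s t - w0) < d.
  apply: le_lt_trans (G_lip _ _ _ _) _; rewrite ltr_pdivlMr ?mulr_gt0// in ss0.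
  by rewrite ltr_pdivlMr ?mulr_gt0// in tt0; nra.
have main : nr (f (G s t) - f w0 - f1 * (G s t - w0)) <= e / B * (`|s - s0| + `|t - t0|).
  apply: le_trans (hd _ Gd) _.
  rewrite (_ : e / B * _ = e / (2 * r * B) * (2 * r * (`|s - s0| + `|t - t0|))); last first.
    by field; rewrite !gt_eqF//; lra.
  by rewrite ler_pM2l// G_lip.
have st0 : 0 <= `|s - s0| + `|t - t0| by rewrite addr_ge0.
split.
  have -> : P s t - (c0 * (mu s)%:C%C + f1 * ((mu s)%:C%C * (G s t - z)))
     = (f (G s t) - f w0 - f1 * (G s t - w0)) * (mu s)%:C%C.
    rewrite /P /c0.
    by move: (G s t) (f (G s t)) (f w0) ((mu s)%:C%C : C) => x1 x2 x3 x4; ring.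
  rewrite nrM nr_real; apply: le_trans (_ : nr (f (G s t) - f w0 - f1 * (G s t - w0)) <= _).
    by rewrite ler_piMr ?nr_ge0.
  apply: le_trans main _; rewrite ler_wpM2r// ler_pdivrMr; last by lra.
  by rewrite ler_peMr// ltW.
have -> : Q s t - (c0 * K t + f1 * (K t * (G s t - z)))
   = (f (G s t) - f w0 - f1 * (G s t - w0)) * K t.
  rewrite /Q /c0.
  by move: (G s t) (f (G s t)) (f w0) (K t) => x1 x2 x3 x4; ring.
rewrite nrM; apply: le_trans (ler_pM _ _ main (K_bound t)) _; rewrite ?nr_ge0//.
rewrite (_ : e / B * (`|s - s0| + `|t - t0|) * (r / (r - nr z)) =
   (e * (`|s - s0| + `|t - t0|)) * ((r / (r - nr z)) / B)); last by field; rewrite !gt_eqF ?subr_gt0//; lra.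
have B0 : 0 < B by lra.
rewrite ler_piMr ?mulr_ge0 ?(ltW e0)// (ler_pdivrMr _ _ B0) mul1r /B.
by rewrite lerDl.
Qed.

(** The integral over the circle does not change while the circle is contracted
    to z, where f may be replaced by its value f z. *)
Lemma cauchy_formula : f z = avg (fun t => f (ze t) * kernel r z t).
Proof.
have QE t : Q 0 t = 'i%C * (f (ze t) * kernel r z t).
  rewrite /Q /G /la /K expr0n addr0 invr1 mul1r.
  by rewrite (_ : z + (ze t - z) = ze t); [ring|ring].
have ck : continuous (kernel r z) by apply: continuous_kernel.
have cfk : continuous (fun t => f (ze t) * kernel r z t).
  apply: ccM ck => t.
  apply: (@continuous_comp _ _ _ ze f); first exact: continuous_ze.
  have [l] : exists l, cdiff f (ze t) l by apply: hf; rewrite nrze.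
  exact: cdiff_continuous.
have i0 : ('i%C : C) != 0 by rewrite eq_complex /= oner_eq0 andbF.
suff : 'i%C * cint (fun t => f (ze t) * kernel r z t) 0 twopi = 'i%C * (f z * cint (kernel r z) 0 twopi).
  move/(mulfI i0); rewrite /avg => ->.
  by rewrite mulrCA -[X in _ * X]/(avg _) (avg_kernel zr) mulr1.
rewrite -(cintZ _ twopi_ge0 cfk).
rewrite (_ : (fun t => 'i%C * (f (ze t) * kernel r z t)) = Q 0); last by apply/funext => t; rewrite QE.
apply/eqP; rewrite -subr_eq0; apply/eqP/nrC0_eq0/le_anti; rewrite nr_ge0 andbT.
have [f1 /cdiff_continuous /(@nr_continuous_at R C C) hc] := hf (ltW zr).
set B := r / (r - nr z).
have B0 : 0 < B by rewrite divr_gt0 ?subr_gt0.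
apply/ler_addgt0Pr => e e0; rewrite add0r.
have e'0 : 0 < e / (2 * B * twopi).
  apply: divr_gt0 e0 _; apply: mulr_gt0 twopi_gt0; by apply: mulr_gt0 B0.
have [d d0 hd] := hc _ e'0.
pose S := 2 * r / d.
have S0 : 0 < S by rewrite !divr_gt0// mulr_gt0.
have laS : la S * (2 * r) < d.
  rewrite /la mulrC ltr_pdivrMr//.
  have -> : 2 * r = d * S by rewrite /S; field; rewrite gt_eqF.
  by rewrite ltr_pM2l//; have := sqr_ge0 (S - 1); nra.
rewrite -(cint_const (ltW S0)).
have -> : 'i%C * (f z * cint (kernel r z) 0 twopi) = f z * cint K 0 twopi.
  by rewrite (cintZ _ twopi_ge0 ck); ring.
set I := _ - _.
have -> : I = cint (fun t => Q S t - f z * K t) 0 twopi.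
  rewrite /I -mulN1r -(cintZ _ twopi_ge0 cK) -(cintZ _ twopi_ge0 (ccM ccC cK)).
  rewrite -(cintD twopi_ge0 (@cQ S) (ccM ccC (ccM ccC cK))).
  by congr cint; apply/funext => t; rewrite mulN1r.
apply: le_trans (@cint_bound _ _ _ _ (e / (2 * B * twopi) * B) twopi_ge0 _ _) _.
- exact: ccB (@cQ S) (ccM ccC cK).
- move=> t _; rewrite /Q -mulrBl nrM; apply: ler_pM; rewrite ?nr_ge0 ?K_bound//.
  apply: ltW; apply: hd; apply: le_lt_trans laS.
  rewrite /G addrC addKr nrM nr_real gtr0_norm; last by have /andP[] := la01 S.
  rewrite ler_pM2l; last by have /andP[] := la01 S.
  exact: nrzez.
by rewrite subr0 le_eqVlt; apply/orP; left; apply/eqP; field; rewrite !gt_eqF ?twopi_gt0.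
Qed.

End CauchyFormula.

End Cauchy.

(** * Holomorphic functions restricted to lines *)
Section DiffEps.
Context {R : realType}.
Local Notation C := (cplx R).

Lemma diff_eps (V W : normedModType C) (f : V -> W) u : differentiable f u ->
  forall e : R, 0 < e -> exists2 d : R, 0 < d &
    forall x, nr (x - u) < d -> nr (f x - f u - 'd f u (x - u)) <= e * nr (x - u).
Proof.
move=> /diff_locally /eqaddoP h e e0.
have e0' : (0 : C) < (e%:C%C : C) by rewrite ltcR.
have /nr_near [d d0 hd] := h _ e0'.
exists d => // x xd; have := hd (x - u); rewrite subr0 => /(_ xd).
by rewrite /= !nrE -rmorphM lecR !fctE /= subrK opprD addrA.
Qed.

(** The bound on L makes it continuous, which the derivative in a normed module
    is required to be. *)
Lemma eps_diff (V W : normedModType C) (f : V -> W) u (L : {linear V -> W}) (K : R) :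
  (forall h, nr (L h) <= K * nr h) ->
  (forall e : R, 0 < e -> exists2 d : R, 0 < d &
    forall x, nr (x - u) < d -> nr (f x - f u - L (x - u)) <= e * nr (x - u)) ->
  differentiable f u /\ forall h, 'd f u h = L h.
Proof.
move=> hK hf.
have cL : continuous L.
  move=> x; apply/nr_continuous_at => e e0.
  have K0 : 0 < `|K| + 1 by rewrite ltr_wpDl.
  exists (e / (`|K| + 1)); first by rewrite divr_gt0.
  move=> y; rewrite ltr_pdivlMr// => hy; rewrite -linearB.
  apply: le_lt_trans (hK _) (le_lt_trans _ hy).
  rewrite mulrC ler_wpM2l ?nr_ge0// (le_trans (ler_norm K))// lerDl//.
have ho : f \o shift u = cst (f u) + L +o_ 0 id.
  apply/eqaddoP => e e0.
  have ie : complex.Im (e : R[i]) = 0 /\ 0 < complex.Re (e : R[i]).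
    by move: e0; rewrite (ltcE (0 : R[i]) e) => /andP[/eqP -> ->].
  have [d d0 hd] := hf _ ie.2.
  apply/nr_near; exists d => // x; rewrite subr0 => xd.
  have := hd (x + u); rewrite addrK => /(_ xd).
  rewrite !fctE /= opprD addrA !nrE.
  have -> : e = (complex.Re (e : R[i]))%:C%C :> R[i] by move: ie; case: (e) => a b [/= -> _].
  by rewrite -rmorphM lecR.
have dE := diff_unique cL ho.
split; last by move=> h; rewrite dE.
apply/diff_locallyP; rewrite dE; split => //.
Qed.

Lemma differentiable_line (V : normedModType C) (f : V -> C) x h (t : C) :
  differentiable f (x + t *: h) ->
  cdiff (fun s : C => f (x + s *: h)) t ('d f (x + t *: h) h).
Proof.
move=> df e e0.
have e1 : 0 < e / (nr h + 1) by rewrite divr_gt0// ltr_wpDl ?nr_ge0.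
have [d d0 hd] := diff_eps df e1.
have h1 : 0 < nr h + 1 by rewrite ltr_wpDl ?nr_ge0.
exists (d / (nr h + 1)); first by rewrite divr_gt0.
move=> s; rewrite ltr_pdivlMr// => hs.
have E : x + s *: h - (x + t *: h) = (s - t) *: h by rewrite opprD addrACA subrr add0r -scalerBl.
have := hd (x + s *: h); rewrite E nrZ => /(_ _)/wrap[].
  apply: le_lt_trans hs; rewrite ler_wpM2l ?nr_ge0// lerDl//.
rewrite linearZ /= [(s - t) *: _]mulrC => /le_trans; apply.
rewrite -mulrA [(_ + 1)^-1 * _]mulrCA ler_pM2l// ler_piMr ?nr_ge0//.
by rewrite ler_pdivrMl// mulr1 lerDl.
Qed.
End DiffEps.

Section Chain.
Context {R : realType}.
Local Notation C := (cplx R).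
Local Notation ReC := (@complex.Re R).
Local Notation ImC := (@complex.Im R).

Lemma is_derive_eps (g : R -> R) (t l : R) :
  is_derive t 1 g l <-> forall e : R, 0 < e -> exists2 d : R, 0 < d &
    forall s, `|s - t| < d -> `|g s - g t - l * (s - t)| <= e * `|s - t|.
Proof.
split.
  move=> [/derivable_nbhs + <-] => /eqaddoP h e e0.
  have /nbhs_normP [d /= d0 hd] := h e e0.
  exists d => // s sd; have := hd (s - t); rewrite /ball_ /= sub0r normrN => /(_ sd).
  by rewrite !fctE /= [(s - t) *: 1]mulr1 subrK opprD addrA [(s - t) *: _]mulrC.
move=> h.
have cv : (fun x => x^-1 *: ((g \o shift t) (x *: 1) - g t)) @ 0^' --> l.
  apply/cvgrPdist_le => e e0; have [d d0 hd] := h e e0.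
  near=> x.
  have x0 : x != 0 by near: x; exact: nbhs_dnbhs_neq.
  have xd : `|x| < d by near: x; apply: dnbhs0_lt.
  have := hd (x + t); rewrite addrK => /(_ xd) hx.
  rewrite /= [x *: 1]mulr1 distrC.
  have -> : x^-1 *: (g (x + t) - g t) - l = x^-1 * (g (x + t) - g t - l * x).
    by rewrite mulrBr mulrCA mulVf// mulr1.
  by rewrite normrM normfV ler_pdivrMl ?normr_gt0// (mulrC `|x|).
split; first by apply/cvg_ex; exists l.
exact: cvg_lim cv.
Unshelve. all: by end_near. Qed.

Lemma Re_lin (a b l : C) (x : R) : ReC (a - b - l * x%:C%C) = ReC a - ReC b - ReC l * x.
Proof. by move: a b l => [a a'] [b b'] [l l'] /=; ring. Qed.
Lemma Im_lin (a b l : C) (x : R) : ImC (a - b - l * x%:C%C) = ImC a - ImC b - ImC l * x.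
Proof. by move: a b l => [a a'] [b b'] [l l'] /=; ring. Qed.

Lemma rderiv_eps (g : R -> C) (t : R) (l : C) :
  rderiv g t l <-> forall e : R, 0 < e -> exists2 d : R, 0 < d &
    forall s, `|s - t| < d -> nr (g s - g t - l * (s - t)%:C%C) <= e * `|s - t|.
Proof.
have RE s : ReC (g s - g t - l * (s - t)%:C%C) = ReC (g s) - ReC (g t) - ReC l * (s - t).
  exact: Re_lin.
have IE s : ImC (g s - g t - l * (s - t)%:C%C) = ImC (g s) - ImC (g t) - ImC l * (s - t).
  exact: Im_lin.
split.
  move=> [/is_derive_eps hr /is_derive_eps hi] e e0.
  have e2 : 0 < e / 2 by lra.
  have [d d0 hd] := hr _ e2; have [d' d'0 hd'] := hi _ e2.
  exists (Num.min d d'); first by rewrite lt_min d0.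
  move=> s; rewrite lt_min => /andP[h1 h2].
  apply: le_trans (nr_le_ReIm _) _; rewrite RE IE.
  by have := hd _ h1; have := hd' _ h2; lra.
move=> h; split; apply/is_derive_eps => e /h [d d0 hd]; exists d => // s /hd.
  by apply: le_trans; rewrite -RE Re_le_nr.
by apply: le_trans; rewrite -IE Im_le_nr.
Qed.

Lemma rderiv_comp (f : C -> C) (g : R -> C) (t : R) (l m : C) :
  cdiff f (g t) l -> rderiv g t m -> rderiv (f \o g) t (l * m).
Proof.
move=> hf /rderiv_eps hg; apply/rderiv_eps => e e0.
set A := nr m + 1; set B := nr l + 1.
have A0 : 0 < A by rewrite ltr_wpDl ?nr_ge0.
have B0 : 0 < B by rewrite ltr_wpDl ?nr_ge0.
have eA : 0 < e / 2 / A by rewrite divr_gt0//; lra.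
have eB : 0 < e / 2 / B by rewrite divr_gt0//; lra.
have [d d0 hd] := hf _ eA.
have [d1 d10 hd1] := hg _ eB; have [d2 d20 hd2] := hg _ ltr01.
exists (Num.min (Num.min d1 d2) (d / A)).
  by rewrite !lt_min d10 d20 divr_gt0.
move=> s; rewrite !lt_min ltr_pdivlMr// => /andP[/andP[s1 s2] s3].
have gl : nr (g s - g t) <= A * `|s - t|.
  rewrite (_ : g s - g t = (g s - g t - m * (s - t)%:C%C) + m * (s - t)%:C%C); last by rewrite subrK.
  apply: le_trans (nrD _ _) _; rewrite nrM nr_real /A mulrDl addrC lerD2l.
  exact: hd2.
have gd : nr (g s - g t) < d by apply: le_lt_trans gl _; rewrite mulrC.
rewrite /= (_ : _ - _ = (f (g s) - f (g t) - l * (g s - g t)) + l * (g s - g t - m * (s - t)%:C%C)); last first.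
  by move: (f (g s)) (f (g t)) (g s) (g t) ((s - t)%:C%C : C) => x1 x2 x3 x4 x5; ring.
apply: le_trans (nrD _ _) _; rewrite nrM.
have h1 : nr (f (g s) - f (g t) - l * (g s - g t)) <= e / 2 * `|s - t|.
  apply: le_trans (hd _ gd) _.
  rewrite (_ : e / 2 * `|s - t| = e / 2 / A * (A * `|s - t|)); last by field; rewrite gt_eqF.
  by rewrite ler_pM2l.
have h2 : nr l * nr (g s - g t - m * (s - t)%:C%C) <= e / 2 * `|s - t|.
  rewrite (_ : e / 2 * `|s - t| = B * (e / 2 / B * `|s - t|)); last by field; rewrite gt_eqF.
  by apply: ler_pM; rewrite ?nr_ge0 ?hd1// /B lerDl.
by rewrite (_ : e * _ = e / 2 * `|s - t| + e / 2 * `|s - t|) ?lerD//; field.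
Qed.

End Chain.

Section Lines.
Context {R : realType}.
Local Notation C := (cplx R).
Context {V : normedModType C}.
Implicit Types (f : V -> C) (x h : V).

(** The k-th Taylor coefficient at x of f along h, written as a Cauchy integral:
    it makes sense before any higher derivative is known to exist. *)
Definition pc k f x h : C := avg (fun t => f (x + cis t *: h) * icis t ^+ k).

Definition hdisc f x h (M : R) := forall t : C, nr t <= 1 ->
  differentiable f (x + t *: h) /\ nr (f (x + t *: h)) <= M.

Lemma hdisc_cdiff f x h M : hdisc f x h M -> forall t : C, nr t <= 1 ->
  cdiff (fun t : C => f (x + t *: h)) t ('d f (x + t *: h) h).
Proof. by move=> H t /H[df _]; exact: differentiable_line. Qed.

Lemma hdisc_rderiv f x h M : hdisc f x h M -> forall t,
  rderiv (fun t => f (x + cis t *: h)) t ('d f (x + cis t *: h) h * ('i%C * cis t)).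
Proof.
move=> H t; apply: (@rderiv_comp _ (fun t : C => f (x + t *: h)) cis); last exact: rderiv_cis.
by apply: hdisc_cdiff H _ _; rewrite nr_cis.
Qed.

Lemma continuous_icisX k : continuous (fun t : R => icis t ^+ k : C).
Proof. by move=> t; apply: rderiv_continuous (rderiv_icisX k t). Qed.

Lemma hdisc_continuous f x h M : hdisc f x h M -> continuous (fun t : R => f (x + cis t *: h)).
Proof. by move=> H t; apply: rderiv_continuous (hdisc_rderiv H t). Qed.

Lemma hdisc_bound f x h M t : hdisc f x h M -> nr (f (x + cis t *: h)) <= M.
Proof. by move=> H; have [] := H (cis t); rewrite ?nr_cis. Qed.

Lemma nr_icisX k t : nr (icis t ^+ k : C) = 1.
Proof. by rewrite nrX -cisV nrV nr_cis invr1 expr1n. Qed.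

Lemma pc_bound k f x h M : hdisc f x h M -> nr (pc k f x h) <= 2 * M.
Proof.
move=> H; apply: avg_bound; first exact: ccM (hdisc_continuous H) (@continuous_icisX k).
by move=> t; rewrite nrM nr_icisX mulr1 (hdisc_bound _ H).
Qed.

Lemma line_taylor f x h M N (t : C) : hdisc f x h M -> nr t < 1 ->
  nr (f (x + t *: h) - \sum_(k < N) t ^+ k * pc k f x h) <= 2 * (M * nr t ^+ N * (1 - nr t)^-1).
Proof.
move=> H t1.
have H' (w : C) : nr w <= 1 -> exists l, cdiff (fun t : C => f (x + t *: h)) w l.
  by move=> w1; exists ('d f (x + w *: h) h); exact: hdisc_cdiff H _ w1.
rewrite (@cauchy_formula R (fun t : C => f (x + t *: h)) 1 t t1 H').
have E s : (1%:C%C : C) * cis s = cis s by rewrite rmorph1 mul1r.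
have := @avg_kernel_expansion R 1 t t1 (fun t => f (x + cis t *: h)) M N (hdisc_continuous H) (fun t => hdisc_bound t H).
rewrite divr1 div1r.
under [in X in X -> _]eq_bigr => k _.
  under [X in avg X]eq_fun => s do rewrite E cisV.
  over.
by under [in X in _ -> X]eq_fun do rewrite E.
Qed.

Lemma pc0 f x h M : hdisc f x h M -> pc 0 f x h = f x.
Proof.
move=> H; have := @line_taylor f x h M 1 0 H; rewrite nr0 => /(_ ltr01).
rewrite big_ord1 expr0 mul1r scale0r addr0 expr1 mulr0 mul0r mulr0 => h0.
by apply/esym/eqP; rewrite -subr_eq0; apply/eqP/nrC0_eq0/le_anti; rewrite nr_ge0 h0.
Qed.

Lemma hdisc_ge0 f x h M : hdisc f x h M -> 0 <= M.
Proof.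
move=> H; have n0 : nr (0 : C) <= 1 by rewrite nr0.
by have [_] := H 0 n0; apply: le_trans; rewrite nr_ge0.
Qed.

Lemma pc1 f x h M : hdisc f x h M -> pc 1 f x h = 'd f x h.
Proof.
move=> H; apply/eqP; rewrite -subr_eq0; apply/eqP/nrC0_eq0/le_anti; rewrite nr_ge0 andbT.
have M0 := hdisc_ge0 H.
apply/ler_addgt0Pr => e e0; rewrite add0r.
have h0 : nr (0 : C) <= 1 by rewrite nr0.
have e20 : 0 < e / 2 by lra.
have [d d0 hd] := hdisc_cdiff H h0 e20.
pose s := Num.min (Num.min (d / 2) (1 / 2)) (e / (8 * (M + 1))).
have s0 : 0 < s by rewrite !lt_min !divr_gt0// mulr_gt0//; lra.
have sd : s <= d / 2 by rewrite /s !ge_min lexx.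
have s1 : s <= 1 / 2 by rewrite /s !ge_min lexx orbT.
have se : s <= e / (8 * (M + 1)) by rewrite /s !ge_min lexx orbT.
pose t : C := s%:C%C.
have nt : nr t = s by rewrite nr_real gtr0_norm.
have := hd t; rewrite subr0 nt => /(_ _)/wrap[]; first by lra.
rewrite scale0r addr0 => h1.
have := @line_taylor f x h M 2 t H; rewrite nt => /(_ _)/wrap[]; first by lra.
rewrite big_ord_recr big_ord1 /= expr0 expr1 mul1r (pc0 H) => h2.
have t0 : 0 < nr t by rewrite nt.
rewrite -(ler_pM2l t0) -nrM.
rewrite (_ : t * _ = (f (x + t *: h) - f x - 'd f x h * t) - (f (x + t *: h) - (f x + t * pc 1 f x h))); last by ring.
apply: le_trans (nrB _ _) _; apply: le_trans (lerD h1 h2) _; rewrite nt.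
have i2 : (1 - s)^-1 <= 2 by rewrite -[2]invrK lef_pV2 ?posrE ?invr_gt0//; lra.
have h3 : M * s ^+ 2 * (1 - s)^-1 <= M * s ^+ 2 * 2.
  by rewrite ler_wpM2l// mulr_ge0// exprn_ge0// ltW.
rewrite ler_pdivlMr in se; last by lra.
nra.
Qed.

(** Integration by parts over the circle: the derivative of
    f(x + cis t h) icis(t)^(k+1) has mean value zero. *)
Lemma pcS k f x h M M' : hdisc f x h M -> hdisc (fun y => 'D_h f y) x h M' ->
  pc k (fun y => 'D_h f y) x h = k.+1%:R * pc k.+1 f x h.
Proof.
move=> H H'.
pose F t := f (x + cis t *: h) * icis t ^+ k.+1.
have DE t : 'D_h f (x + cis t *: h) = 'd f (x + cis t *: h) h.
  by apply: deriveE; have [] := H (cis t); rewrite ?nr_cis.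
have dF t : rderiv F t ('i%C * ('D_h f (x + cis t *: h) * icis t ^+ k) -
     'i%C * (k.+1%:R * (f (x + cis t *: h) * icis t ^+ k.+1))).
  apply: rderiv_eq (rderivM (hdisc_rderiv H t) (rderiv_icisX k.+1 t)) _.
  rewrite DE exprS.
  have := cisK t; set a := cis t; set b := icis t; set c := 'd f _ _; set e := f _ => ab.
  rewrite (_ : c * ('i%C * a) * (b * b ^+ k) = (a * b) * ('i%C * (c * b ^+ k))); last by ring.
  by rewrite ab; ring.
have c1 : continuous (fun t => 'D_h f (x + cis t *: h) * icis t ^+ k).
  exact: ccM (hdisc_continuous H') (@continuous_icisX k).
have c2 : continuous (fun t => f (x + cis t *: h) * icis t ^+ k.+1).
  exact: ccM (hdisc_continuous H) (@continuous_icisX k.+1).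
have i0 : ('i%C : C) != 0 by rewrite eq_complex /= oner_eq0 andbF.
apply: (mulfI i0); rewrite /pc -(avgZ _ c2) -(avgZ _ c1) -(avgZ _ (ccM ccC c2)).
apply/eqP; rewrite -subr_eq0 -(avgB (ccM ccC c1) (ccM ccC (ccM ccC c2))).
rewrite /avg (@cint_prim R _ 0 twopi F twopi_ge0 (fun t _ => dF t)).
by rewrite /F cis2pi icis2pi subrr mulr0.
Qed.

End Lines.

(** * Cauchy estimates and holomorphy of derivatives *)
Section Balls.
Context {R : realType}.
Local Notation C := (cplx R).
Context {V : normedModType C}.
Implicit Types (f g : V -> C) (u x y h w : V).

Definition hball f u (r M : R) := forall x, nr (x - u) < r -> differentiable f x /\ nr (f x) <= M.

Definition hol f u := \forall x \near u, differentiable f x.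

Lemma hol_hball f u : hol f u -> exists r M, 0 < r /\ hball f u r M.
Proof.
move=> hf; have /nr_near [d d0 hd] := hf.
have /differentiable_continuous/nr_continuous_at/(_ 1 ltr01) [e e0 he] := nbhs_singleton hf.
exists (Num.min d e), (nr (f u) + 1); split; first by rewrite lt_min d0.
move=> x; rewrite lt_min => /andP[xd xe]; split; first exact: hd.
rewrite -[f x](subrK (f u)) addrC; apply: le_trans (nrD _ _) _.
by rewrite lerD2l ltW// he.
Qed.

Lemma hball_hol f u r M : 0 < r -> hball f u r M -> hol f u.
Proof. by move=> r0 H; apply/nr_near; exists r => // x /H[]. Qed.

Lemma hball_hdisc f u r M x h : hball f u r M -> nr (x - u) + nr h < r -> hdisc f x h M.
Proof.
move=> H xh t t1; apply: H; apply: le_lt_trans xh.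
rewrite addrAC; apply: le_trans (nrD _ _) _; rewrite lerD2l nrZ.
by rewrite ler_piMl ?nr_ge0.
Qed.

Lemma hball_ge0 f u r M : 0 < r -> hball f u r M -> 0 <= M.
Proof.
move=> r0 H; have [] := H u; first by rewrite subrr nr0.
by move=> _; apply: le_trans; rewrite nr_ge0.
Qed.

Lemma shrink h (s : R) : 0 < s -> exists2 c : R, 0 < c & nr (c%:C%C *: h) <= s.
Proof.
move=> s0; have h0 : 0 < nr h + 1 by rewrite ltr_wpDl ?nr_ge0.
exists (s / (nr h + 1)); first by rewrite divr_gt0.
rewrite nrZ nr_real gtr0_norm ?divr_gt0//.
by rewrite -mulrA ler_piMr ?(ltW s0)// ler_pdivrMl// mulr1 lerDl.
Qed.

Lemma realC_neq0 (c : R) : 0 < c -> (c%:C%C : C) != 0.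
Proof. by move=> c0; rewrite -nr_gt0 nr_real gtr0_norm. Qed.

(** The expansion along the line of the increment k, rescaled to a direction h of
    norm s: the remainder is then uniform in the direction of k. *)
Lemma taylor_increment f u r M x (s : R) k N : hball f u r M -> 0 < s -> nr (x - u) + s < r ->
  k != 0 -> nr k <= s / 2 ->
  let h := (s / nr k)%:C%C *: k in let t : C := (nr k / s)%:C%C in
  [/\ nr h = s, t *: h = k, hdisc f x h M &
  nr (f (x + k) - \sum_(j < N) t ^+ j * pc j f x h) <= 4 * M / s ^+ N * nr k ^+ N].
Proof.
move=> H s0 xs k0 ks h t.
have nk : 0 < nr k by rewrite nr_gt0.
have nh : nr h = s by rewrite nrZ nr_real gtr0_norm ?divr_gt0// divfK// gt_eqF.
have th : t *: h = k.
  rewrite /t /h scalerA -rmorphM.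
  by rewrite (_ : _ / _ * _ = 1) ?rmorph1 ?scale1r//; field; rewrite !gt_eqF.
have hd : hdisc f x h M by apply: hball_hdisc H _; rewrite nh.
have nt : nr t = nr k / s by rewrite nr_real gtr0_norm ?divr_gt0.
have t1 : nr t <= 1 / 2 by rewrite nt ler_pdivrMr//; lra.
split => //.
rewrite -{1}th; apply: le_trans (line_taylor N hd _) _; first by lra.
rewrite nt expr_div_n in t1 *.
have M0 := hdisc_ge0 hd.
have i2 : (1 - nr k / s)^-1 <= 2 by rewrite -[2]invrK lef_pV2 ?posrE ?invr_gt0//; lra.
rewrite (_ : 4 * M / s ^+ N * nr k ^+ N = 2 * (M * (nr k ^+ N / s ^+ N) * 2)); last first.
  by field; rewrite gt_eqF// exprn_gt0.
have q0 : 0 <= M * (nr k ^+ N / s ^+ N).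
  by apply: mulr_ge0 => //; apply: divr_ge0; apply: exprn_ge0; rewrite ?nr_ge0 ?ltW.
by rewrite ler_pM2l// ler_wpM2l.
Qed.

Lemma hball_lip f u r M x (s : R) k : hball f u r M -> 0 < s -> nr (x - u) + s < r ->
  nr k <= s / 2 -> nr (f (x + k) - f x) <= 4 * M / s * nr k.
Proof.
move=> H s0 xs ks; have [->|k0] := eqVneq k 0.
  by rewrite addr0 subrr !nr0 mulr0.
have [_ _ hd] := taylor_increment 1 H s0 xs k0 ks.
by rewrite big_ord1 expr0 mul1r (pc0 hd) !expr1.
Qed.

Lemma hball_second f u r M x (s : R) k : hball f u r M -> 0 < s -> nr (x - u) + s < r ->
  nr k <= s / 2 -> nr (f (x + k) - f x - 'd f x k) <= 4 * M / s ^+ 2 * nr k ^+ 2.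
Proof.
move=> H s0 xs ks; have [->|k0] := eqVneq k 0.
  by rewrite addr0 subrr linear0 subr0 !nr0 expr0n mulr0.
have [_ th hd] := taylor_increment 2 H s0 xs k0 ks.
rewrite big_ord_recr big_ord1 /= expr0 mul1r expr1 (pc0 hd) (pc1 hd).
by rewrite -[_ * 'd f x _]/(_ *: 'd f x _) -linearZ th opprD addrA.
Qed.

Lemma cauchy_estimate f u r M x (s : R) h : hball f u r M -> 0 < s -> nr (x - u) + s < r ->
  nr ('d f x h) <= 2 * M / s * nr h.
Proof.
move=> H s0 xs; have [->|h0] := eqVneq h 0; first by rewrite linear0 !nr0 mulr0.
have nh : 0 < nr h by rewrite nr_gt0.
pose h' := (s / nr h)%:C%C *: h.
have nh' : nr h' = s by rewrite nrZ nr_real gtr0_norm ?divr_gt0// divfK// gt_eqF.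
have hd : hdisc f x h' M by apply: hball_hdisc H _; rewrite nh'.
have := pc_bound 1 hd; rewrite (pc1 hd) linearZ /= nrM nr_real gtr0_norm ?divr_gt0//.
rewrite mulrAC ler_pdivrMr// mulrC -ler_pdivlMr// => /le_trans; apply.
by rewrite mulrAC.
Qed.

Lemma continuous_diff f u r M y h : hball f u r M -> nr (y - u) < r ->
  {for y, continuous (fun y => 'd f y h)}.
Proof.
move=> H yr; apply/nr_continuous_at => e e0.
pose s := (r - nr (y - u)) / 4.
have s0 : 0 < s by rewrite /s; lra.
have rE : nr (y - u) = r - 4 * s by rewrite /s; field.
have [c c0 nc] := shrink h s0.
have r0 : 0 < r by apply: le_lt_trans yr; exact: nr_ge0.
have M0 := hball_ge0 r0 H.
have K0 : 0 < 2 * (4 * M / s + 1) / c.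
  have A0 : 0 <= 4 * M / s by apply: divr_ge0; [lra|exact: ltW].
  by apply: divr_gt0 => //; apply: mulr_gt0 => //; lra.
exists (Num.min (s / 2) (e / (2 * (4 * M / s + 1) / c))).
  by rewrite lt_min (divr_gt0 e0 K0) andbT; lra.
move=> y'; rewrite lt_min (ltr_pdivlMr _ _ K0) => /andP[ys ye].
have hd : hdisc f y (c%:C%C *: h) M by apply: hball_hdisc H _; lra.
have yu : nr (y' - u) <= nr (y' - y) + nr (y - u) by rewrite -[y' - u](subrKA y) nrD.
have hd' : hdisc f y' (c%:C%C *: h) M by apply: hball_hdisc H _; lra.
have E z : hdisc f z (c%:C%C *: h) M -> 'd f z h = (c%:C%C)^-1 * pc 1 f z (c%:C%C *: h).
  by move=> hz; rewrite (pc1 hz) linearZ /= mulrA mulVf ?realC_neq0// mul1r.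
rewrite (E _ hd) (E _ hd') -mulrBr nrM nrV nr_real (gtr0_norm c0).
have c1 := hdisc_continuous hd; have c2 := hdisc_continuous hd'.
rewrite /pc -(avgB (ccM c2 (@continuous_icisX R 1)) (ccM c1 (@continuous_icisX R 1))).
apply: le_lt_trans ye.
have -> : nr (y' - y) * (2 * (4 * M / s + 1) / c) = c^-1 * (2 * ((4 * M / s + 1) * nr (y' - y))) by ring.
rewrite ler_pM2l ?invr_gt0//; apply: avg_bound.
  exact: ccB (ccM c2 (@continuous_icisX R 1)) (ccM c1 (@continuous_icisX R 1)).
move=> t; rewrite -mulrBl nrM nr_icisX mulr1.
apply: le_trans (_ : 4 * M / s * nr (y' - y) <= _); last first.
  by rewrite ler_wpM2r ?nr_ge0// lerDl.
have -> : y' + cis t *: (c%:C%C *: h) = (y + cis t *: (c%:C%C *: h)) + (y' - y).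
  by rewrite addrAC [y + _]addrC subrK.
apply: hball_lip H s0 _ _; last by lra.
rewrite addrAC; apply: le_lt_trans (lerD (nrD _ _) (lexx _)) _.
by rewrite [nr (cis t *: _)]nrZ nr_cis mul1r; lra.
Qed.

(** The derivative along w is a mean value of f over a circle, and the second
    order estimate [hball_second] allows to differentiate under the mean value.
    The formula for the differential is what makes derivatives commute. *)
Lemma diff_D f u r M x w (s c : R) : hball f u r M -> 0 < s -> nr (x - u) + 4 * s < r ->
  0 < c -> nr (c%:C%C *: w) <= s ->
  differentiable (fun y => 'D_w f y) x /\
  forall h, 'd (fun y => 'D_w f y) x h = (c%:C%C)^-1 * pc 1 (fun y => 'D_h f y) x (c%:C%C *: w).
Proof.
move=> H s0 xs c0 nw; set w' := c%:C%C *: w.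
have r0 : 0 < r by apply: le_lt_trans xs; rewrite addr_ge0 ?nr_ge0// mulr_ge0// ltW.
have M0 := hball_ge0 r0 H.
have cC := realC_neq0 c0.
have ny t : nr (x + cis t *: w' - u) <= nr (x - u) + s.
  by rewrite addrAC; apply: le_trans (nrD _ _) _; rewrite lerD2l nrZ nr_cis mul1r.
have ny2 t : nr (x + cis t *: w' - u) + s < r.
  by apply: le_lt_trans (lerD (ny t) (lexx s)) _; lra.
have cd h : continuous (fun t : R => 'd f (x + cis t *: w') h * icis t ^+ 1).
  apply: ccM (@continuous_icisX R 1) => t.
  apply: (@continuous_comp _ _ _ (fun t => x + cis t *: w') (fun y => 'd f y h)); last first.
    by apply: continuous_diff H _; apply: le_lt_trans (ny t) _; lra.
  apply: cvgD; first exact: cvg_cst.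
  apply: cvgZr_tmp; exact: rderiv_continuous (rderiv_cis t).
pose L h := (c%:C%C)^-1 * avg (fun t => 'd f (x + cis t *: w') h * icis t ^+ 1).
have Llin : linear L.
  move=> a h h'; rewrite /L.
  suff -> : avg (fun t => 'd f (x + cis t *: w') (a *: h + h') * icis t ^+ 1) =
     a * avg (fun t => 'd f (x + cis t *: w') h * icis t ^+ 1) +
     avg (fun t => 'd f (x + cis t *: w') h' * icis t ^+ 1).
    by rewrite mulrDr; congr (_ + _); exact: mulrCA.
  rewrite -(avgZ a (cd h)) -(avgD (ccM ccC (cd h)) (cd h')).
  congr avg; apply/funext => t; rewrite linearP /= mulrDl.
  by rewrite -[a *: _]/(a * _) mulrA.
pose Ll : {linear V -> C} := HB.pack L (GRing.isLinear.Build _ _ _ _ L Llin).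
have [||dD dE] := @eps_diff R V C (fun y => 'D_w f y) x Ll (c^-1 * (2 * (2 * M / s))).
- move=> h; rewrite /Ll /= /L nrM nrV nr_real (gtr0_norm c0).
  rewrite (_ : c^-1 * _ * nr h = c^-1 * (2 * (2 * M / s * nr h))); last by ring.
  rewrite ler_pM2l ?invr_gt0//; apply: avg_bound; first exact: cd.
  move=> t; rewrite nrM nr_icisX mulr1.
  exact: cauchy_estimate H s0 (ny2 t).
- have E y : nr (y - x) < s -> 'D_w f y = (c%:C%C)^-1 * pc 1 f y w' /\ hdisc f y w' M.
    move=> yx.
    have yu : nr (y - u) <= nr (y - x) + nr (x - u) by rewrite -[y - u](subrKA x) nrD.
    have hd : hdisc f y w' M by apply: hball_hdisc H _; lra.
    split=> //; rewrite (pc1 hd) linearZ /= mulrA mulVf// mul1r deriveE//.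
    by have [] := H y; first by lra.
  move=> e e0.
  pose K := c^-1 * (2 * (4 * M / s ^+ 2)) + 1.
  have K0 : 0 < K.
    by rewrite ltr_wpDl// mulr_ge0 ?invr_ge0 ?(ltW c0)// mulr_ge0// divr_ge0 ?exprn_ge0 ?(ltW s0)// mulr_ge0.
  exists (Num.min (s / 2) (e / K)); first by rewrite lt_min (divr_gt0 e0 K0) andbT; lra.
  move=> y; rewrite lt_min (ltr_pdivlMr _ _ K0) => /andP[ys ye].
  have [|-> hd] := E y; first by lra.
  have [|-> hx] := E x; first by rewrite subrr nr0.
  rewrite /Ll /= /L -mulrBr -mulrBr nrM nrV nr_real (gtr0_norm c0).
  have c1 := ccM (hdisc_continuous hd) (@continuous_icisX R 1).
  have c2 := ccM (hdisc_continuous hx) (@continuous_icisX R 1).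
  rewrite /pc -(avgB c1 c2) -(avgB (ccB c1 c2) (cd _)).
  apply: le_trans (_ : c^-1 * (2 * (4 * M / s ^+ 2 * nr (y - x) ^+ 2)) <= _).
    rewrite ler_pM2l ?invr_gt0//; apply: avg_bound; first exact: ccB (ccB c1 c2) (cd _).
    move=> t; rewrite -!mulrBl nrM nr_icisX mulr1.
    have -> : y + cis t *: w' = (x + cis t *: w') + (y - x) by rewrite addrAC [x + _]addrC subrK.
    by apply: hball_second H s0 (ny2 t) _; apply: ltW.
  rewrite (_ : c^-1 * _ = (c^-1 * (2 * (4 * M / s ^+ 2)) * nr (y - x)) * nr (y - x)); last by ring.
  rewrite ler_wpM2r ?nr_ge0//; apply: le_trans (ltW ye).
  by rewrite mulrC ler_wpM2l ?nr_ge0// lerDl.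
split=> // h; rewrite dE /Ll /= /L /pc; congr (_ * avg _); apply/funext => t.
rewrite deriveE//; have [] // := H (x + cis t *: w').
by apply: le_lt_trans (ny2 t); rewrite lerDl ltW.
Qed.

Lemma D_hball f u r M w : 0 < r -> hball f u r M -> exists M', hball (fun y => 'D_w f y) u (r / 2) M'.
Proof.
move=> r0 H; exists (2 * M / (r / 4) * nr w) => x xr.
have s0 : 0 < r / 8 by lra.
have [c c0 cw] := shrink w s0.
have xs : nr (x - u) + 4 * (r / 8) < r by lra.
have [dD _] := diff_D H s0 xs c0 cw.
have [|dx _] := H x; first by lra.
split; [exact: dD|rewrite deriveE//].
by apply: cauchy_estimate H _ _; lra.
Qed.

Lemma hol_D f u w : hol f u -> hol (fun y => 'D_w f y) u.
Proof.
move=> /hol_hball [r [M [r0 H]]]; have [M' H'] := D_hball w r0 H.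
by apply: hball_hol H'; lra.
Qed.

Lemma D_commute f u v w : hol f u ->
  'D_v (fun y => 'D_w f y) u = 'D_w (fun y => 'D_v f y) u.
Proof.
move=> /hol_hball [r [M [r0 H]]].
have [M' H'] := D_hball v r0 H.
have s0 : 0 < r / 16 by lra.
have [c c0 cw] := shrink w s0.
have us : nr (u - u) + 4 * (r / 16) < r by rewrite subrr nr0; lra.
have [dw dE] := diff_D H s0 us c0 cw.
have u2 : nr (u - u) < r / 2 by rewrite subrr nr0; lra.
have hd : hdisc (fun y => 'D_v f y) u (c%:C%C *: w) M'.
  by apply: hball_hdisc H' _; rewrite subrr nr0; lra.
have [dv _] := H' u u2.
apply: etrans (deriveE v dw) _; apply: etrans (dE v) _.
apply: etrans _ (esym (deriveE w dv)).
move: (pc 1 _ u _) (pc1 hd) => p -> {dw dE}.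
move: ('d _ u) => L.
by rewrite linearZ /= mulrA mulVf ?realC_neq0// mul1r.
Qed.

End Balls.

(** * Orders of vanishing and homogeneous parts *)
Section Orders.
Context {R : realType}.
Local Notation C := (cplx R).
Context {V : normedModType C}.
Implicit Types (f g : V -> C) (u x y h v w : V).

(* Directional derivatives are locked: unification would otherwise unfold the
   limits that define them. *)
Fact dd_key : unit. Proof. exact: tt. Qed.
Definition dd v f : V -> C := locked_with dd_key (fun x => 'D_v f x).
Lemma dd_unlock v f : dd v f = (fun x => 'D_v f x).
Proof. by rewrite /dd unlock. Qed.

Lemma hol_dd v f u : hol f u -> hol (dd v f) u.
Proof. by rewrite dd_unlock; exact: hol_D. Qed.

Lemma hol_near f u : hol f u -> \forall x \near u, hol f x.
Proof. exact: near_join. Qed.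

Lemma hol_at f u : hol f u -> differentiable f u.
Proof. exact: nbhs_singleton. Qed.

Lemma hol_cst (c : C) u : hol (fun _ : V => c) u.
Proof. by apply: nearW => x; exact: differentiable_cst. Qed.

Lemma hol_add f g u : hol f u -> hol g u -> hol (fun x => f x + g x) u.
Proof. by apply: filterS2 => x; exact: differentiableD. Qed.

Lemma hol_mul f g u : hol f u -> hol g u -> hol (fun x => f x * g x) u.
Proof. by apply: filterS2 => x; exact: differentiableM. Qed.

Lemma hol_sum I (s : seq I) (P : pred I) (F : I -> V -> C) u :
  (forall i, hol (F i) u) -> hol (fun x => \sum_(i <- s | P i) F i x) u.
Proof.
move=> h; elim: s => [|i s IH].
  by under eq_fun do rewrite big_nil; exact: hol_cst.
under eq_fun do rewrite big_cons.
by case: (P i) => //; exact: hol_add.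
Qed.

Lemma hol_prod I (s : seq I) (P : pred I) (F : I -> V -> C) u :
  (forall i, hol (F i) u) -> hol (fun x => \prod_(i <- s | P i) F i x) u.
Proof.
move=> h; elim: s => [|i s IH].
  by under eq_fun do rewrite big_nil; exact: hol_cst.
under eq_fun do rewrite big_cons.
by case: (P i) => //; exact: hol_mul.
Qed.

(** Differentiability is defined through the value of a limit, so that passing
    to a function that agrees nearby goes through the epsilon-delta form. *)
Lemma hol_hball_eq f g u : (\forall x \near u, f x = g x) -> hol f u -> hol g u.
Proof.
move=> fg hf.
have fg' := near_join fg.
near=> x.
have h1 : \forall y \near x, f y = g y by near: x.
have h2 : differentiable f x by near: x.
have [K hK] : exists K : R, forall h, nr ('d f x h) <= K * nr h.
  have hx : hol f x by near: x; exact: hol_near.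
  have [r [M [r0 H]]] := hol_hball hx.
  exists (2 * M / (r / 2)) => h; apply: cauchy_estimate H _ _; first by lra.
  by rewrite subrr nr0; lra.
have [//|] := @eps_diff R V C g x ('d f x) K hK.
move=> e e0; have [d d0 hd] := diff_eps h2 e0.
have /nr_near [d' d'0 hd'] := h1.
exists (Num.min d d'); first by rewrite lt_min d0.
move=> y; rewrite lt_min => /andP[yd yd'].
rewrite -(hd' _ yd') -(hd' x) ?subrr ?nr0//; exact: hd.
Unshelve. all: by end_near. Qed.

Lemma near_dd v f g u : (\forall x \near u, f x = g x) -> \forall x \near u, dd v f x = dd v g x.
Proof. by move=> /near_join; rewrite !dd_unlock; apply: filterS => x h; exact: near_eq_derive. Qed.

Lemma ddE v f x : differentiable f x -> dd v f x = 'd f x v.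
Proof. by rewrite dd_unlock; exact: deriveE. Qed.

Lemma dd_lin v f g (c : C) u : hol f u -> hol g u ->
  \forall x \near u, dd v (fun y => f y + c * g y) x = dd v f x + c * dd v g x.
Proof.
apply: filterS2 => x df dg.
have d1 : derivable f x v by exact: diff_derivable.
have d2 : derivable g x v by exact: diff_derivable.
have d3 : derivable (c \*: g) x v by exact: derivableZ.
rewrite !dd_unlock.
by apply: etrans (deriveD d1 d3) _; rewrite (deriveZ c d2).
Qed.

Lemma dd_dir (c : C) v w f u : hol f u ->
  \forall x \near u, dd (v + c *: w) f x = dd v f x + c * dd w f x.
Proof.
by apply: filterS => x df; rewrite !(ddE _ df) linearD linearZ.
Qed.

Lemma dd_scale (c : C) w f u : hol f u -> \forall x \near u, dd (c *: w) f x = c * dd w f x.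
Proof. by apply: filterS => x df; rewrite !(ddE _ df) linearZ. Qed.

Lemma dd_commute v w f u : hol f u -> \forall x \near u, dd v (dd w f) x = dd w (dd v f) x.
Proof. by move=> /hol_near; apply: filterS => x; rewrite !dd_unlock; exact: D_commute. Qed.

Definition dn k v f := iter k (dd v) f.

Lemma dnSr k v f : dn k.+1 v f = dn k v (dd v f).
Proof. exact: iterSr. Qed.

Lemma hol_dn k v f u : hol f u -> hol (dn k v f) u.
Proof. by move=> hf; elim: k => //= k; exact: hol_dd. Qed.

Lemma near_dn k v f g u : (\forall x \near u, f x = g x) -> \forall x \near u, dn k v f x = dn k v g x.
Proof. by move=> fg; elim: k => //= k; exact: near_dd. Qed.

Lemma near_trans (F G H : V -> C) u : (\forall x \near u, F x = G x) ->
  (\forall x \near u, G x = H x) -> \forall x \near u, F x = H x.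
Proof. by apply: filterS2 => x -> ->. Qed.

Lemma dn_lin k v f g (c : C) u : hol f u -> hol g u ->
  \forall x \near u, dn k v (fun y => f y + c * g y) x = dn k v f x + c * dn k v g x.
Proof.
move=> hf hg; elim: k => [|k IH]; first exact: nearW.
rewrite /=; apply: near_trans (near_dd v IH) _.
by apply: dd_lin; exact: hol_dn.
Qed.

Lemma dn_cst0 k v x : dn k v (fun=> 0) x = 0.
Proof.
have -> : dn k v (fun=> 0) = (fun=> 0); last by [].
elim: k => //= k ->; apply/funext => y.
rewrite (ddE _ (differentiable_cst (0 : C) y)).
by rewrite (diff_cst (0 : C) y).
Qed.

Lemma dn_mul k v f (c : C) u : hol f u -> \forall x \near u, dn k v (fun y => c * f y) x = c * dn k v f x.
Proof.
move=> hf; have := dn_lin k v c (hol_cst 0 u) hf; apply: filterS => x.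
rewrite dn_cst0 add0r => <-; congr (dn k v _ x).
by apply/funext => y; rewrite add0r.
Qed.

Lemma dn_scale k (c : C) v f u : hol f u -> \forall x \near u, dn k (c *: v) f x = c ^+ k * dn k v f x.
Proof.
elim: k f => [|k IH] f hf; first by apply: nearW => x; rewrite mul1r.
rewrite !dnSr.
apply: near_trans (near_dn k _ (dd_scale c v hf)) _.
apply: near_trans (dn_mul k (c *: v) c (hol_dd v hf)) _.
have := IH _ (hol_dd v hf); apply: filterS => x ->.
by rewrite exprS mulrA.
Qed.

(** The k-th differential is a homogeneous polynomial; its restrictions to
    affine lines are all that genericity arguments need, and avoid polynomials
    in several variables. *)
Lemma dn_poly k v w f u : hol f u -> exists p : {poly C}, forall t : C, dn k (v + t *: w) f u = p.[t].
Proof.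
elim: k f => [|k IH] f hf; first by exists (f u)%:P => t; rewrite hornerC.
have [p hp] := IH _ (hol_dd v hf); have [q hq] := IH _ (hol_dd w hf).
exists (p + 'X * q) => t; rewrite hornerD hornerM hornerX -hp -hq.
rewrite dnSr.
have h1 := near_dn k (v + t *: w) (dd_dir t v w hf).
have h2 := dn_lin k (v + t *: w) t (hol_dd v hf) (hol_dd w hf).
exact: etrans (nbhs_singleton h1) (nbhs_singleton h2).
Qed.

Lemma pc_dn k f u r M h : hball f u r M -> nr h < r / 2 ^+ k ->
  pc k f u h = dn k h f u / (k`!)%:R.
Proof.
elim: k f r M => [|k IH] f r M H hr.
  rewrite fact0 divr1; apply: (pc0 (M := M)).
  by apply: hball_hdisc H _; rewrite subrr nr0 add0r -[r]divr1 -(expr0 2).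
have r0 : 0 < r.
  have : 0 < r / 2 ^+ k.+1 by apply: le_lt_trans hr; exact: nr_ge0.
  by rewrite pmulr_lgt0// invr_gt0 exprn_gt0.
have [M' H'] := D_hball h r0 H.
have r2 : r / 2 ^+ k.+1 <= r / 2.
  by rewrite ler_pM2l// lef_pV2 ?posrE ?exprn_gt0// exprS ler_peMr// exprn_ege1//; lra.
have hd : hdisc f u h M by apply: hball_hdisc H _; rewrite subrr nr0 add0r; lra.
have hd' : hdisc (fun y => 'D_h f y) u h M' by apply: hball_hdisc H' _; rewrite subrr nr0 add0r; lra.
have k0 : (k.+1%:R : C) != 0 by rewrite pnatr_eq0.
apply: (mulfI k0); rewrite -(pcS k hd hd') -dd_unlock; rewrite -dd_unlock in H'; rewrite (IH _ _ _ H'); last first.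
  by move: hr; rewrite exprS invfM mulrA.
rewrite factS natrM invfM dnSr.
by rewrite [RHS]mulrCA mulVKf.
Qed.

(** Vanishing to order at least k, as a growth estimate: this form is stable
    under products and sums, and [taylor_ordP] relates it to Taylor coefficients. *)
Definition ord_ge f u (k : nat) := exists K r : R, 0 < r /\
  forall x, nr (x - u) < r -> nr (f x) <= K * nr (x - u) ^+ k.

Lemma ord_ge0 f u : hol f u -> ord_ge f u 0.
Proof.
move=> /hol_hball [r [M [r0 H]]]; exists M, r; split => // x /H[_].
by rewrite expr0 mulr1.
Qed.

Lemma ord_ge_gt0 f u k : ord_ge f u k -> exists K r : R, [/\ 0 < K, 0 < r &
  forall x, nr (x - u) < r -> nr (f x) <= K * nr (x - u) ^+ k].
Proof.
move=> [K [r [r0 h]]]; exists (`|K| + 1), r; split; [by rewrite ltr_wpDl|by []|].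
move=> x /h /le_trans; apply; rewrite ler_wpM2r ?exprn_ge0 ?nr_ge0//.
by rewrite (le_trans (ler_norm K))// lerDl.
Qed.

Lemma ord_ge_val f u k : ord_ge f u k.+1 -> f u = 0.
Proof.
move=> [K [r [r0 h]]]; have := h u; rewrite subrr nr0 => /(_ r0).
rewrite exprS mul0r mulr0 => h0.
by apply/nrC0_eq0/le_anti; rewrite h0 nr_ge0.
Qed.

Lemma ord_ge_near f g u k : (\forall x \near u, f x = g x) -> ord_ge f u k -> ord_ge g u k.
Proof.
move=> /nr_near [d d0 hd] [K [r [r0 h]]]; exists K, (Num.min r d); split; first by rewrite lt_min r0.
by move=> x; rewrite lt_min => /andP[xr xd]; rewrite -hd// h.
Qed.

(** Cauchy estimates on balls whose radius is comparable to the distance to the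
    center lose exactly one power of this distance. *)
Lemma ord_ge_dd v f u k : hol f u -> ord_ge f u k.+1 -> ord_ge (dd v f) u k.
Proof.
move=> hf /ord_ge_gt0 [K [r [K0 r0 h]]].
have [d d0 hd] := (nr_near _ _).1 hf.
pose A := K * 2 ^+ k.+1.
have A0 : 0 < A by rewrite mulr_gt0// exprn_gt0.
(* off the center, use the ball of radius |x - u| / 2 around x *)
have off x : x != u -> nr (x - u) < Num.min (r / 2) (d / 2) ->
    nr (dd v f x) <= (2 * A / (1 / 2)) * nr v * nr (x - u) ^+ k.
  move=> xu; rewrite lt_min => /andP[xr xd].
  have p0 : 0 < nr (x - u) by rewrite nr_gt0 subr_eq0.
  set p := nr (x - u) in p0 xr xd *.
  have H : hball f x p (K * (2 * p) ^+ k.+1).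
    move=> y yx; have yu : nr (y - u) < 2 * p.
      apply: le_lt_trans (_ : nr (y - x) + p < _); last by lra.
      by rewrite -[y - u](subrKA x) nrD.
    split; first by apply: hd; lra.
    apply: le_trans (h _ _) _; first by lra.
    by rewrite ler_pM2l// lerXn2r ?nnegrE ?nr_ge0//; [lra|exact: ltW].
  rewrite ddE; last by apply: hd; rewrite -/p; lra.
  have p2 : 0 < p / 2 by lra.
  have := @cauchy_estimate R V f x p _ x (p / 2) v H p2; rewrite subrr nr0 => /(_ _)/wrap[]; first by lra.
  move=> /le_trans; apply; rewrite le_eqVlt; apply/orP; left; apply/eqP.
  by rewrite /A exprMn [p ^+ k.+1]exprS; field; rewrite gt_eqF.
have m0 : 0 < Num.min (r / 2) (d / 2) by rewrite lt_min !divr_gt0.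
case: k A A0 off h => [|k] A A0 off h.
  exists (Num.max ((2 * A / (1 / 2)) * nr v) (nr (dd v f u))), (Num.min (r / 2) (d / 2)); split => //.
  move=> x xr; have [->|xu] := eqVneq x u; first by rewrite expr0 mulr1 le_max lexx orbT.
  by apply: le_trans (off _ xu xr) _; rewrite !expr0 !mulr1 le_max lexx.
exists ((2 * A / (1 / 2)) * nr v), (Num.min (r / 2) (d / 2)); split => //.
move=> x xr; have [->|xu] := eqVneq x u; last exact: off.
rewrite subrr nr0 exprS mul0r mulr0.
(* at the center, balls of radius s give a derivative of size O(s) *)
have du : differentiable f u by exact: hol_at.
rewrite (ddE _ du); apply/ler_addgt0Pr => e e0; rewrite add0r.
pose B := 4 * K * nr v + 1.
have B0 : 0 < B by rewrite ltr_wpDl// mulr_ge0 ?nr_ge0// mulr_ge0// ltW.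
pose s := Num.min (Num.min r d) (Num.min 1 (e / B)).
have s0 : 0 < s by rewrite !lt_min r0 d0 ltr01 divr_gt0.
have sr : s <= r by rewrite /s !ge_min lexx.
have sd : s <= d by rewrite /s !ge_min lexx orbT.
have s1 : s <= 1 by rewrite /s !ge_min lexx !orbT.
have se : s <= e / B by rewrite /s !ge_min lexx !orbT.
have H : hball f u s (K * s ^+ k.+2).
  move=> y yu; split; first by apply: hd; lra.
  apply: le_trans (h _ _) _; first by lra.
  by rewrite ler_pM2l// lerXn2r ?nnegrE ?nr_ge0 ?ltW.
have s2 : 0 < s / 2 by lra.
have := @cauchy_estimate R V f u s _ u (s / 2) v H s2; rewrite subrr nr0 => /(_ _)/wrap[]; first by lra.
move=> /le_trans; apply.
rewrite (_ : 2 * _ / _ * _ = s * (s ^+ k * (4 * K * nr v))); last by rewrite !exprS; field; rewrite gt_eqF.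
rewrite ler_pdivlMr// in se; apply: le_trans se; rewrite ler_pM2l//.
apply: le_trans (_ : 4 * K * nr v <= _); last by rewrite /B lerDl.
rewrite ler_piMl ?mulr_ge0 ?nr_ge0 ?(ltW K0)//.
by apply: exprn_ile1 => //; exact: ltW.
Qed.

Lemma ord_ge_dn v f u k j : hol f u -> (j < k)%N -> ord_ge f u k -> dn j v f u = 0.
Proof.
move=> hf jk; have -> : k = ((k - j).-1.+1 + j)%N by rewrite prednK ?subn_gt0// subnK// ltnW.
move: (k - j).-1 => l {k jk} ho.
apply: (@ord_ge_val _ _ l); elim: j l ho => [|j IH] l; first by rewrite addn0.
rewrite addnS -addSn => /IH h; apply: ord_ge_dd => //; exact: hol_dn.
Qed.

Lemma ord_geS f u k : ord_ge f u k.+1 -> ord_ge f u k.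
Proof.
move=> /ord_ge_gt0 [K [r [K0 r0 h]]]; exists K, (Num.min r 1); split; first by rewrite lt_min r0 ltr01.
move=> x; rewrite lt_min => /andP[xr x1]; apply: le_trans (h _ xr) _.
by rewrite ler_pM2l// exprS ler_piMl ?exprn_ge0 ?nr_ge0// ltW.
Qed.

Lemma ord_ge_le f u j k : (j <= k)%N -> ord_ge f u k -> ord_ge f u j.
Proof.
move=> /subnKC <-; elim: (k - j)%N => [|l IH]; first by rewrite addn0.
by rewrite addnS => /ord_geS.
Qed.

Lemma ord_geP f u k : hol f u -> (forall j v, (j < k)%N -> dn j v f u = 0) -> ord_ge f u k.
Proof.
move=> /hol_hball [r [M [r0 H]]] h0.
pose s := r / 2 ^+ k / 2.
have rk : 0 < r / 2 ^+ k by rewrite divr_gt0 ?exprn_gt0.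
have s0 : 0 < s by rewrite divr_gt0.
have rkr : r / 2 ^+ k <= r by rewrite ler_pdivrMr ?exprn_gt0// ler_peMr ?(ltW r0)// exprn_ege1//; lra.
have xs : nr (u - u) + s < r by rewrite subrr nr0 add0r /s; lra.
exists (4 * M / s ^+ k), (s / 2); split; first by lra.
move=> x xu; have [x0|x0] := eqVneq (x - u) 0.
  have [k0|k0] := posnP k.
    rewrite k0 !expr0 divr1 mulr1; have [|_ h1] := H x; first by rewrite /s in xu; lra.
    by apply: le_trans h1 _; have := hball_ge0 r0 H; lra.
  have -> : x = u by apply/eqP; rewrite -subr_eq0; apply/eqP.
  by rewrite (h0 0%N 0 k0 : f u = 0) subrr !nr0 expr0n gtn_eqF// mulr0.
have [nh th hd] := taylor_increment k H s0 xs x0 (ltW xu).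
rewrite big1 ?subr0 ?[u + _]addrC ?subrK// => j _.
rewrite (pc_dn H) ?h0 ?mul0r ?mulr0//.
rewrite nh; apply: lt_le_trans (_ : r / 2 ^+ k <= _); first by rewrite /s; lra.
rewrite ler_pM2l// lef_pV2 ?posrE ?exprn_gt0// ler_weXn2l//; last exact: ltnW.
by lra.
Qed.

Definition hpart k f u v : C := dn k v f u / (k`!)%:R.

Lemma hpart_eq0 k f u v : (hpart k f u v == 0) = (dn k v f u == 0).
Proof. by rewrite mulf_eq0 invr_eq0 pnatr_eq0 eqn0Ngt fact_gt0 orbF. Qed.

(** Along the line through u in the direction v, the lower Taylor terms vanish by
    hypothesis, so that the term of degree k is the first one. *)
Lemma hpart_approx f u v k : hol f u -> ord_ge f u k -> exists K r : R, 0 < r /\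
  forall t : C, nr t < r -> nr (f (u + t *: v) - t ^+ k * hpart k f u v) <= K * nr t ^+ k.+1.
Proof.
move=> hf ho; have [r [M [r0 H]]] := hol_hball hf.
have rk : 0 < r / 2 ^+ k by rewrite divr_gt0 ?exprn_gt0.
have s0 : 0 < r / 2 ^+ k / 2 by rewrite divr_gt0.
have [c c0 hc] := shrink v s0.
have rkr : r / 2 ^+ k <= r by rewrite ler_pdivrMr ?exprn_gt0// ler_peMr ?(ltW r0)// exprn_ege1//; lra.
set h := c%:C%C *: v in hc.
have hd : hdisc f u h M by apply: hball_hdisc H _; rewrite subrr nr0 add0r; lra.
have M0 := hdisc_ge0 hd.
exists (4 * M / c ^+ k.+1), (c / 2); split; first by lra.
move=> t tc; pose t' : C := t / c%:C%C.
have nt' : nr t' = nr t / c by rewrite nrM nrV nr_real gtr0_norm.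
have t'1 : nr t' <= 1 / 2 by rewrite nt' ler_pdivrMr//; lra.
have E : t' *: h = t *: v by rewrite scalerA divfK// realC_neq0.
have := line_taylor k.+1 hd (_ : nr t' < 1) => /(_ _)/wrap[]; first by lra.
rewrite big_ord_recr big1 /= ?add0r; last first.
  move=> j _; rewrite (pc_dn H) ?(ord_ge_dn _ hf _ ho) ?mul0r ?mulr0//.
  apply: le_lt_trans hc _; apply: lt_le_trans (_ : r / 2 ^+ k <= _); first by lra.
  rewrite ler_pM2l// lef_pV2 ?posrE ?exprn_gt0// ler_weXn2l//; last exact: ltnW.
  by lra.
rewrite E (pc_dn H); last by apply: le_lt_trans hc _; lra.
have /nbhs_singleton -> := dn_scale k (c%:C%C : C) v hf.
have -> : t' ^+ k * (c%:C%C ^+ k * dn k v f u / k`!%:R) = t ^+ k * hpart k f u v.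
  have tE : t = t' * (c%:C%C : C) by rewrite divfK// realC_neq0.
  have alg (y a b d : C) : y ^+ k * (a ^+ k * b / d) = (y * a) ^+ k * (b / d) by rewrite exprMn !mulrA.
  by rewrite [t in RHS]tE; exact: alg.
move=> /le_trans; apply; rewrite nt' expr_div_n in t'1 *.
have i2 : (1 - nr t / c)^-1 <= 2 by rewrite -[2]invrK lef_pV2 ?posrE ?invr_gt0//; lra.
rewrite (_ : 4 * M / c ^+ k.+1 * nr t ^+ k.+1 = 2 * (M * (nr t ^+ k.+1 / c ^+ k.+1) * 2)); last first.
  by field; rewrite gt_eqF// exprn_gt0.
have q0 : 0 <= M * (nr t ^+ k.+1 / c ^+ k.+1).
  by apply: mulr_ge0 => //; apply: divr_ge0; apply: exprn_ge0; rewrite ?nr_ge0 ?ltW.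
by rewrite ler_pM2l// ler_wpM2l.
Qed.

End Orders.

(** * Exact orders and lowest degrees *)
Section OrdOps.
Context {R : realType}.
Local Notation C := (cplx R).
Context {V : normedModType C}.
Implicit Types (f g : V -> C) (u x y h v w : V).

Lemma ord_geD f g u k : ord_ge f u k -> ord_ge g u k -> ord_ge (fun x => f x + g x) u k.
Proof.
move=> [K [r [r0 h]]] [K' [r' [r'0 h']]].
exists (K + K'), (Num.min r r'); split; first by rewrite lt_min r0.
move=> x; rewrite lt_min => /andP[/h h1 /h' h2]; apply: le_trans (nrD _ _) _.
by rewrite mulrDl lerD.
Qed.

Lemma ord_geM f g u k l : ord_ge f u k -> ord_ge g u l -> ord_ge (fun x => f x * g x) u (k + l).
Proof.
move=> [K [r [r0 h]]] [K' [r' [r'0 h']]].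
exists (K * K'), (Num.min r r'); split; first by rewrite lt_min r0.
move=> x; rewrite lt_min => /andP[/h h1 /h' h2]; rewrite nrM exprD mulrACA.
by apply: ler_pM; rewrite ?nr_ge0.
Qed.

Lemma ord_ge_cst (c : C) u : ord_ge (fun=> c) u 0.
Proof. by exists (nr c), 1; split => // x _; rewrite expr0 mulr1. Qed.

Lemma ord_ge_zero u k : ord_ge (fun=> 0 : C) u k.
Proof. by exists 0, 1; split => // x _; rewrite nr0 mul0r. Qed.

Lemma ord_geZ (c : C) f u k : ord_ge f u k -> ord_ge (fun x => c * f x) u k.
Proof. by move=> /(ord_geM (ord_ge_cst c u)). Qed.

Lemma ord_geN f u k : ord_ge f u k -> ord_ge (fun x => - f x) u k.
Proof. by move=> [K [r [r0 h]]]; exists K, r; split => // x /h; rewrite nrN. Qed.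

Lemma ord_geB f g u k : ord_ge f u k -> ord_ge g u k -> ord_ge (fun x => f x - g x) u k.
Proof. by move=> hf hg; apply: ord_geD => //; exact: ord_geN. Qed.

Lemma ord_ge_sum I (s : seq I) (P : pred I) (F : I -> V -> C) u k :
  (forall i, P i -> ord_ge (F i) u k) -> ord_ge (fun x => \sum_(i <- s | P i) F i x) u k.
Proof.
move=> h; elim: s => [|i s IH].
  by under eq_fun do rewrite big_nil; exact: ord_ge_zero.
under eq_fun do rewrite big_cons.
by case Pi: (P i) => //; apply: ord_geD => //; exact: h.
Qed.

Lemma ord_ge_prod I (s : seq I) (P : pred I) (F : I -> V -> C) u (k : I -> nat) :
  (forall i, P i -> ord_ge (F i) u (k i)) ->
  ord_ge (fun x => \prod_(i <- s | P i) F i x) u (\sum_(i <- s | P i) k i).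
Proof.
move=> h; elim: s => [|i s IH].
  by under eq_fun do rewrite big_nil; rewrite big_nil; exact: ord_ge_cst.
under eq_fun do rewrite big_cons; rewrite big_cons.
by case Pi: (P i) => //; apply: ord_geM => //; exact: h.
Qed.

Lemma ord_ge_line f u v k : ord_ge f u k -> ord_ge (fun t : C => f (u + t *: v)) (0 : C) k.
Proof.
move=> /ord_ge_gt0 [K [r [K0 r0 h]]].
have v1 : 0 < nr v + 1 by rewrite ltr_wpDl ?nr_ge0.
exists (K * nr v ^+ k), (r / (nr v + 1)); split; first by rewrite divr_gt0.
move=> t; rewrite subr0 ltr_pdivlMr// => ht.
have E : u + t *: v - u = t *: v by rewrite addrC addKr.
apply: le_trans (h _ _) _; rewrite E nrZ.
  by apply: le_lt_trans ht; rewrite ler_wpM2l ?nr_ge0// lerDl.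
by rewrite exprMn -mulrA (mulrC (nr t ^+ k)).
Qed.

Lemma ord_ge_pow k : ord_ge (fun t : C => t ^+ k) (0 : C) k.
Proof. by exists 1, 1; split => // t _; rewrite subr0 nrX mul1r. Qed.

Lemma ord_ge_coef (c : C) k : ord_ge (fun t : C => t ^+ k * c) (0 : C) k.+1 -> c = 0.
Proof.
move=> /ord_ge_gt0 [K [r [K0 r0 h]]].
apply/nrC0_eq0/le_anti; rewrite nr_ge0 andbT; apply/ler_addgt0Pr => e e0; rewrite add0r.
pose s := Num.min (r / 2) (e / K).
have s0 : 0 < s by rewrite lt_min !divr_gt0.
have sr : s <= r / 2 by rewrite /s !ge_min lexx.
have se : s <= e / K by rewrite /s !ge_min lexx orbT.
have ns : nr (s%:C%C : C) = s by rewrite nr_real gtr0_norm.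
have := h (s%:C%C : C); rewrite subr0 ns => /(_ _)/wrap[]; first by lra.
rewrite nrM nrX ns exprS [K * _]mulrA [K * s * _]mulrC ler_pM2l ?exprn_gt0// => /le_trans; apply.
by rewrite mulrC -ler_pdivlMr.
Qed.

End OrdOps.

Section ExactOrder.
Context {R : realType}.
Local Notation C := (cplx R).
Context {V : normedModType C}.
Implicit Types (f g : V -> C) (u x y h v w : V).

Lemma near_all (P : V -> Prop) u : (forall x, P x) -> \forall x \near u, P x.
Proof. exact: nearW. Qed.

Lemma ord_ge_approx f u v k : hol f u -> ord_ge f u k ->
  ord_ge (fun t : C => f (u + t *: v) - t ^+ k * hpart k f u v) (0 : C) k.+1.
Proof.
move=> hf ho; have [K [r [r0 h]]] := hpart_approx v hf ho.
by exists K, r; split => // t; rewrite subr0 => /h.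
Qed.

Definition exact_ord f u e := ord_ge f u e /\ ~ ord_ge f u e.+1.

Lemma exact_ord_hpart f u e : hol f u -> exact_ord f u e -> exists v, hpart e f u v != 0.
Proof.
move=> hf [h1 h2]; apply: contrapT => /forallNP h; apply: h2; apply: ord_geP => // j v.
rewrite ltnS leq_eqVlt => /orP[/eqP ->|je]; last exact: ord_ge_dn hf je h1.
by apply/eqP; rewrite -hpart_eq0; apply: contrapT => /negP; exact: h.
Qed.

Definition line_poly (q : V -> C) := forall v w, exists p : {poly C}, forall t : C, q (v + t *: w) = p.[t].

Lemma hpart_line_poly e f u : hol f u -> line_poly (hpart e f u).
Proof.
move=> hf v w; have [p hp] := dn_poly e v w hf.
exists (p * ((e`!)%:R^-1)%:P) => t; by rewrite hornerM hornerC -hp.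
Qed.

Lemma poly_nonroot (p : {poly C}) : p != 0 -> exists t, p.[t] != 0.
Proof.
move=> p0; apply: contrapT => /forallNP h.
pose s : seq C := [seq i%:R | i <- iota 0 (size p)].
have h1 : all (root p) s.
  by apply/allP => t _; apply/rootP/eqP; apply: contrapT => /negP; exact: h.
have h2 : uniq s.
  by rewrite map_inj_uniq ?iota_uniq// => i j /eqP; rewrite eqr_nat => /eqP.
by have := max_poly_roots p0 h1 h2; rewrite size_map size_iota ltnn.
Qed.

(** Restricted to the line joining the two points, both functions are nonzero
    polynomials in one variable, and so is their product. *)
Lemma line_poly_common (q1 q2 : V -> C) v1 v2 : line_poly q1 -> line_poly q2 ->
  q1 v1 != 0 -> q2 v2 != 0 -> exists v, q1 v != 0 /\ q2 v != 0.
Proof.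
move=> h1 h2 n1 n2; have [p1 hp1] := h1 v1 (v2 - v1); have [p2 hp2] := h2 v1 (v2 - v1).
have p10 : p1 != 0 by apply: contraNneq n1 => p0; rewrite -[v1](addr0) -(scale0r (v2 - v1)) hp1 p0 horner0.
have p20 : p2 != 0.
  by apply: contraNneq n2 => p0; rewrite -[v2](subrK v1) addrC -(scale1r (v2 - v1)) hp2 p0 horner0.
have [t] := poly_nonroot (mulf_neq0 p10 p20).
rewrite hornerM mulf_eq0 negb_or => /andP[t1 t2].
by exists (v1 + t *: (v2 - v1)); rewrite hp1 hp2.
Qed.

Lemma hpartM f g u e e' v : hol f u -> hol g u -> ord_ge f u e -> ord_ge g u e' ->
  ord_ge (fun t : C => f (u + t *: v) * g (u + t *: v) - t ^+ (e + e') * (hpart e f u v * hpart e' g u v))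
    (0 : C) (e + e').+1.
Proof.
move=> hf hg of' og; have af := ord_ge_approx v hf of'; have ag := ord_ge_approx v hg og.
have lf := ord_ge_line v of'.
have h1 := ord_geM lf ag; have h2 := ord_geM af (ord_geZ (hpart e' g u v) (ord_ge_pow e')).
rewrite addnS in h1; rewrite addSn in h2.
have := ord_geD h1 h2; congr (ord_ge _ _ _); apply/funext => t.
by rewrite exprD; move: (f _) (g _) (hpart e f u v) (hpart e' g u v) => a b c d; ring.
Qed.

(** The leading form of the product is the product of the leading forms, which
    is nonzero in a direction common to both. *)
Lemma exact_ordM f g u e e' : hol f u -> hol g u -> exact_ord f u e -> exact_ord g u e' ->
  exact_ord (fun x => f x * g x) u (e + e').
Proof.
move=> hf hg ef eg; have [of' _] := ef; have [og _] := eg.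
split; first exact: ord_geM.
have [v1 n1] := exact_ord_hpart hf ef; have [v2 n2] := exact_ord_hpart hg eg.
have [v [m1 m2]] := line_poly_common (hpart_line_poly e hf) (hpart_line_poly e' hg) n1 n2.
move=> /(ord_ge_line v) h.
have := ord_geB h (hpartM v hf hg of' og).
rewrite (_ : (fun t => _) = (fun t : C => t ^+ (e + e') * (hpart e f u v * hpart e' g u v))); last first.
  by apply/funext => t; rewrite opprB addrC subrK.
by move/ord_ge_coef/eqP; rewrite mulf_eq0 (negbTE m1) (negbTE m2).
Qed.

Lemma exact_ord_cst (c : C) u : c != 0 -> exact_ord (fun=> c) u 0.
Proof.
move=> c0; split; first exact: ord_ge_cst.
by move=> /ord_ge_val /eqP; rewrite (negbTE c0).
Qed.

Lemma exact_ord_prod I (s : seq I) (F : I -> V -> C) u (k : I -> nat) :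
  (forall i, hol (F i) u) -> (forall i, exact_ord (F i) u (k i)) ->
  exact_ord (fun x => \prod_(i <- s) F i x) u (\sum_(i <- s) k i).
Proof.
move=> hF h; elim: s => [|i s IH].
  by under eq_fun do rewrite big_nil; rewrite big_nil; apply: exact_ord_cst; exact: oner_neq0.
under eq_fun do rewrite big_cons; rewrite big_cons.
by apply: exact_ordM => //; exact: hol_prod.
Qed.

Lemma exact_ord_near f g u k : (\forall x \near u, f x = g x) -> exact_ord f u k -> exact_ord g u k.
Proof.
move=> fg [h1 h2]; split; first exact: ord_ge_near h1.
by move=> h; apply: h2; apply: ord_ge_near h; apply: filterS fg => x.
Qed.

Lemma exact_ord_inj f u e e' : exact_ord f u e -> exact_ord f u e' -> e = e'.
Proof.
move=> [h1 h2] [h3 h4]; apply/eqP; rewrite eqn_leq; apply/andP; split; rewrite leqNgt; apply/negP => l.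
  by apply: h4; exact: ord_ge_le h1.
by apply: h2; exact: ord_ge_le h3.
Qed.

(** All Taylor coefficients along every line through u vanish, and the Taylor
    series converges to f on the whole ball. *)
Lemma flat_zero f u r M : hball f u r M -> (forall k, ord_ge f u k) ->
  forall x, nr (x - u) < r -> f x = 0.
Proof.
move=> H ho x xr.
have [x0|x0] := eqVneq (x - u) 0.
  by move/eqP: x0; rewrite subr_eq0 => /eqP ->; exact: ord_ge_val (ho 1%N).
have n0 : 0 < nr (x - u) by rewrite nr_gt0.
pose s := (nr (x - u) + r) / 2.
have sr : s < r by rewrite /s; lra.
have ns : nr (x - u) < s by rewrite /s; lra.
have s0 : 0 < s by lra.
pose h := (s / nr (x - u))%:C%C *: (x - u).
have nh : nr h = s by rewrite nrZ nr_real (gtr0_norm (divr_gt0 s0 n0)) divfK// gt_eqF.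
have hd : hdisc f u h M by apply: hball_hdisc H _; rewrite subrr nr0 add0r nh.
have M0 := hdisc_ge0 hd.
have lt_ord N : ord_ge (fun t : C => f (u + t *: h) - \sum_(k < N) t ^+ k * pc k f u h) (0 : C) N.
  exists (4 * M), (1 / 2); split; first by lra.
  move=> t; rewrite subr0 => t2; apply: le_trans (line_taylor N hd _) _; first by lra.
  have i2 : (1 - nr t)^-1 <= 2 by rewrite -[2]invrK lef_pV2 ?posrE ?invr_gt0//; lra.
  rewrite (_ : 4 * M * nr t ^+ N = 2 * (M * nr t ^+ N * 2)); last by ring.
  by rewrite ler_pM2l// ler_wpM2l// mulr_ge0 ?exprn_ge0 ?nr_ge0.
have pc_0 j : pc j f u h = 0.
  elim/ltn_ind: j => j IH; apply: (@ord_ge_coef R _ j).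
  have := ord_geB (ord_ge_line h (ho j.+1)) (lt_ord j.+1).
  congr (ord_ge _ _ _); apply/funext => t.
  rewrite big_ord_recr big1 /= ?add0r ?opprB ?[_ + (_ - _)]addrC ?subrK//.
  by move=> i _; rewrite IH ?mulr0.
pose t : C := (nr (x - u) / s)%:C%C.
have nt : nr t = nr (x - u) / s by rewrite nr_real (gtr0_norm (divr_gt0 n0 s0)).
have t1 : nr t < 1 by rewrite nt ltr_pdivrMr// mul1r.
have th : t *: h = x - u.
  rewrite /t /h scalerA -rmorphM.
  by rewrite (_ : _ / _ * _ = 1) ?rmorph1 ?scale1r//; field; rewrite !gt_eqF.
have ux : u + t *: h = x by rewrite th [u + _]addrC subrK.
apply/nrC0_eq0/le_anti; rewrite nr_ge0 andbT; apply/ler_addgt0Pr => e e0; rewrite add0r.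
have [|N hN] := @pow_small R (nr t) (2 * M * (1 - nr t)^-1) e _ e0.
  by rewrite nr_ge0.
apply: le_trans (ltW hN); have := line_taylor N hd t1.
rewrite ux big1 ?subr0; last by move=> i _; rewrite pc_0 mulr0.
by rewrite mulrAC -!mulrA.
Qed.

Lemma exact_ord_exists f u : hol f u -> ~ (\forall x \near u, f x = 0) -> exists e, exact_ord f u e.
Proof.
move=> hf nz; apply: contrapT => /forallNP h; apply: nz.
have ho k : ord_ge f u k.
  elim: k => [|k IH]; first exact: ord_ge0.
  by apply: contrapT => nk; apply: (h k).
have [r [M [r0 H]]] := hol_hball hf.
by apply/nr_near; exists r => //; exact: flat_zero H ho.
Qed.

Lemma exact_ord_not_near0 f u e : exact_ord f u e -> ~ (\forall x \near u, f x = 0).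
Proof.
move=> [_ h] hz; apply: h; apply: ord_ge_near (ord_ge_zero u e.+1).
by apply: filterS hz => x ->.
Qed.

End ExactOrder.

Section RowVectors.
Context {R : realType} {n : nat}.
Local Notation C := (cplx R).
Local Notation V := 'rV[C]_n.
Implicit Types (f g : V -> C) (u x v : V).

Lemma partialE i f : partial i f = dd (delta_mx 0 i) f.
Proof. by rewrite dd_unlock. Qed.

Lemma hol_partial i f u : hol f u -> hol (partial i f) u.
Proof. by rewrite partialE; exact: hol_dd. Qed.

Lemma dd_partial v f u : hol f u -> \forall x \near u, dd v f x = \sum_i v 0 i * partial i f x.
Proof.
apply: filterS => x df; rewrite (ddE _ df) [in LHS](row_sum_delta v) linear_sum.
by apply: eq_bigr => i _; rewrite linearZ partialE (ddE _ df).
Qed.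

(** Words of partial derivatives; since these commute, every word amounts to one
    of the multi-indices of [mderive]. *)
Definition wd (s : seq 'I_n) f := foldr (fun i g => partial i g) f s.

Lemma hol_wd s f u : hol f u -> hol (wd s f) u.
Proof. by move=> hf; elim: s => //= i s; exact: hol_partial. Qed.

Lemma near_partial i f g u : (\forall x \near u, f x = g x) -> \forall x \near u, partial i f x = partial i g x.
Proof. by rewrite !partialE; exact: near_dd. Qed.

Lemma wd_swap i s f u : hol f u -> \forall x \near u, wd s (partial i f) x = partial i (wd s f) x.
Proof.
move=> hf; elim: s => [|j s IH]; first exact: near_all.
rewrite /=; apply: near_trans (near_partial j IH) _.
by rewrite !partialE; apply: dd_commute; exact: hol_wd.
Qed.

Lemma wd_perm s s' f u : hol f u -> perm_eq s s' -> \forall x \near u, wd s f x = wd s' f x.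
Proof.
move=> hf; elim: s s' => [|i s IH] s' ss'.
  by have := perm_size ss' => /esym/eqP; rewrite size_eq0 => /eqP ->; exact: near_all.
have : i \in s' by rewrite -(perm_mem ss') inE eqxx.
move=> /splitPr h; case: h ss' => s1 s2 ss'.
have {}IH : \forall x \near u, wd s f x = wd (s1 ++ s2) f x.
  by apply: IH; rewrite -(perm_cons i) (perm_trans ss')// perm_catC /= perm_cons perm_catC.
apply: near_trans (near_partial i IH) _.
have E (t1 t2 : seq 'I_n) : wd (t1 ++ t2) f = wd t1 (wd t2 f) by exact: foldr_cat.
rewrite !E /=; have := wd_swap i s1 (hol_wd s2 hf); apply: filterS => x; exact: esym.
Qed.

Definition mword (a : 'I_n -> nat) := flatten [seq nseq (a i) i | i <- enum 'I_n].

Lemma mderiveE a f : mderive a f = wd (mword a) f.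
Proof.
rewrite /mderive /mword /wd; elim: (enum 'I_n) => [|i s IH]; first exact: erefl.
rewrite [flatten _]/= foldr_cat -IH [LHS]/=; move: (foldr _ f s) => g {IH}.
elim: (a i) => [|k IH]; first exact: erefl.
exact: (congr1 (partial i) IH).
Qed.

Lemma size_mword a : size (mword a) = mdegree a.
Proof.
rewrite /mword /mdegree size_flatten /shape -map_comp sumnE big_map -big_enum.
by apply: eq_bigr => i _; rewrite /= size_nseq.
Qed.

Lemma perm_mword s : perm_eq s (mword (fun i => count_mem i s)).
Proof.
apply/allP => i _; apply/eqP; rewrite /mword count_flatten -map_comp sumnE big_map enumT -/(index_enum _).
rewrite (bigD1 i)//= count_nseq /= eqxx mul1n big1 ?addn0// => j ji.
by rewrite count_nseq /= (negbTE ji).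
Qed.

Lemma dn_sum k v (F : 'I_n -> V -> C) (c : 'I_n -> C) u : (forall i, hol (F i) u) ->
  \forall x \near u, dn k v (fun y => \sum_i c i * F i y) x = \sum_i c i * dn k v (F i) x.
Proof.
move=> hF; elim: (index_enum _) => [|i s IH].
  by apply: near_all => x; under eq_fun do rewrite big_nil; rewrite big_nil dn_cst0.
have hS : hol (fun y => \sum_(i <- s) c i * F i y) u.
  by apply: hol_sum => j; apply: hol_mul => //; exact: hol_cst.
have := dn_lin k v (c i) hS (hF i); apply: filterS2 IH => x h1 h2.
rewrite big_cons -h1 addrC -h2; congr (dn k v _ x); apply/funext => y.
by rewrite big_cons addrC.
Qed.

Lemma words_dn k v f u : hol f u -> (forall s, size s = k -> wd s f u = 0) -> dn k v f u = 0.
Proof.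
elim: k f => [|k IH] f hf h; first exact: (h [::]).
rewrite dnSr.
have h1 := near_dn k v (dd_partial v hf).
have h2 := dn_sum k v (fun i => v 0 i) (fun i => hol_partial i hf).
apply: etrans (nbhs_singleton h1) _; apply: etrans (nbhs_singleton h2) _.
rewrite big1// => i _; rewrite IH ?mulr0//; first exact: hol_partial.
move=> s ss; have := h (rcons s i); rewrite size_rcons ss => /(_ erefl).
by rewrite /wd foldr_rcons.
Qed.

Lemma ord_ge_wd f u s k : hol f u -> ord_ge f u (size s + k) -> ord_ge (wd s f) u k.
Proof.
move=> hf; elim: s k => //= i s IH k; rewrite addSn -addnS => /IH.
by rewrite partialE; apply: ord_ge_dd; exact: hol_wd.
Qed.

(** The multi-index derivatives of degree j determine all directional derivatives
    of order j by [words_dn], and conversely each derivative lowers the order by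
    at most one. *)
Lemma taylor_ordP f u k : hol f u ->
  (forall a, (mdegree a < k)%N -> taylor_coef f u a = 0) <-> ord_ge f u k.
Proof.
move=> hf; split => h.
  apply: ord_geP => // j v jk; apply: words_dn => // s ss.
  have /nbhs_singleton -> := wd_perm hf (perm_mword s).
  rewrite -mderiveE; have := h (fun i => count_mem i s).
  have -> : mdegree (fun i => count_mem i s) = j by rewrite -size_mword -(perm_size (perm_mword s)).
  move=> /(_ jk) /eqP; rewrite mulf_eq0 invr_eq0 pnatr_eq0 -[(_ == 0%N)]negbK -lt0n prodn_gt0 ?orbF//.
    by move/eqP.
  by move=> i; exact: fact_gt0.
move=> a ak; rewrite /taylor_coef mderiveE.
have ha : k = (size (mword a) + (k - mdegree a).-1.+1)%N.
  by rewrite prednK ?subn_gt0// size_mword subnKC// ltnW.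
by move: h; rewrite ha => /(ord_ge_wd hf)/ord_ge_val ->; rewrite mul0r.
Qed.

Lemma lowest_degreeP (J : Type) (F : J -> V -> C) u e : (forall j, hol (F j) u) ->
  lowest_degree F u e <-> (forall j, ord_ge (F j) u e) /\ exists j, ~ ord_ge (F j) u e.+1.
Proof.
move=> hF; split=> [[[j [a [ae an]]] h]|[h1 [j h2]]].
  split; first by move=> i; apply/taylor_ordP => // b; exact: h.
  exists j => /taylor_ordP => /(_ (hF j)) /(_ a); rewrite ae => /(_ (ltnSn _)) /eqP.
  by rewrite (negbTE an).
split; last by move=> i a; move: a; apply/taylor_ordP.
have [a an] : exists a, ~ ((mdegree a < e.+1)%N -> taylor_coef (F j) u a = 0).
  by apply: contrapT => /forallNP h; apply: h2; apply/taylor_ordP => // a; apply: contrapT; exact: h.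
have [ae a0] : (mdegree a < e.+1)%N /\ taylor_coef (F j) u a <> 0.
  split; first by apply: contrapT => h; apply: an => /h.
  by move=> h; apply: an => _; exact: h.
exists j, a; split; last exact/eqP.
apply/eqP; rewrite eqn_leq -ltnS ae /= leqNgt; apply/negP => ale.
by apply: a0; move: a ale {ae an}; apply/taylor_ordP.
Qed.

End RowVectors.

(** * Families of matrices and leading terms *)
Section MatrixFamilies.
Context {R : realType}.
Local Notation C := (cplx R).

(** In coordinates where A0 is the partial identity of rank r, the last n - r
    rows of A t vanish at t = 0, and every term of the determinant takes one
    entry from each of them. *)
Lemma det_order (n : nat) (A : C -> 'M[C]_n) (A0 : 'M[C]_n) :
  (forall i j, ord_ge (fun t : C => A t i j - A0 i j) (0 : C) 1) ->
  ord_ge (fun t : C => \det (A t)) (0 : C) (n - \rank A0).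
Proof.
move=> hA; set r := \rank A0.
pose Lm := col_ebase A0; pose Um := row_ebase A0.
have uL : Lm \in unitmx by exact: col_ebase_unit.
have uU : Um \in unitmx by exact: row_ebase_unit.
pose N t := invmx Lm *m A t *m invmx Um.
have AE t : \det (A t) = \det Lm * \det Um * \det (N t).
  rewrite mulrAC -!det_mulmx; congr (\det _).
  by rewrite /N !mulmxA mulmxV// mul1mx mulmxKV.
have N0 : invmx Lm *m A0 *m invmx Um = pid_mx r.
  by rewrite -{1}(mulmx_ebase A0) !mulmxA mulVmx// mul1mx mulmxK.
have hN i j : ord_ge (fun t : C => N t i j - (pid_mx r : 'M[C]_n) i j) (0 : C) 1.
  have -> : (fun t => N t i j - (pid_mx r : 'M[C]_n) i j) =
     (fun t => \sum_k \sum_l (invmx Lm i l * invmx Um k j) * (A t l k - A0 l k)).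
    apply/funext => t; rewrite -N0.
    have subE (X Y : 'M[C]_n) : X i j - Y i j = (X - Y) i j by rewrite !mxE.
    rewrite subE -mulmxBl -mulmxBr.
    rewrite mxE; apply: eq_bigr => k _; rewrite mxE big_distrl; apply: eq_bigr => l _ /=.
    by rewrite !mxE; ring.
  apply: ord_ge_sum => k _; apply: ord_ge_sum => l _; apply: ord_geZ; exact: hA.
have hN' i j : ord_ge (fun t : C => N t i j) (0 : C) (r <= i)%N.
  have [ri|ir] := leqP r i.
    have := hN i j; congr (ord_ge _ _ _); apply/funext => t.
    have -> : (pid_mx r : 'M[C]_n) i j = 0 by rewrite mxE ltnNge ri andbF.
    by rewrite subr0.
  have := ord_geD (ord_geS (hN i j)) (ord_ge_cst ((pid_mx r : 'M[C]_n) i j) (0 : C)).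
  by congr (ord_ge _ _ _); apply/funext => t; rewrite subrK.
have -> : (fun t : C => \det (A t)) = (fun t => \det Lm * \det Um * \det (N t)).
  by apply/funext => t; exact: AE.
apply: ord_geZ; rewrite /determinant; apply: ord_ge_sum => s _; apply: ord_geZ.
have rn : (r <= n)%N by exact: rank_leq_row.
have -> : (n - r = \sum_(i < n) (r <= i))%N.
  rewrite -(big_mkord xpredT (fun i => (r <= i : nat)%N)) /= (big_cat_nat _ rn)//=.
  rewrite big_nat_cond big1 ?add0n; last by move=> i /andP[/andP[_ ir] _]; rewrite leqNgt ir.
  rewrite big_nat_cond (eq_bigr (fun=> 1%N)); last by move=> i /andP[/andP[-> _] _].
  by rewrite -big_nat_cond sum_nat_const_nat muln1.
exact: ord_ge_prod.
Qed.

(** A maximal minor that is nonzero at p stays so nearby. *)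
Lemma rank_semicontinuous (T : topologicalType) m n (F : T -> 'M[C]_(m, n)) (p : T) :
  (forall i j, {for p, continuous (fun x => F x i j)}) ->
  \forall x \near p, (\rank (F p) <= \rank (F x))%N.
Proof.
move=> cF; have [Pm [Qm PQ]] := full_minor (F p).
pose g x := \det (Pm *m F x *m Qm).
have csum I (l : seq I) (G : I -> T -> C) (a : I -> C) :
    (forall i, G i @ p --> a i) -> (fun x => \sum_(i <- l) G i x) @ p --> \sum_(i <- l) a i.
  move=> hG; elim: l => [|i l IH].
    by under eq_fun do rewrite big_nil; rewrite big_nil; exact: cvg_cst.
  under eq_fun do rewrite big_cons; rewrite big_cons; exact: (cvgD (hG i) IH).
have cprod I (l : seq I) (G : I -> T -> C) (a : I -> C) :
    (forall i, G i @ p --> a i) -> (fun x => \prod_(i <- l) G i x) @ p --> \prod_(i <- l) a i.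
  move=> hG; elim: l => [|i l IH].
    by under eq_fun do rewrite big_nil; rewrite big_nil; exact: cvg_cst.
  under eq_fun do rewrite big_cons; rewrite big_cons; exact: (cvgM (hG i) IH).
have cg : {for p, continuous g}.
  rewrite /g /determinant.
  apply: (csum) => s; apply: (@cvgM _ _ _ _ (fun=> _) _ _ _ (cvg_cst _)).
  apply: (cprod) => i.
  have E x : (Pm *m F x *m Qm) i (s i) = \sum_k \sum_l (Pm i l * Qm k (s i)) * F x l k.
    rewrite mxE; apply: eq_bigr => k _; rewrite mxE big_distrl.
    by apply: eq_bigr => l _ /=; ring.
  rewrite E; under eq_fun do rewrite E.
  apply: (csum) => k; apply: (csum) => l.
  exact: (@cvgM _ _ _ _ (fun=> _) _ _ _ (cvg_cst _) (cF l k)).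
have g1 : g p != 0 by rewrite /g PQ det1 oner_eq0.
have nz : \forall x \near p, g x != 0 by exact: (cvgr_neq0 _ cg g1).
by apply: filterS nz => x; exact: rank_ge_minor.
Qed.

End MatrixFamilies.

Section Leading.
Context {R : realType}.
Local Notation C := (cplx R).
Implicit Types f g : C -> C.

(** f(t) = c t^k + O(t^(k+1)); the coefficient c may vanish. *)
Definition lead f (k : nat) (c : C) := ord_ge (fun t : C => f t - t ^+ k * c) (0 : C) k.+1.

Lemma ord_ge_monomial k c : ord_ge (fun t : C => t ^+ k * c) (0 : C) k.
Proof. by have := ord_geM (ord_ge_pow k) (ord_ge_cst c (0 : C)); rewrite addn0. Qed.

Lemma lead_ge f k c : lead f k c -> ord_ge f (0 : C) k.
Proof.
move=> h; have := ord_geD (ord_geS h) (ord_ge_monomial k c).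
by congr (ord_ge _ _ _); apply/funext => t; rewrite subrK.
Qed.

Lemma lead_eq0 f k c : lead f k c -> ord_ge f (0 : C) k.+1 -> c = 0.
Proof.
move=> h1 h2; apply: (@ord_ge_coef _ c k); have := ord_geB h2 h1.
by congr (ord_ge _ _ _); apply/funext => t; rewrite opprB addrC subrK.
Qed.

Lemma lead_of_ge f k : ord_ge f (0 : C) k.+1 -> lead f k 0.
Proof.
by rewrite /lead; congr (ord_ge _ _ _); apply/funext => t; rewrite mulr0 subr0.
Qed.

Lemma leadM f g k l c d : lead f k c -> lead g l d -> lead (fun t => f t * g t) (k + l) (c * d).
Proof.
move=> hf hg; have h1 := ord_geM hf (lead_ge hg).
have h2 := ord_geM (ord_ge_monomial k c) hg.
rewrite addnS in h2; have := ord_geD h1 h2.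
by rewrite /lead; congr (ord_ge _ _ _); apply/funext => t; rewrite exprD; ring.
Qed.

Lemma lead_sum I (s : seq I) (F : I -> C -> C) k (c : I -> C) :
  (forall i, lead (F i) k (c i)) -> lead (fun t => \sum_(i <- s) F i t) k (\sum_(i <- s) c i).
Proof.
move=> h; have := @ord_ge_sum _ _ _ s xpredT (fun i t => F i t - t ^+ k * c i) 0 k.+1 (fun i _ => h i).
rewrite /lead; congr (ord_ge _ _ _); apply/funext => t.
by rewrite sumrB mulr_sumr.
Qed.

Lemma lead_pow k : lead (fun t => t ^+ k) k 1.
Proof.
have := ord_ge_zero (0 : C) k.+1; rewrite /lead; congr (ord_ge _ _ _).
by apply/funext => t; rewrite mulr1 subrr.
Qed.

Lemma lead_cst c : lead (fun=> c) 0 c.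
Proof.
have := ord_ge_zero (0 : C) 1; rewrite /lead; congr (ord_ge _ _ _).
by apply/funext => t; rewrite expr0 mul1r subrr.
Qed.

(** Dividing the column j by t^(f j) leaves a family to which [det_order]
    applies. *)
Lemma det_lead_order n (A : C -> 'M[C]_n) (A0 : 'M[C]_n) (f : 'I_n -> nat) :
  (forall i j, lead (fun t => A t i j) (f j) (A0 i j)) ->
  ord_ge (fun t => \det (A t)) (0 : C) (\sum_j f j + (n - \rank A0)).
Proof.
move=> hA.
pose A' t : 'M[C]_n := \matrix_(i, j) if t == 0 then A0 i j else A t i j / t ^+ f j.
have AE t : A t = A' t *m diag_mx (\row_j t ^+ f j).
  apply/matrixP => i j; rewrite mul_mx_diag !mxE; case: eqP => [->|/eqP t0].
    have [K [r [r0 h]]] := hA i j.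
    have /h : nr ((0 : C) - 0) < r by rewrite subr0 nr0.
    rewrite subr0 nr0 exprS mul0r mulr0 => hle.
    have := @nr0_eq0 _ _ (A 0 i j - 0 ^+ f j * A0 i j) (@le_anti _ _ _ _ _).
    rewrite hle nr_ge0 => /(_ isT)/eqP; rewrite subr_eq0 => /eqP ->.
    by rewrite mulrC.
  by rewrite divfK // expf_neq0.
have -> : (fun t => \det (A t)) = (fun t => (\prod_j t ^+ f j) * \det (A' t)).
  apply/funext => t; rewrite AE det_mulmx det_diag mulrC; congr (_ * _).
  by apply: eq_bigr => j _; rewrite mxE.
apply: ord_geM; first by apply: ord_ge_prod => j _; exact: ord_ge_pow.
apply: det_order => i j; have [K [r [r0 h]]] := hA i j.
exists K, r; split => // t /[dup] /h; rewrite !subr0 => ht tr.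
rewrite mxE; case: eqP => [->|/eqP t0].
  by rewrite subrr !nr0 expr1 mulr0.
have nt : 0 < nr t by rewrite nr_gt0.
have -> : A t i j / t ^+ f j - A0 i j = (A t i j - t ^+ f j * A0 i j) / t ^+ f j.
  by rewrite mulrBl [t ^+ _ * _]mulrC mulfK // expf_neq0.
rewrite nrM nrV nrX ler_pdivrMr ?exprn_gt0//.
by apply: le_trans ht _; rewrite exprS expr1 mulrA.
Qed.

End Leading.

(** * The local model of a log-canonical system *)
Section HolomorphicAlgebra.
Context {R : realType} {V : normedModType (cplx R)}.
Local Notation C := (cplx R).
Implicit Types u : V.

Lemma hol_det n (A : V -> 'M[C]_n) u : (forall i j, hol (fun x => A x i j) u) ->
  hol (fun x => \det (A x)) u.
Proof.
move=> hA; rewrite /determinant; apply: (@hol_sum _ _ _ _ xpredT (fun s x => _ * _)) => s.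
by apply: hol_mul; [exact: hol_cst | apply: hol_prod => i; exact: hA].
Qed.

Lemma hol_mulmx m n p (A : V -> 'M[C]_(m, n)) (B : V -> 'M[C]_(n, p)) u :
  (forall i j, hol (fun x => A x i j) u) -> (forall i j, hol (fun x => B x i j) u) ->
  forall i j, hol (fun x => (A x *m B x) i j) u.
Proof.
move=> hA hB i j; under eq_fun do rewrite mxE.
by apply: hol_sum => l; apply: hol_mul.
Qed.

Lemma hol_wedge n (a b : V -> ext C n) u : (forall K, hol (fun x => a x K) u) ->
  (forall K, hol (fun x => b x K) u) -> forall K, hol (fun x => wedge (a x) (b x) K) u.
Proof.
move=> ha hb K; under eq_fun do rewrite ffunE.
apply: hol_sum => I; apply: hol_mul => //; apply: hol_mul => //; exact: hol_cst.
Qed.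

Lemma hol_ext_vect n (v : V -> 'rV[C]_n) u : (forall j, hol (fun x => v x 0 j) u) ->
  forall K, hol (fun x => ext_vect (v x) K) u.
Proof. by move=> hv K; under eq_fun do rewrite ffunE; apply: hol_sum. Qed.

Lemma hol_ext1 n u K : hol (fun _ : V => (ext1 : ext C n) K) u.
Proof. exact: hol_cst. Qed.

Lemma hol_pfq n r k (B : V -> 'M[C]_n) (s : V -> 'M[C]_(k, n)) u :
  (forall i j, hol (fun x => B x i j) u) -> (forall i j, hol (fun x => s x i j) u) ->
  forall K, hol (fun x => pfq r (B x) (s x) K) u.
Proof.
move=> hB hs; apply: hol_wedge.
  elim: r => [|r IH]; first exact: hol_ext1.
  apply: hol_wedge => // K; under eq_fun do rewrite ffunE.
  by apply: hol_sum => i; apply: hol_sum.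
elim: (index_enum _) => [|i l IH] K.
  under eq_fun do rewrite big_nil; exact: hol_ext1.
under eq_fun do rewrite big_cons; apply: hol_wedge => // {}K.
by apply: hol_ext_vect => j; under eq_fun do rewrite mxE.
Qed.

End HolomorphicAlgebra.

Lemma near_line (R : realType) (V : normedModType (cplx R)) (Q : V -> Prop) (u v : V) :
  (\forall x \near u, Q x) -> \forall t \near (0 : cplx R), Q (u + t *: v).
Proof.
move=> /nr_near[d d0 h]; apply/nr_near.
have v1 : 0 < nr v + 1 by rewrite ltr_wpDl ?nr_ge0.
exists (d / (nr v + 1)); first by rewrite divr_gt0.
move=> t; rewrite subr0 ltr_pdivlMr// => ht; apply: h.
rewrite addrC addKr nrZ; apply: le_lt_trans ht.
by rewrite ler_wpM2l ?nr_ge0// lerDl.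
Qed.

(** In this section everything takes place near a point u of C^n: B is a bivector
    field, the rows of s are vector fields, and the functions phi j diagonalize
    both up to the constant matrices Lam and cc. The orders e of the Jacobian
    determinant and f j of phi j are those at u. *)
Section LocalModel.
Context {R : realType} {n k : nat}.
Local Notation C := (cplx R).
Local Notation V := 'rV[C]_n.
Variables (u : V) (phi : 'I_n -> V -> C) (B : V -> 'M[C]_n) (s : V -> 'M[C]_(k, n)).
Variables (Lam : 'M[C]_n) (cc : 'M[C]_(k, n)).

Definition jacobian_mx (x : V) : 'M[C]_n := \matrix_(i, j) partial i (phi j) x.
Definition diag_phi (x : V) : 'M[C]_n := diag_mx (\row_j phi j x).

Hypothesis hB : forall i j, hol (fun x => B x i j) u.
Hypothesis hs : forall i j, hol (fun x => s x i j) u.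
Hypothesis hphi : forall j, hol (phi j) u.
Hypothesis eqB : \forall x \near u,
  (jacobian_mx x)^T *m B x *m jacobian_mx x = diag_phi x *m Lam *m diag_phi x.
Hypothesis eqs : \forall x \near u, s x *m jacobian_mx x = cc *m diag_phi x.
Variables (e : nat) (f : 'I_n -> nat).
Hypothesis exact_D : exact_ord (fun x => \det (jacobian_mx x)) u e.
Hypothesis exact_phi : forall j, exact_ord (phi j) u (f j).

Lemma hol_jacobian_mx i j : hol (fun x => jacobian_mx x i j) u.
Proof. by under eq_fun do rewrite mxE; exact: hol_partial. Qed.

Lemma hol_det_jacobian : hol (fun x => \det (jacobian_mx x)) u.
Proof. by apply: hol_det; exact: hol_jacobian_mx. Qed.

Lemma hol_prod_phi : hol (fun x => \prod_j phi j x) u.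
Proof. exact: hol_prod. Qed.

Lemma exact_prod_phi : exact_ord (fun x => \prod_j phi j x) u (\sum_j f j).
Proof. exact: exact_ord_prod. Qed.

Lemma det_diag_phi x : \det (diag_phi x) = \prod_j phi j x.
Proof. by rewrite det_diag; apply: eq_bigr => j _; rewrite mxE. Qed.

Lemma exact_ord_factor (g h F : V -> C) a b : hol g u -> hol h u -> hol F u ->
  (\forall x \near u, g x * h x = F x) -> exact_ord g u a -> exact_ord F u b ->
  exists2 c, exact_ord h u c & (a + c)%N = b.
Proof.
move=> hg hh hF E eg eF.
have [c ec] : exists c, exact_ord h u c.
  apply: exact_ord_exists => // h0; apply: (exact_ord_not_near0 eF).
  by apply: filterS2 h0 E => x -> <-; rewrite mulr0.
exists c => //; apply: exact_ord_inj eF; apply: exact_ord_near E _.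
exact: exact_ordM.
Qed.

(** The congruence by the Jacobian matrix and the one by the diagonal matrix of
    the phi j lead to the same top coefficient, whence
    det J * pfq r B s = prod phi * pfq r Lam cc; orders of products add up. *)
Lemma exact_ord_pfaffian r : (r + r + k)%N = n ->
  (\forall x \near u, (B x)^T = - B x /\ (\rank (B x) <= r + r)%N) ->
  Lam^T = - Lam -> (\rank Lam <= r + r)%N -> pfq r Lam cc [set: 'I_n]%SET != 0 ->
  exists2 d, exact_ord (fun x => pfq r (B x) (s x) [set: 'I_n]%SET) u d &
    (e + d)%N = (\sum_j f j)%N.
Proof.
move=> rk skB skL rL nz.
apply: (@exact_ord_factor _ _ (fun x => pfq r Lam cc [set: 'I_n]%SET * \prod_j phi j x) _ _
  hol_det_jacobian _ _ _ exact_D).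
- exact: hol_pfq.
- by apply: hol_mul; [exact: hol_cst | exact: hol_prod_phi].
- near=> x.
  have [sk rB] : (B x)^T = - B x /\ (\rank (B x) <= r + r)%N by near: x.
  rewrite -(pfq_congr (jacobian_mx x) (s x) rk sk rB).
  have -> : (jacobian_mx x)^T *m B x *m jacobian_mx x = diag_phi x *m Lam *m diag_phi x by near: x.
  have -> : s x *m jacobian_mx x = cc *m diag_phi x by near: x.
  have -> : diag_phi x *m Lam *m diag_phi x = (diag_phi x)^T *m Lam *m diag_phi x.
    by rewrite tr_diag_mx.
  by rewrite pfq_congr// det_diag_phi mulrC.
- rewrite -[X in exact_ord _ _ X]add0n; apply: exact_ordM exact_prod_phi.
  + exact: hol_cst.
  + exact: hol_prod_phi.
  + exact: exact_ord_cst.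
Unshelve. all: by end_near. Qed.


Definition lin_bivect (v : V) : 'M[C]_n := \matrix_(i, j) dd v (fun x => B x i j) u.

Lemma lead_linear (g : V -> C) (v : V) : hol g u -> g u = 0 ->
  lead (fun t => g (u + t *: v)) 1 (dd v g u).
Proof.
move=> hg g0.
have o1 : ord_ge g u 1 by apply: ord_geP => // -[|]//.
by have := ord_ge_approx v hg o1; rewrite /hpart /= divr1.
Qed.

(** phi j vanishes to order f j, so that its partial derivatives vanish to order
    f j - 1 at least. The factor t makes up for the missing power, also when
    f j = 0, in which case the limit column is zero. *)
Lemma scaled_jacobian (v : V) : exists J0 : 'M[C]_n, forall i j,
  lead (fun t => t * jacobian_mx (u + t *: v) i j) (f j) (J0 i j).
Proof.
exists (\matrix_(i, j) if f j is g.+1 then hpart g (partial i (phi j)) u v else 0) => i j.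
rewrite mxE; have [of_ _] := exact_phi j.
have hp : hol (partial i (phi j)) u by exact: hol_partial.
have -> : (fun t => t * jacobian_mx (u + t *: v) i j) =
    (fun t => t ^+ 1 * partial i (phi j) (u + t *: v)).
  by apply/funext => t; rewrite mxE.
case E : (f j) => [|g].
  apply: lead_of_ge; exact: (ord_geM (ord_ge_pow 1) (ord_ge_line v (ord_ge0 hp))).
have og : ord_ge (partial i (phi j)) u g.
  by rewrite partialE; apply: ord_ge_dd => //; rewrite -E.
have := leadM (lead_pow 1) (ord_ge_approx v hp og).
by rewrite mul1r.
Qed.

Hypothesis B0 : B u = 0.

Lemma lead_bivect v i j : lead (fun t => B (u + t *: v) i j) 1 (lin_bivect v i j).
Proof. by rewrite mxE; apply: lead_linear => //; rewrite B0 mxE. Qed.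

(** On the line u + t v, the left side of the bracket relation, multiplied by
    t^2, has leading coefficient the given matrix at the power
    f j + f l + 1, while the right side is of order f j + f l + 2. *)
Lemma scaled_jacobian_isotropic (v : V) (J0 : 'M[C]_n) :
  (forall i j, lead (fun t => t * jacobian_mx (u + t *: v) i j) (f j) (J0 i j)) ->
  J0^T *m lin_bivect v *m J0 = 0.
Proof.
move=> hJ; apply/matrixP => j l; rewrite [RHS]mxE.
have L : lead (fun t => \sum_q (\sum_i t * jacobian_mx (u + t *: v) i j * B (u + t *: v) i q) *
    (t * jacobian_mx (u + t *: v) q l)) (f j + 1 + f l) ((J0^T *m lin_bivect v *m J0) j l).
  rewrite mxE; apply: (lead_sum _) => q; apply: leadM => //.
  rewrite mxE; apply: (lead_sum _) => i; rewrite mxE; apply: leadM => //; exact: lead_bivect.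
apply: lead_eq0 L _.
have o1 : ord_ge (fun x => ((jacobian_mx x)^T *m B x *m jacobian_mx x) j l) u (f j + f l).
  have := ord_geZ (Lam j l) (ord_geM (exact_phi j).1 (exact_phi l).1).
  apply: ord_ge_near; near=> x.
  have -> : (jacobian_mx x)^T *m B x *m jacobian_mx x = diag_phi x *m Lam *m diag_phi x by near: x.
  by rewrite mul_mx_diag mxE mul_diag_mx !mxE; ring.
have := ord_geM (ord_ge_pow 2) (ord_ge_line v o1).
have -> : (2 + (f j + f l) = (f j + 1 + f l).+1)%N by lia.
congr (ord_ge _ _ _); apply/funext => t.
rewrite mxE mulr_sumr; apply: eq_bigr => q _.
have -> : \sum_i t * jacobian_mx (u + t *: v) i j * B (u + t *: v) i q =
    t * ((jacobian_mx (u + t *: v))^T *m B (u + t *: v)) j q.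
  by rewrite [in RHS]mxE mulr_sumr; apply: eq_bigr => i _; rewrite [X in _ * (X * _)]mxE mulrA.
by rewrite expr2; ring.
Unshelve. all: by end_near. Qed.

Lemma line_poly_minor l (Pm : 'M[C]_(l, n)) (Qm : 'M[C]_(n, l)) :
  line_poly (fun v => \det (Pm *m lin_bivect v *m Qm)).
Proof.
move=> v w; pose X := Pm *m lin_bivect v *m Qm; pose Y := Pm *m lin_bivect w *m Qm.
exists (\det (map_mx polyC X + 'X *: map_mx polyC Y)) => t.
have -> : Pm *m lin_bivect (v + t *: w) *m Qm = X + t *: Y.
  have -> : lin_bivect (v + t *: w) = lin_bivect v + t *: lin_bivect w.
    apply/matrixP => i j; rewrite !mxE.
    exact: (nbhs_singleton (dd_dir t v w (hB i j))).
  by rewrite mulmxDr mulmxDl -scalemxAr -scalemxAl.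
rewrite -horner_evalE -det_map_mx; congr (\det _).
move: X Y => X Y; apply/matrixP => i j.
rewrite !mxE -[RHS]/(((X i j)%:P + 'X * (Y i j)%:P).[t]).
by rewrite hornerD hornerM hornerX !hornerC.
Qed.

(** Both q and a maximal minor of the linear part are polynomial on lines, so
    that some direction avoids the zeros of both. *)
Lemma generic_rank (q : V -> C) v0 v1 : line_poly q -> q v0 != 0 ->
  exists2 v, q v != 0 & (\rank (lin_bivect v1) <= \rank (lin_bivect v))%N.
Proof.
move=> lq q0; have [Pm [Qm PQ]] := full_minor (lin_bivect v1).
have d1 : \det (Pm *m lin_bivect v1 *m Qm) != 0 by rewrite PQ det1 oner_eq0.
have [v [qv dv]] := line_poly_common lq (line_poly_minor Pm Qm) q0 d1.
by exists v; [exact: qv | exact: rank_ge_minor dv].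
Qed.

(** In a generic direction v, t^n det J is the determinant of the scaled Jacobian
    matrix, whose limit J0 is isotropic for the linear part of B. A large rank of
    that linear part forces a small rank of J0, hence a high order of det J. *)
Lemma linearization_rank_le v1 :
  (\rank (lin_bivect v1) + (\sum_j f j).*2 <= (e + n).*2)%N.
Proof.
have arith (a b c d : nat) : (b + a.*2 <= n.*2)%N -> (c <= b)%N -> (a <= n)%N ->
    ~ (n + e < d + (n - a))%N -> (c + d.*2 <= (e + n).*2)%N by lia.
have [v0 h0] := exact_ord_hpart hol_det_jacobian exact_D.
have [v hv rv] := generic_rank v1 (hpart_line_poly e hol_det_jacobian) h0.
have [J0 hJ] := scaled_jacobian v.
have iso := isotropic_rank (scaled_jacobian_isotropic hJ).
have oD : ord_ge (fun t : C => t ^+ n * \det (jacobian_mx (u + t *: v))) (0 : C)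
    (\sum_j f j + (n - \rank J0)).
  have hJ' i j : lead (fun t : C => (t *: jacobian_mx (u + t *: v)) i j) (f j) (J0 i j).
    by have := hJ i j; congr (lead _ _ _); apply/funext => t; rewrite [RHS]mxE.
  have := det_lead_order hJ'.
  by congr (ord_ge _ _ _); apply/funext => t; rewrite detZ.
have lD := leadM (lead_pow n) (ord_ge_approx v hol_det_jacobian exact_D.1).
have : ~ (n + e < \sum_j f j + (n - \rank J0))%N.
  move=> lt; move/eqP: hv; apply; rewrite -[LHS]mul1r.
  exact: (lead_eq0 lD (ord_ge_le lt oD)).
move=> nlt; exact: (arith _ _ _ _ iso rv (rank_leq_row J0) nlt).
Qed.

Hypothesis s0 : s u = 0.

(** The bordered matrix vanishes at u, and the rank of its linear part exceeds
    that of the linear part of B by at most 2k. Hence its determinant vanishes to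
    high order, while det J ^ 2 * det (bordered B s) is a nonzero constant times
    the square of prod phi. *)
Lemma linearization_rank_ge : \det (bordered Lam cc) != 0 ->
  exists v, ((e + n).*2 <= \rank (lin_bivect v) + (\sum_j f j).*2)%N.
Proof.
have arith (a b c : nat) : (a <= b + k.*2)%N -> (a <= n + k)%N ->
    ~ (0 + (c + c) < e + e + (n + k + (n + k - a)))%N -> ((e + n).*2 <= b + c.*2)%N by lia.
move=> nz; have [v hv] := exact_ord_hpart hol_prod_phi exact_prod_phi.
exists v; pose s1 : 'M[C]_(k, n) := \matrix_(i, j) dd v (fun x => s x i j) u.
set M0 := bordered (lin_bivect v) s1.
have oM : ord_ge (fun t : C => \det (bordered (B (u + t *: v)) (s (u + t *: v)))) (0 : C)
    ((n + k) + ((n + k) - \rank M0)).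
  suff hM i j : lead (fun t : C => bordered (B (u + t *: v)) (s (u + t *: v)) i j) 1 (M0 i j).
    have := @det_lead_order _ _ _ _ (fun=> 1%N) hM.
    by rewrite sum_nat_const card_ord muln1.
  have ls a b : lead (fun t : C => s (u + t *: v) a b) 1 (s1 a b).
    by rewrite mxE; apply: lead_linear => //; rewrite s0 mxE.
  have lN (g : C -> C) c : lead g 1 c -> lead (fun t : C => - g t) 1 (- c).
    move=> h; have := leadM (lead_cst (-1)) h; rewrite add0n mulN1r.
    by congr (lead _ _ _); apply/funext => t; rewrite mulN1r.
  rewrite /M0 /bordered; case: (splitP i) => i' ei; case: (splitP j) => j' ej.
  - have -> : i = lshift k i' by apply/val_inj.
    have -> : j = lshift k j' by apply/val_inj.
    by rewrite block_mxEul; under eq_fun do rewrite block_mxEul; exact: lead_bivect.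
  - have -> : i = lshift k i' by apply/val_inj.
    have -> : j = rshift n j' by apply/val_inj.
    by rewrite block_mxEur mxE; under eq_fun do rewrite block_mxEur mxE; exact: ls.
  - have -> : i = rshift n i' by apply/val_inj.
    have -> : j = lshift k j' by apply/val_inj.
    rewrite block_mxEdl [(- s1) _ _]mxE; under eq_fun do rewrite block_mxEdl mxE.
    by apply: lN; exact: ls.
  - have -> : i = rshift n i' by apply/val_inj.
    have -> : j = rshift n j' by apply/val_inj.
    rewrite block_mxEdr mxE; under eq_fun do rewrite block_mxEdr mxE.
    by apply: lead_of_ge; exact: ord_ge_zero.
have rM : (\rank M0 <= \rank (lin_bivect v) + k.*2)%N by exact: rank_bordered.
have lR := leadM (lead_cst (\det (bordered Lam cc)))
  (leadM (ord_ge_approx v hol_prod_phi exact_prod_phi.1) (ord_ge_approx v hol_prod_phi exact_prod_phi.1)).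
have oD := ord_ge_line v exact_D.1.
have oL := ord_geM (ord_geM oD oD) oM.
have E : \forall x \near u, \det (jacobian_mx x) ^+ 2 * \det (bordered (B x) (s x)) =
    \det (bordered Lam cc) * (\prod_j phi j x * \prod_j phi j x).
  near=> x; rewrite -det_bordered_congr.
  have -> : (jacobian_mx x)^T *m B x *m jacobian_mx x = diag_phi x *m Lam *m diag_phi x by near: x.
  have -> : s x *m jacobian_mx x = cc *m diag_phi x by near: x.
  have -> : diag_phi x *m Lam *m diag_phi x = (diag_phi x)^T *m Lam *m diag_phi x.
    by rewrite tr_diag_mx.
  by rewrite det_bordered_congr det_diag_phi expr2 mulrC.
have El : \forall t \near (0 : C), \det (jacobian_mx (u + t *: v)) * \det (jacobian_mx (u + t *: v))
     * \det (bordered (B (u + t *: v)) (s (u + t *: v))) =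
    \det (bordered Lam cc) * (\prod_j phi j (u + t *: v) * \prod_j phi j (u + t *: v)).
  by apply: filterS (near_line v E) => t; rewrite expr2.
have {oL} oL := ord_ge_near El oL.
have : ~ (0 + (\sum_j f j + \sum_j f j) < e + e + (n + k + (n + k - \rank M0)))%N.
  move=> lt; have := lead_eq0 lR (ord_ge_le lt oL).
  by move/eqP; apply/negP; exact: (mulf_neq0 nz (mulf_neq0 hv hv)).
move=> nlt; exact: (arith _ _ _ rM (rank_leq_row M0) nlt).
Unshelve. all: by end_near. Qed.

End LocalModel.

(** * Functions and tensors in charts *)
Section Calculus.
Context {R : realType}.
Local Notation C := (cplx R).

Lemma differentiable_entry (V : normedModType C) m n (F : V -> 'M[C]_(m, n)) a i j :
  differentiable F a -> differentiable (fun x => F x i j) a.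
Proof. by move=> dF; exact: (differentiable_comp dF (differentiable_coord _ i j)). Qed.

Lemma derive_entry (V : normedModType C) m n (F : V -> 'M[C]_(m, n)) a v i j :
  differentiable F a -> 'D_v (fun x => F x i j) a = ('D_v F a) i j.
Proof.
move=> dF; apply: cvg_lim; first exact: norm_hausdorff.
have cF : (fun h => h^-1 *: (F (h *: v + a) - F a)) @ 0^' --> 'D_v F a.
  exact: (diff_derivable dF).
have -> : (fun h : C => h^-1 *: (F (h *: v + a) i j - F a i j)) =
    (fun M : 'M[C]_(m, n) => M i j) \o (fun h => h^-1 *: (F (h *: v + a) - F a)).
  by apply/funext => h /=; rewrite !mxE.
exact: (cvg_comp _ _ cF (@coord_continuous _ _ _ i j _)).
Qed.

Lemma diff_row n (f : 'rV[C]_n -> C) y w : differentiable f y ->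
  'd f y w = \sum_j w 0 j * partial j f y.
Proof.
move=> df; rewrite {1}(row_sum_delta w) linear_sum; apply: eq_bigr => j _.
by rewrite linearZ /partial (deriveE _ df).
Qed.

Lemma chain_row (V : normedModType C) n (g : V -> 'rV[C]_n) (f : 'rV[C]_n -> C) u v :
  differentiable g u -> differentiable f (g u) ->
  'D_v (fun x => f (g x)) u = \sum_j ('D_v g u) 0 j * partial j f (g u).
Proof.
move=> dg df; rewrite -diff_row// (deriveE v dg).
have -> : 'D_v (fun x => f (g x)) u = 'd (f \o g) u v.
  exact: (deriveE v (differentiable_comp dg df)).
by rewrite (diff_comp dg df).
Qed.

End Calculus.

Section Charts.
Context {R : realType} {n : nat} {P : cmanifold (cplx R) n}.
Local Notation C := (cplx R).
Implicit Types (p q : P) (z w : chart C n P).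

Lemma chart_cover p : exists z, chart_at p z.
Proof. by have [z az cz] := atlas_cover p; exists z. Qed.

Lemma chart_nbhs p z : chart_at p z -> \forall q \near p, chart_at q z.
Proof.
move=> [az cz]; have : \forall q \near p, cdom z q.
  by apply: open_nbhs_nbhs; split => //; exact: cdom_open.
by apply: filterS.
Qed.

Lemma cmap_cvg p z : chart_at p z -> {for p, continuous (cmap z)}.
Proof.
move=> [_ cz]; have := @cmap_continuous _ _ _ z.
by rewrite (continuous_open_subspace _ (@cdom_open _ _ _ z)); apply; rewrite inE.
Qed.

Lemma cinv_cvg p z : chart_at p z -> cinv z @ cmap z p --> p.
Proof.
move=> [_ cz]; rewrite -[X in _ --> X](cmapK cz); have := @cinv_continuous _ _ _ z.
by rewrite (continuous_open_subspace _ (@cimg_open _ _ _ z)); apply; rewrite inE; exists p.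
Qed.

(** Statements about points near p are transported to statements about
    coordinates; [cinv] is a two-sided inverse only on the image of the chart,
    which is a neighborhood. *)
Lemma near_chart p z (Q : P -> 'rV[C]_n -> Prop) : chart_at p z ->
  (\forall q \near p, chart_at q z -> Q q (cmap z q)) -> \forall u \near cmap z p, Q (cinv z u) u.
Proof.
move=> zp; have [az cz] := zp => hQ.
have hi : \forall u \near cmap z p, (cmap z @` cdom z) u.
  by apply: open_nbhs_nbhs; split; [exact: cimg_open | exists p].
have hi' := cinv_cvg zp hQ.
apply: filterS2 hi hi' => u [q cq <-] /=; rewrite (cmapK cq) => h.
exact: h.
Qed.

Lemma near_chart_all p z (Q : P -> 'rV[C]_n -> Prop) : chart_at p z ->
  (forall q, chart_at q z -> Q q (cmap z q)) -> \forall u \near cmap z p, Q (cinv z u) u.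
Proof. by move=> zp hQ; apply: near_chart (zp) _; exact: nearW. Qed.

Lemma near_cmap p z (Q : 'rV[C]_n -> Prop) : chart_at p z ->
  (\forall u \near cmap z p, Q u) -> \forall q \near p, Q (cmap z q).
Proof. by move=> zp; apply: cmap_cvg. Qed.

Lemma near_chart_at p z w : chart_at p z -> chart_at p w ->
  \forall u \near cmap z p, chart_at (cinv z u) w /\ cmap z (cinv z u) = u.
Proof.
move=> zp wp; apply: (near_chart (Q := fun q u => chart_at q w /\ cmap z q = u) zp).
by apply: filterS (chart_nbhs wp) => q wq zq; split.
Qed.

Lemma hol_of_points p z (F : 'rV[C]_n -> C) : chart_at p z ->
  (forall q, chart_at q z -> differentiable F (cmap z q)) -> hol F (cmap z p).
Proof. move=> zp h; exact: (near_chart_all (Q := fun _ u => differentiable F u) zp h). Qed.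

Lemma hol_chart (f : P -> C) p z : holomorphic_fun f -> chart_at p z ->
  hol (f \o cinv z) (cmap z p).
Proof. by move=> hf zp; apply: hol_of_points => // q zq; exact: hf. Qed.

Lemma hol_bivect (pi : poisson P) p z i j : chart_at p z ->
  hol (fun u => bivect pi z u i j) (cmap z p).
Proof.
move=> zp; apply: hol_of_points => // q zq; apply: differentiable_entry.
exact: bivect_holo.
Qed.

Lemma in_charts_id p z w : chart_at p z -> chart_at p w ->
  differentiable (in_charts z w idfun) (cmap z p).
Proof. by move=> [az cz] [aw cw]; have := atlas_compat az aw cz cw. Qed.

Lemma jacobian_mx_change (phi : 'I_n -> P -> C) p z w :
  (forall j, holomorphic_fun (phi j)) -> chart_at p z -> chart_at p w ->
  jacobian_mx (fun j => phi j \o cinv z) (cmap z p) =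
  'J (in_charts z w idfun) (cmap z p) *m jacobian_mx (fun j => phi j \o cinv w) (cmap w p).
Proof.
move=> hphi zp wp; apply/matrixP => i j; rewrite [LHS]mxE [RHS]mxE.
have dg := in_charts_id zp wp.
have gp : in_charts z w idfun (cmap z p) = cmap w p by rewrite /in_charts /= (cmapK zp.2).
have df : differentiable (phi j \o cinv w) (in_charts z w idfun (cmap z p)).
  by rewrite gp; exact: (hphi j p w wp).
have E : \forall u \near cmap z p, (phi j \o cinv z) u = (phi j \o cinv w) (in_charts z w idfun u).
  apply: filterS (near_chart_at zp wp) => u [wu _].
  by rewrite /in_charts /= (cmapK wu.2).
rewrite partialE (nbhs_singleton (near_dd (delta_mx 0 i) E)) dd_unlock (chain_row _ dg df) gp.
apply: eq_bigr => l _; rewrite [X in _ = _ * X]mxE; congr (_ * _).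
by rewrite (deriveEjacobian _ dg) -rowE mxE.
Qed.

End Charts.

(** * Top forms and the identity theorem *)
Section TopForms.
Context {R : realType} {n : nat} {P : cmanifold (cplx R) n}.
Local Notation C := (cplx R).
Implicit Types (p q : P) (z w : chart C n P) (phi : 'I_n -> P -> C).

Definition jac phi z := jacobian_mx (fun j => phi j \o cinv z).

Lemma top_form_degree (D : 'rV[C]_n -> ext C n) u e :
  (forall x, homog n (D x)) -> (forall K, hol (fun x => D x K) u) ->
  exact_ord (fun x => D x [set: 'I_n]%SET) u e -> lowest_degree (fun I x => D x I) u e.
Proof.
move=> hD hol_D [oe noe]; apply/lowest_degreeP => //; split; last by exists [set: 'I_n]%SET.
move=> K; have [->//|KT] := eqVneq K [set: 'I_n]%SET.
have -> : (fun x => D x K) = fun=> 0 by apply/funext => x; exact: homog_top.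
exact: ord_ge_zero.
Qed.

Lemma d_wedgeE phi z u : d_wedge phi z u = \prod_(i < n) vec (row i (jac phi z u)^T) :> extR C n.
Proof.
apply: eq_bigr => i _; congr ext_vect; apply/rowP => j; rewrite !mxE //.
Qed.

Lemma d_wedge_top phi z u : d_wedge phi z u [set: 'I_n]%SET = \det (jac phi z u).
Proof. by rewrite d_wedgeE top_prod det_tr. Qed.

Lemma homog_d_wedge phi z u : homog n (d_wedge phi z u).
Proof. by rewrite d_wedgeE; exact: homog_prod. Qed.

Lemma hol_d_wedge phi p z : (forall j, holomorphic_fun (phi j)) -> chart_at p z ->
  forall K, hol (fun x => d_wedge phi z x K) (cmap z p).
Proof.
move=> hphi zp; rewrite /d_wedge; elim: (index_enum _) => [|i l IH] K.
  under eq_fun do rewrite big_nil; exact: hol_ext1.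
under eq_fun do rewrite big_cons; apply: hol_wedge => // {}K.
apply: hol_ext_vect => j; under eq_fun do rewrite mxE.
exact: hol_partial (hol_chart (hphi i) zp).
Qed.

Lemma hol_det_jac phi p z : (forall j, holomorphic_fun (phi j)) -> chart_at p z ->
  hol (fun x => \det (jac phi z x)) (cmap z p).
Proof. by move=> hphi zp; apply: hol_det_jacobian => j; exact: hol_chart. Qed.

Lemma jac_unit_change phi p z w : (forall j, holomorphic_fun (phi j)) ->
  chart_at p z -> chart_at p w ->
  \det (jac phi z (cmap z p)) != 0 -> \det (jac phi w (cmap w p)) != 0.
Proof.
move=> hphi zp wp; rewrite /jac (jacobian_mx_change hphi zp wp) det_mulmx mulf_eq0.
by rewrite negb_or => /andP[].
Qed.

End TopForms.

Section IdentityTheorem.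
Context {R : realType} {n : nat} {P : cmanifold (cplx R) n}.
Local Notation C := (cplx R).
Implicit Types (p q : P) (z w : chart C n P).

(** Complements of local zero loci: in each chart, N is where some holomorphic
    function does not vanish. These are the sets to which the identity theorem
    applies. *)
Definition principal (N : set P) := forall z, exists F : 'rV[C]_n -> C,
  forall q, chart_at q z -> hol F (cmap z q) /\ (F (cmap z q) != 0 <-> N q).

(** The interior of the complement of N is closed: if the local equation
    vanishes near points close to q, then, being holomorphic on a ball around
    them that contains q, it vanishes near q. As P is connected, this interior is
    empty. *)
Lemma principal_dense N : connected [set: P] -> principal N -> N !=set0 -> dense N.
Proof.
move=> cP pN [p1 Np1].
pose Z : set P := [set q | nbhs q (~` N)].
have oZ : open Z.
  rewrite openE => q Zq; have := nbhs_interior Zq; apply: filterS => q'.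
  by rewrite /interior.
have cZ : closed Z.
  move=> q clq; have [z zq] := chart_cover q.
  have [F hF] := pN z; have [hol_F _] := hF q zq.
  have [r [M [r0 hb]]] := hol_hball hol_F.
  have nb : \forall q' \near q, nr (cmap z q' - cmap z q) < r / 4.
    have := cmap_cvg zq; move/nr_cvg; apply; lra.
  have [q' [Zq' [nq' zq']]] := clq _ (filterI nb (chart_nbhs zq)).
  have F0 : \forall u \near cmap z q', F u = 0.
    have := near_chart (Q := fun _ u => F u = 0) zq'; apply.
    apply: filterS Zq' => q'' nN zq''; apply/eqP/negPn/negP => /(hF q'' zq'').2.
    exact: nN.
  have hb' : hball F (cmap z q') (r / 2) M.
    move=> x hx; apply: hb; apply: le_lt_trans (_ : nr (x - cmap z q') + nr (cmap z q' - cmap z q) < r).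
      by rewrite -[x - cmap z q](subrKA (cmap z q')); exact: nrD.
    by lra.
  have F0s : \forall u \near cmap z q', 0 = F u by apply: filterS F0 => u ->.
  have FZ := flat_zero hb' (fun k => ord_ge_near F0s (ord_ge_zero _ k)).
  have F0' : \forall u \near cmap z q, F u = 0.
    apply/nr_near; exists (r / 4); first by lra.
    move=> x hx; apply: FZ; apply: le_lt_trans (_ : nr (x - cmap z q) + nr (cmap z q - cmap z q') < r / 2).
      by rewrite -[x - cmap z q'](subrKA (cmap z q)); exact: nrD.
    by rewrite (nrBC (cmap z q)); lra.
  apply: filterS2 (chart_nbhs zq) (near_cmap zq F0') => y zy Fy /(hF y zy).2.
  by rewrite Fy eqxx.
move=> O [x Ox] oO; have [//|nON] := pselect (O `&` N !=set0).
have ZT : Z = [set: P].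
  apply: cP; [|by exists Z => //; rewrite setTI..].
  exists x; have : \forall q \near x, O q by apply: open_nbhs_nbhs; split.
  apply: filterS => q Oq Nq; apply: nON; exists q; split => //.
have : Z p1 by rewrite ZT.
by move=> /nbhs_singleton.
Qed.

End IdentityTheorem.

Section RegularLocus.
Context {R : realType} {n : nat} {P : cmanifold (cplx R) n}.
Local Notation C := (cplx R).
Implicit Types (p q : P) (z w : chart C n P).
Variable phi : 'I_n -> P -> C.
Hypothesis hphi : forall j, holomorphic_fun (phi j).

Let mul_neq0 (a b : C) : a * b != 0 -> a != 0 /\ b != 0.
Proof. by rewrite mulf_eq0 negb_or => /andP. Qed.

(** Quantifying over all charts makes the Jacobian condition independent of the
    choice of one, by [jac_unit_change]. *)
Definition regular_locus : set P := [set p | forall z, chart_at p z ->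
  \det (jac phi z (cmap z p)) * \prod_j phi j p != 0].

Lemma regular_principal : principal regular_locus.
Proof.
move=> z; exists (fun u => \det (jac phi z u) * \prod_j (phi j \o cinv z) u) => q zq.
split.
  apply: hol_mul; first exact: hol_det_jac.
  by apply: hol_prod => j; exact: hol_chart.
have E : \prod_j (phi j \o cinv z) (cmap z q) = \prod_j phi j q.
  by apply: eq_bigr => j _ /=; rewrite (cmapK zq.2).
rewrite E; split => [h w wq|h]; last exact: h.
have [h1 h2] := mul_neq0 h.
exact: (mulf_neq0 (jac_unit_change hphi zq wq h1) h2).
Qed.

(** At a point where the Jacobian determinant is nonzero, no phi j vanishes
    identically nearby, since the column j of the Jacobian matrix would. Hence the
    product of all these functions does not vanish identically either. *)
Lemma regular_nonempty : (exists p z, chart_at p z /\ d_wedge phi z (cmap z p) <> [ffun=> 0]) ->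
  regular_locus !=set0.
Proof.
move=> [p [z [zp nz]]].
have D0 : \det (jac phi z (cmap z p)) != 0.
  apply/eqP => D0; apply: nz; apply/ffunP => K; rewrite [RHS]ffunE.
  have [->|KT] := eqVneq K [set: 'I_n]%SET; first by rewrite d_wedge_top.
  exact: (homog_top (@homog_d_wedge R n P phi z (cmap z p)) KT).
pose F (j : 'I_n) := phi j \o cinv z.
have hF j : hol (F j) (cmap z p) by exact: hol_chart.
have eF j : exists e, exact_ord (F j) (cmap z p) e.
  apply: exact_ord_exists => // F0; move/eqP: D0; apply.
  rewrite (expand_det_col _ j) big1// => i _; rewrite [X in X * _]mxE.
  have Fi : partial i (F j) (cmap z p) = partial i (fun=> 0) (cmap z p).
    exact: (nbhs_singleton (near_partial i F0)).
  by rewrite -/(F j) Fi partialE dd_unlock derive_cst mul0r.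
have /(_ _)/cid - h := eF.
have eD : exact_ord (fun x => \det (jac phi z x)) (cmap z p) 0.
  by split; [exact: ord_ge0 (hol_det_jac hphi zp) | move=> /ord_ge_val D0'; rewrite D0' eqxx in D0].
have eP : exact_ord (fun x => \prod_j F j x) (cmap z p) (\sum_j sval (h j)).
  by apply: exact_ord_prod => // j; exact: svalP (h j).
have eDP := exact_ordM (hol_det_jac hphi zp) (hol_prod _ _ hF) eD eP.
have [//|nR] := pselect (regular_locus !=set0).
have [G hG] := regular_principal z.
case: (exact_ord_not_near0 eDP).
apply: (near_chart_all (Q := fun _ x => \det (jac phi z x) * \prod_j F j x = 0) zp).
move=> q zq; apply/eqP/negPn/negP => nq; apply: nR; exists q => w wq.
have [h1 h2] := mul_neq0 nq; apply: mulf_neq0; first exact: (jac_unit_change hphi zq wq h1).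
apply/prodf_neq0 => j _; move/prodf_neq0: h2 => /(_ j isT).
by rewrite /F /= (cmapK zq.2).
Qed.

Hypothesis cP : connected [set: P].
Hypothesis nondeg : exists p z, chart_at p z /\ d_wedge phi z (cmap z p) <> [ffun=> 0].

Lemma regular_dense : dense regular_locus.
Proof. exact: principal_dense cP regular_principal (regular_nonempty nondeg). Qed.

Lemma regular_not_near0 p z (F : 'rV[C]_n -> C) : chart_at p z ->
  (forall q, chart_at q z -> regular_locus q -> F (cmap z q) != 0) ->
  ~ \forall u \near cmap z p, F u = 0.
Proof.
move=> zp hF F0; have Fq := near_cmap zp F0.
have : nbhs p [set q | chart_at q z /\ F (cmap z q) = 0] by exact: filterI (chart_nbhs zp) Fq.
rewrite nbhsE => -[W [oW Wp] sW].
have [q [Wq rq]] : W `&` regular_locus !=set0 by apply: regular_dense => //; exists p.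
have [zq Fq0] := sW q Wq.
by have := hF q zq rq; rewrite Fq0 eqxx.
Qed.

Lemma exact_ord_jac p z : chart_at p z ->
  exists e, exact_ord (fun x => \det (jac phi z x)) (cmap z p) e.
Proof.
move=> zp; apply: exact_ord_exists; first exact: hol_det_jac.
by apply: (regular_not_near0 zp) => q zq rq; have [] := mul_neq0 (rq z zq).
Qed.

Lemma exact_ord_phi p z : chart_at p z ->
  exists f : 'I_n -> nat, forall j, exact_ord (phi j \o cinv z) (cmap z p) (f j).
Proof.
move=> zp; suff h j : exists e, exact_ord (phi j \o cinv z) (cmap z p) e.
  by exists (fun j => sval (cid (h j))) => j; exact: svalP.
apply: exact_ord_exists; first exact: hol_chart.
apply: (regular_not_near0 zp) => q zq rq; have [_ /prodf_neq0 /(_ j isT)] := mul_neq0 (rq z zq).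
by rewrite /= (cmapK zq.2).
Qed.

End RegularLocus.

(** * The infinitesimal action of the torus *)
Lemma id_diff (R : realType) (V : normedModType (cplx R)) (a : V) : differentiable (fun x : V => x) a.
Proof. by have [] := is_diff_id a. Qed.

Lemma pair_cvgr (U W : topologicalType) (a : U) (b : W) : (fun x : W => (a, x)) @ b --> (a, b).
Proof. exact: (cvg_pair (cvg_cst a) cvg_id). Qed.

Lemma pair_cvgl (U W : topologicalType) (a : U) (b : W) : (fun x : U => (x, b)) @ a --> (a, b).
Proof. exact: (cvg_pair cvg_id (cvg_cst b)). Qed.

Section TorusAction.
Context {R : realType} {m n : nat} {P : cmanifold (cplx R) n} { pi : poisson P}.
Local Notation C := (cplx R).
Variable T : torus_action m pi.
Implicit Types (p q : P) (z w : chart C n P) (t : 'rV[C]_m).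

Local Notation unit_t := (const_mx 1 : 'rV[C]_m).

Lemma torus1 : torus unit_t.
Proof. by move=> i; rewrite mxE oner_neq0. Qed.

Lemma torus_open : open (@torus C m).
Proof.
rewrite openE => t ht.
have h (i : 'I_m) : \forall s \near t, (s : 'rV[C]_m) 0 i != 0.
  exact: (cvgr_neq0 _ (@coord_continuous _ _ _ 0 i t) (ht i)).
exact: (@filter_forall _ _ (fun i => [set s : 'rV[C]_m | s 0 i != 0]) (nbhs t) _ h).
Qed.

Definition torus_inv t : 'rV[C]_m := \row_i (t 0 i)^-1.

Lemma torus_invP t : torus t -> torus (torus_inv t).
Proof. by move=> ht i; rewrite mxE invr_neq0. Qed.

Lemma act_inv t p : torus t -> act T (torus_inv t) (act T t p) = p.
Proof.
move=> ht; rewrite -act_mul//; last exact: torus_invP.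
have -> : torus_mul (torus_inv t) t = const_mx 1.
  by apply/rowP => i; rewrite !mxE mulVf.
exact: act_one.
Qed.

Lemma act_cvg t p : torus t ->
  (fun tp : 'rV[C]_m * P => act T tp.1 tp.2) @ (t, p) --> act T t p.
Proof.
move=> ht; have := @act_continuous C m n P pi T.
have oT : open [set tp : 'rV[C]_m * P | torus tp.1].
  apply: (@open_comp _ _ (@fst 'rV[C]_m P) (@torus C m) _ torus_open) => x _; exact: cvg_fst.
rewrite (continuous_open_subspace _ oT) => /(_ (t, p)); apply.
by rewrite inE.
Qed.

Lemma near_act p z : chart_at p z ->
  \forall tu \near (unit_t, cmap z p), [/\ torus tu.1, chart_at (cinv z tu.2) z,
    cmap z (cinv z tu.2) = tu.2 & chart_at (act T tu.1 (cinv z tu.2)) z].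
Proof.
move=> zp.
have h1 : \forall tu \near (unit_t, cmap z p), torus tu.1.
  exact: (cvg_fst (open_nbhs_nbhs (conj torus_open torus1))).
have h2 : \forall tu \near (unit_t, cmap z p), chart_at (cinv z tu.2) z /\
    cmap z (cinv z tu.2) = tu.2.
  exact: (cvg_snd (near_chart_at zp zp)).
have c1 : (fun tu : 'rV[C]_m * 'rV[C]_n => (tu.1, cinv z tu.2)) @ (unit_t, cmap z p) --> (unit_t, p).
  have f1 : (fun tu : 'rV[C]_m * 'rV[C]_n => tu.1) @ (unit_t, cmap z p) --> unit_t by exact: cvg_fst.
  have f2 : (fun tu : 'rV[C]_m * 'rV[C]_n => cinv z tu.2) @ (unit_t, cmap z p) --> p.
    by apply: (@cvg_comp _ _ _ snd (cinv z) _ _ _ _ (cinv_cvg zp)); exact: cvg_snd.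
  exact: (cvg_pair f1 f2).
have c2 : (fun tu : 'rV[C]_m * 'rV[C]_n => act T tu.1 (cinv z tu.2)) @ (unit_t, cmap z p) --> p.
  have := cvg_comp _ _ c1 (act_cvg (p := p) torus1).
  by rewrite act_one.
have h3 : \forall tu \near (unit_t, cmap z p), chart_at (act T tu.1 (cinv z tu.2)) z.
  exact: (c2 _ (chart_nbhs zp)).
apply: filterS2 h1 (filterI h2 h3) => tu a [[b c] d]; split => //.
Qed.

Definition chart_act z (tu : 'rV[C]_m * 'rV[C]_n) : 'rV[C]_n := cmap z (act T tu.1 (cinv z tu.2)).

Lemma differentiable_chart_act t q z : torus t -> chart_at q z -> chart_at (act T t q) z ->
  differentiable (chart_act z) (t, cmap z q).
Proof. by move=> ht zq ztq; exact: (act_holo ht zq ztq). Qed.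

Lemma hol_chart_act p z j : chart_at p z -> hol (fun tu => chart_act z tu 0 j) (unit_t, cmap z p).
Proof.
move=> zp; apply: filterS (near_act zp) => -[t u] [/= ht zq Eu ztq].
have := differentiable_chart_act ht zq ztq; rewrite Eu => dG.
exact: (differentiable_entry 0 j dG).
Qed.

Lemma chart_act1 q z : chart_at q z -> chart_at (act T unit_t q) z.
Proof. by rewrite act_one. Qed.

Lemma differentiable_orbit q z : chart_at q z ->
  differentiable (fun t => cmap z (act T t q)) unit_t.
Proof.
move=> zq.
have dp : differentiable (fun t : 'rV[C]_m => (t, cmap z q)) unit_t.
  exact: (differentiable_pair (id_diff _) (@differentiable_cst _ _ _ _ _)).
have -> : (fun t => cmap z (act T t q)) = chart_act z \o (fun t => (t, cmap z q)).
  by apply/funext => t; rewrite /chart_act /= (cmapK zq.2).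
exact: (differentiable_comp dp (differentiable_chart_act torus1 zq (chart_act1 zq))).
Qed.

Lemma infinitesimalE q z x j : chart_at q z ->
  infinitesimal T z q x 0 j = dd (x, 0) (fun tu => chart_act z tu 0 j) (unit_t, cmap z q).
Proof.
move=> zq; rewrite /infinitesimal -(derive_entry _ _ _ (differentiable_orbit zq)) dd_unlock.
have E : (fun h : C => h^-1 *: (chart_act z (h *: (x, 0) + (unit_t, cmap z q)) 0 j -
      chart_act z (unit_t, cmap z q) 0 j)) =
    (fun h : C => h^-1 *: (cmap z (act T (h *: x + unit_t) q) 0 j - cmap z (act T unit_t q) 0 j)).
  by apply/funext => h; rewrite /chart_act /= scaler0 add0r (cmapK zq.2).
exact: (congr1 (fun F : C -> C => lim (F @ (0 : C)^')) (esym E)).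
Qed.

(** It is a partial derivative, in the direction of the torus, of the action read
    in the chart, which is holomorphic in both variables jointly. *)
Lemma hol_infinitesimal p z x j : chart_at p z ->
  hol (fun u => infinitesimal T z (cinv z u) x 0 j) (cmap z p).
Proof.
move=> zp.
have h1 : hol (fun u => dd (x, 0) (fun tu => chart_act z tu 0 j) (unit_t, u)) (cmap z p).
  have hd := hol_dd (x, 0) (hol_chart_act j zp).
  have c1 : (fun u : 'rV[C]_n => (unit_t, u)) @ cmap z p --> (unit_t, cmap z p).
    exact: pair_cvgr.
  have hn : \forall u \near cmap z p,
      differentiable (dd (x, 0) (fun tu => chart_act z tu 0 j)) (unit_t, u) by exact: (c1 _ hd).
  rewrite /hol; apply: filterS hn => u du.
  have dp : differentiable (fun u : 'rV[C]_n => (unit_t, u)) u.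
    exact: (differentiable_pair (@differentiable_cst _ _ _ _ _) (id_diff _)).
  exact: (differentiable_comp dp du).
apply: hol_hball_eq h1.
have := near_chart_all (Q := fun q u => dd (x, 0) (fun tu => chart_act z tu 0 j) (unit_t, u) =
  infinitesimal T z q x 0 j) zp; apply => q zq.
by rewrite infinitesimalE.
Qed.

(** Differentiating f(t p) = chi(t) f(p) at t = 1. Where f p vanishes, f is zero
    on the orbit of p; elsewhere chi is differentiable at 1, being a quotient. *)
Lemma weight_derivative (f : P -> C) chi x q z : holomorphic_fun f ->
  (forall t p, torus t -> f (act T t p) = chi t * f p) -> chart_at q z ->
  \sum_l infinitesimal T z q x 0 l * partial l (f \o cinv z) (cmap z q) =
  'D_x chi unit_t * f q.
Proof.
move=> hf wf zq.
have df : differentiable (f \o cinv z) (cmap z (act T unit_t q)).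
  by rewrite act_one; exact: (hf q z zq).
have := chain_row x (differentiable_orbit zq) df; rewrite act_one => <-.
have E : \forall t \near unit_t, (f \o cinv z) (cmap z (act T t q)) = f q *: chi t.
  have h2 : \forall t \near unit_t, chart_at (act T t q) z.
    have c : (fun t : 'rV[C]_m => act T t q) @ unit_t --> q.
      have c1 : (fun t : 'rV[C]_m => (t, q)) @ unit_t --> (unit_t, q).
        exact: pair_cvgl.
      by have := cvg_comp _ _ c1 (act_cvg (p := q) torus1); rewrite act_one.
    exact: (c _ (chart_nbhs zq)).
  apply: filterS2 h2 (open_nbhs_nbhs (conj torus_open torus1)) => t zt ht /=.
  by rewrite (cmapK zt.2) wf // mulrC.
have dfo : differentiable (fun t => (f \o cinv z) (cmap z (act T t q))) unit_t.
  exact: (differentiable_comp (differentiable_orbit zq) df).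
have [f0|f0] := eqVneq (f q) 0.
  rewrite f0 mulr0 (near_eq_derive x (g := cst 0)) ?derive_cst//.
  by apply: filterS E => t ->; rewrite f0 scale0r.
have E' : \forall t \near unit_t, chi t = ((f q)^-1 \*: (fun t => (f \o cinv z) (cmap z (act T t q)))) t.
  by apply: filterS E => t Et; rewrite /= [f (cinv z _)]Et scalerA mulVf// scale1r.
rewrite (near_eq_derive x E') (deriveZ _ (diff_derivable dfo)).
by rewrite mulrAC mulVf// mul1r.
Qed.

Lemma infinitesimal_fixed p z x : T_fixed T p -> chart_at p z -> infinitesimal T z p x = 0.
Proof.
move=> fp zp; rewrite /infinitesimal (near_eq_derive x (g := cst (cmap z p))) ?derive_cst//.
by apply: filterS (open_nbhs_nbhs (conj torus_open torus1)) => t ht; rewrite fp.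
Qed.

End TorusAction.

(** * The rank of the Poisson structure *)
Section RankLemmas.
Context {C : fieldType}.

Lemma rank_congr_le m n (B : 'M[C]_n) (J : 'M[C]_(n, m)) : (\rank (J^T *m B *m J) <= \rank B)%N.
Proof. exact: leq_trans (mxrankM_maxl _ _) (mxrankM_maxr _ _). Qed.

Lemma max_rank_bound n (S : set 'M[C]_n) (A : 'M[C]_n) : S A -> (\rank A <= max_rank S)%N.
Proof.
move=> SA; have rn : (\rank A < n.+1)%N by rewrite ltnS rank_leq_row.
have := @leq_bigmax_cond _ (fun k : 'I_n.+1 => `[< exists2 A, S A & \rank A = k >])
  (fun k => k : nat) (Ordinal rn); apply.
by apply/asboolP; exists A.
Qed.

Lemma max_rank_lub n (S : set 'M[C]_n) k : (forall A, S A -> (\rank A <= k)%N) ->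
  (max_rank S <= k)%N.
Proof.
move=> h; apply/bigmax_leqP => i /asboolP[A SA <-]; exact: h.
Qed.

Lemma congruent_sub n (B L J D : 'M[C]_n) (s v : 'rV[C]_n) : J \in unitmx -> D \in unitmx ->
  J^T *m B *m J = D *m L *m D -> s *m J = v *m D -> (s <= B)%MS = (v <= L)%MS.
Proof.
move=> uJ uD EB Es.
have uJT : J^T \in unitmx by rewrite unitmx_tr.
have fJ : row_free J by rewrite row_free_unit.
have fD : row_free D by rewrite row_free_unit.
rewrite -(submxMfree s B fJ) Es -(submxMfree v L fD).
have e1 : (J^T *m B *m J :=: B *m J)%MS.
  by rewrite -mulmxA; apply: eqmxMfull; rewrite row_full_unit.
have e2 : (D *m L *m D :=: L *m D)%MS.
  by rewrite -mulmxA; apply: eqmxMfull; rewrite row_full_unit.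
by rewrite -(e1 : (_ :=: _)%MS) EB e2.
Qed.

Lemma congruent_rank n (B L J D : 'M[C]_n) : J \in unitmx -> D \in unitmx ->
  J^T *m B *m J = D *m L *m D -> \rank B = \rank L.
Proof.
move=> uJ uD EB.
have rk (A M : 'M[C]_n) (A' : 'M[C]_n) : A \in unitmx -> A' \in unitmx -> \rank (A *m M *m A') = \rank M.
  move=> uA uA'; rewrite mxrankMfree ?row_free_unit//.
  have fA : row_full A by rewrite row_full_unit.
  by rewrite (eqmxMfull M fA).
by rewrite -(rk J^T B J) ?unitmx_tr// EB rk.
Qed.

Lemma diag_congr_skew n (B L J D : 'M[C]_n) : D \in unitmx -> D^T = D -> B^T = - B ->
  J^T *m B *m J = D *m L *m D -> L^T = - L.
Proof.
move=> uD DT BT EB.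
have : D *m L^T *m D = D *m (- L) *m D.
  have -> : D *m L^T *m D = (D *m L *m D)^T by rewrite !trmx_mul DT mulmxA.
  by rewrite -EB !trmx_mul trmxK BT mulNmx mulmxN mulmxA EB mulmxN mulNmx.
by move/(can_inj (mulmxK uD))/(can_inj (mulKmx uD)).
Qed.

End RankLemmas.

Section PoissonRank.
Context {R : realType} {m n : nat} {P : cmanifold (cplx R) n} { pi : poisson P}.
Local Notation C := (cplx R).
Variable T : torus_action m pi.
Implicit Types (p q : P) (z w : chart C n P).
Variable L : set P.
Hypothesis leafL : T_leaf T L.

Lemma act_rank_le t p z w : torus t -> chart_at p z -> chart_at (act T t p) w ->
  (\rank (bivect pi w (cmap w (act T t p))) <= \rank (bivect pi z (cmap z p)))%N.
Proof. by move=> ht zp wp; have E := act_poisson ht zp wp; rewrite E rank_congr_le. Qed.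

(** Along a symplectic leaf the rank is the dimension of the leaf, and the torus
    acts by Poisson automorphisms. *)
Lemma leaf_rank : exists k, forall p z, L p -> chart_at p z ->
  \rank (bivect pi z (cmap z p)) = k.
Proof.
have [S [[k [M [iota [[_ _ _ hJ] rS]]]] _] ->] := leafL.
have rk p z : S p -> chart_at p z -> \rank (bivect pi z (cmap z p)) = k.
  rewrite -rS => -[q _ <-] zp; have [w wq] := chart_cover q.
  have [/eqP fJ /eqmx_rank <-] := hJ q w z wq zp.
  exact: fJ.
exists k => p z [t ht [q Sq <-]] zp; have [w wq] := chart_cover q.
have qE : act T (torus_inv t) (act T t q) = q by exact: act_inv.
have wq' : chart_at (act T (torus_inv t) (act T t q)) w by rewrite qE.
have le1 := act_rank_le ht wq zp.
have := act_rank_le (torus_invP ht) zp wq'; rewrite qE => le2.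
by apply/eqP; rewrite eqn_leq -{1}(rk q w Sq wq) le1 -(rk q w Sq wq) le2.
Qed.

Lemma entry_cvg p z (F : 'rV[C]_n -> C) : chart_at p z -> hol F (cmap z p) ->
  {for p, continuous (fun q => F (cmap z q))}.
Proof.
move=> zp hF; have cF : {for cmap z p, continuous F} := differentiable_continuous (hol_at hF).
exact: (cvg_comp _ _ (cmap_cvg zp) cF).
Qed.

Hypothesis denseL : dense L.

(** The rank can only increase near a point. *)
Lemma dense_rank_le k (D : set P) : dense D ->
  (forall p z, D p -> chart_at p z -> (\rank (bivect pi z (cmap z p)) <= k)%N) ->
  forall p z, chart_at p z -> (\rank (bivect pi z (cmap z p)) <= k)%N.
Proof.
move=> dD hD p z zp.
have sc : \forall q \near p, (\rank (bivect pi z (cmap z p)) <= \rank (bivect pi z (cmap z q)))%N.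
  apply: (@rank_semicontinuous _ _ _ _ (fun q => bivect pi z (cmap z q))) => i j.
  exact: (entry_cvg zp (hol_bivect pi i j zp)).
have : nbhs p [set q | (\rank (bivect pi z (cmap z p)) <= \rank (bivect pi z (cmap z q)))%N /\
  chart_at q z] by exact: filterI sc (chart_nbhs zp).
rewrite nbhsE => -[W [oW Wp] sW].
have [q [Wq Dq]] : W `&` D !=set0 by apply: dD => //; exists p.
by have [le zq] := sW q Wq; apply: leq_trans le (hD q z Dq zq).
Qed.

Lemma leaf_poisson_rank p : 
  (forall q z, L q -> chart_at q z -> \rank (bivect pi z (cmap z q)) = poisson_rank pi) /\
  (forall q z, chart_at q z -> (\rank (bivect pi z (cmap z q)) <= poisson_rank pi)%N).
Proof.
have le q z : chart_at q z -> (\rank (bivect pi z (cmap z q)) <= poisson_rank pi)%N.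
  by move=> zq; apply: max_rank_bound; exists q, z.
split => // q z Lq zq.
apply/eqP; rewrite eqn_leq le//=.
have [k hk] := leaf_rank; rewrite (hk q z Lq zq).
apply: max_rank_lub => A [p' [w [wp' ->]]].
by apply: (dense_rank_le denseL) => // p'' z'' Lp'' zp''; rewrite (hk p'' z'').
Qed.

End PoissonRank.

(** * The constant matrices of a log-canonical system *)
Section LogCanonicalConstants.
Context {R : realType} {m n k : nat} {P : cmanifold (cplx R) n} { pi : poisson P}.
Local Notation C := (cplx R).
Variable T : torus_action m pi.
Implicit Types (p q : P) (z w : chart C n P).
Variables (L : set P) (X : 'M[C]_(k, m)) (phi : 'I_n -> P -> C).

Definition sigma_mx z (u : 'rV[C]_n) : 'M[C]_(k, n) :=
  \matrix_i infinitesimal T z (cinv z u) (row i X).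

Definition diag_at z := diag_phi (fun j => phi j \o cinv z).

Lemma pfaffianE r z u : pfaffian T r X z u = pfq r (bivect pi z u) (sigma_mx z u).
Proof. by congr wedge; apply: eq_bigr => i _; rewrite rowK. Qed.

Lemma hol_sigma_mx p z i j : chart_at p z -> hol (fun u => sigma_mx z u i j) (cmap z p).
Proof. by move=> zp; under eq_fun do rewrite mxE; exact: hol_infinitesimal. Qed.

Lemma infinitesimal_linear p z (y : 'rV[C]_k) : chart_at p z ->
  infinitesimal T z p (y *m X) = y *m sigma_mx z (cmap z p).
Proof.
move=> zp; have dz := differentiable_orbit T zp.
rewrite /infinitesimal (deriveE _ dz) mulmx_sum_row linear_sum mulmx_sum_row.
apply: eq_bigr => i _; rewrite linearZ /= rowK /infinitesimal (cmapK zp.2).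
by rewrite (deriveE _ dz).
Qed.

Hypothesis logphi : log_canonical T phi.
Hypothesis cP : connected [set: P].
Hypothesis leafL : T_leaf T L.
Hypothesis denseL : dense L.
Hypothesis openL : open L.
Hypothesis basisX : complement_basis X (lie_stabilizer T L).

Let hphi : forall j, holomorphic_fun (phi j). Proof. by have [] := logphi. Qed.
Let nondeg : exists p z, chart_at p z /\ d_wedge phi z (cmap z p) <> [ffun=> 0].
Proof. by have [] := logphi. Qed.

Lemma regular_units p z : regular_locus phi p -> chart_at p z ->
  jac phi z (cmap z p) \in unitmx /\ diag_at z (cmap z p) \in unitmx.
Proof.
move=> rp zp; have := rp z zp; rewrite mulf_eq0 negb_or => /andP[h1 /prodf_neq0 h2].
rewrite !unitmxE !unitfE; split; first exact: h1.
rewrite det_diag_phi; apply/prodf_neq0 => j _ /=; rewrite (cmapK zp.2); exact: h2.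
Qed.

(** The matrix of the brackets of the phi j is J^T B J. *)
Lemma bracket_matrix : exists Lam : 'M[C]_n, forall p z, chart_at p z ->
  (jac phi z (cmap z p))^T *m bivect pi z (cmap z p) *m jac phi z (cmap z p) =
  diag_at z (cmap z p) *m Lam *m diag_at z (cmap z p).
Proof.
have [_ hc _ _] := logphi.
exists (\matrix_(i, j) sval (cid (hc i j))) => p z zp; apply/matrixP => i j.
have := svalP (cid (hc i j)) p z zp; set c := sval _ => hb.
have -> : (diag_at z (cmap z p) *m (\matrix_(i, j) sval (cid (hc i j))) *m diag_at z (cmap z p)) i j =
    c * (phi i p * phi j p).
  by rewrite mul_mx_diag mxE mul_diag_mx !mxE /= (cmapK zp.2) -/c; ring.
rewrite -hb /bracket [LHS]mxE [RHS]exchange_big /=; apply: eq_bigr => l _.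
rewrite [X in X * _]mxE big_distrl /=; apply: eq_bigr => q _.
have -> : (jac phi z (cmap z p))^T i q = partial q (phi i \o cinv z) (cmap z p).
  by rewrite [LHS]mxE [LHS]mxE.
have -> : jac phi z (cmap z p) l j = partial l (phi j \o cinv z) (cmap z p).
  by rewrite [LHS]mxE.
by rewrite (mulrC (partial q _ _)) .
Qed.

Lemma weight_matrix : exists nu : 'rV[C]_m -> 'rV[C]_n, forall p z x, chart_at p z ->
  infinitesimal T z p x *m jac phi z (cmap z p) = nu x *m diag_at z (cmap z p).
Proof.
have [_ _ _ hw] := logphi.
exists (fun x => \row_j 'D_x (sval (cid (hw j))) (const_mx 1)) => p z x zp.
apply/rowP => j; rewrite mul_mx_diag !mxE.
have := svalP (cid (hw j)) => /(weight_derivative x (hphi j)) /(_ zp).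
rewrite /= (cmapK zp.2) => <-; apply: eq_bigr => l _.
by rewrite mxE.
Qed.

(** At a regular point, sigma(y X) is tangent to the symplectic leaf if and only
    if y * cc lies in the row space of Lam, a condition that does not involve the
    point. If it holds, then sigma(y X) is tangent at all regular points, hence
    at all points of L, since the rank is constant on L and semicontinuous; as X
    spans a complement of the stabilizer, y = 0. *)
Lemma log_canonical_constants : exists (Lam : 'M[C]_n) (cc : 'M[C]_(k, n)),
  [/\ forall p z, chart_at p z ->
        (jac phi z (cmap z p))^T *m bivect pi z (cmap z p) *m jac phi z (cmap z p) =
        diag_at z (cmap z p) *m Lam *m diag_at z (cmap z p),
      forall p z, chart_at p z ->
        sigma_mx z (cmap z p) *m jac phi z (cmap z p) = cc *m diag_at z (cmap z p),
      Lam^T = - Lam, \rank Lam = poisson_rank pi &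
      forall y : 'rV_k, (y *m cc <= Lam)%MS -> y = 0].
Proof.
have [Lam hLam] := bracket_matrix; have [nu hnu] := weight_matrix.
pose cc : 'M[C]_(k, n) := \matrix_i nu (row i X).
have hcc p z : chart_at p z ->
    sigma_mx z (cmap z p) *m jac phi z (cmap z p) = cc *m diag_at z (cmap z p).
  move=> zp; apply/row_matrixP => i; rewrite !row_mul !rowK (cmapK zp.2).
  exact: hnu.
have dR : dense (regular_locus phi) by exact: (regular_dense hphi cP nondeg).
have [p1 [_ [Lp1 Rp1]]] : [set: P] `&` (L `&` regular_locus phi) !=set0.
  have [p0 _] := nondeg.
  by apply: (denseI openL denseL dR) => //; [exists p0 | exact: openT].
have [z1 zp1] := chart_cover p1.
have [uJ1 uD1] := regular_units Rp1 zp1.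
have rkL := (leaf_poisson_rank leafL denseL p1).1.
have rkle := (leaf_poisson_rank leafL denseL p1).2.
exists Lam, cc; split => //.
- have BT : (bivect pi z1 (cmap z1 p1))^T = - bivect pi z1 (cmap z1 p1) by exact: bivect_anti.
  have DT : (diag_at z1 (cmap z1 p1))^T = diag_at z1 (cmap z1 p1) by exact: tr_diag_mx.
  exact: (diag_congr_skew uD1 DT BT (hLam p1 z1 zp1)).
- by rewrite -(congruent_rank uJ1 uD1 (hLam p1 z1 zp1)) rkL.
move=> y ycc.
have regular_sub p z : regular_locus phi p -> chart_at p z ->
    (y *m sigma_mx z (cmap z p) <= bivect pi z (cmap z p))%MS.
  move=> Rp zp; have [uJ uD] := regular_units Rp zp.
  by rewrite (congruent_sub uJ uD (hLam p z zp) (v := y *m cc)) // -mulmxA hcc // mulmxA.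
have leaf_sub p z : L p -> chart_at p z ->
    (y *m sigma_mx z (cmap z p) <= bivect pi z (cmap z p))%MS.
  move=> Lp zp.
  pose F q := col_mx (bivect pi z (cmap z q)) (y *m sigma_mx z (cmap z q)).
  have sc : \forall q \near p, (\rank (F p) <= \rank (F q))%N.
    apply: rank_semicontinuous => i j; change (continuous_at p (fun q => F q i j)).
    case: (splitP i) => i' ei.
      have -> : (fun q => F q i j) = (fun q => bivect pi z (cmap z q) i' j).
        apply/funext => q; have -> : i = lshift 1 i' by apply/val_inj.
        exact: col_mxEu.
      exact: (entry_cvg zp (hol_bivect pi i' j zp)).
    have -> : (fun q => F q i j) = (fun q => (y *m sigma_mx z (cmap z q)) i' j).
      apply/funext => q; have -> : i = rshift n i' by apply/val_inj.
      exact: col_mxEd.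
    apply: (entry_cvg (F := fun u => (y *m sigma_mx z u) i' j) zp).
    apply: (hol_mulmx (A := fun=> y)) => a b; first exact: hol_cst.
    exact: hol_sigma_mx.
  have : nbhs p [set q | (\rank (F p) <= \rank (F q))%N /\ chart_at q z].
    exact: filterI sc (chart_nbhs zp).
  rewrite nbhsE => -[W [oW Wp] sW].
  have [q [Wq Rq]] : W `&` regular_locus phi !=set0 by apply: dR => //; exists p.
  have [leq zq] := sW q Wq.
  have eF : (F q :=: bivect pi z (cmap z q))%MS.
    by apply/eqmxP; rewrite col_mx_sub submx_refl regular_sub //= -addsmxE addsmxSl.
  have le2 : (\rank (F p) <= \rank (bivect pi z (cmap z p)))%N.
    by rewrite (rkL p z Lp zp); apply: leq_trans leq _; rewrite eF; exact: rkle.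
  have sF : (bivect pi z (cmap z p) <= F p)%MS by rewrite /F -addsmxE addsmxSl.
  have := mxrank_leqif_sup sF => /geq_leqif; rewrite le2 => /esym.
  by apply: submx_trans; rewrite /F -addsmxE addsmxSr.
have [fX cX _] := basisX.
have yX : y *m X = 0.
  apply: cX; first exact: submxMl.
  by move=> p z Lp zp; rewrite infinitesimal_linear //; exact: leaf_sub.
by apply: (row_free_inj fX); rewrite yX mul0mx.
Qed.

End LogCanonicalConstants.

(** * The linearization and the theorem *)
Section Linearization.
Context {R : realType} {n : nat}.
Local Notation C := (cplx R).
Local Notation V := 'rV[C]_n.

Lemma lead_inj (f : C -> C) k c d : lead f k c -> lead f k d -> c = d.
Proof.
move=> h1 h2; apply/eqP; rewrite -subr_eq0; apply/eqP; apply: (@ord_ge_coef _ _ k).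
have := ord_geB h2 h1; congr (ord_ge _ _ _); apply/funext => t; ring.
Qed.

Lemma derive_derive (f : V -> C) u v i : differentiable f u ->
  partial i (fun w => 'D_w f u) v = partial i f u.
Proof.
move=> df; have cd : continuous ('d f u : V -> C) := diff_continuous df.
have -> : (fun w => 'D_w f u) = 'd f u by apply/funext => w; exact: deriveE.
rewrite /partial (deriveE _ (linear_differentiable v cd)) (diff_lin _ cd).
by rewrite (deriveE _ df).
Qed.

(** Where B vanishes, only its derivative contributes to the derivative of a
    bracket. *)
Lemma lin_bivect_bracket (B : V -> 'M[C]_n) (u : V) (f g : V -> C) v :
  (forall i j, hol (fun x => B x i j) u) -> B u = 0 -> hol f u -> hol g u ->
  bracket (lin_bivect u B) (fun w => 'D_w f u) (fun w => 'D_w g u) v = 'D_v (bracket B f g) u.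
Proof.
move=> hB B0 hf hg.
have val0 (h : V -> C) : hol h u -> lead (fun t => h (u + t *: v)) 0 (h u).
  by move=> hh; have := ord_ge_approx v hh (ord_ge0 hh); rewrite /hpart /= divr1.
have hb : hol (bracket B f g) u.
  rewrite /bracket; apply: (hol_sum _ _ (F := fun i x => \sum_j B x i j * partial i f x * partial j g x)) => i.
  apply: (hol_sum _ _ (F := fun j x => B x i j * partial i f x * partial j g x)) => j.
  apply: hol_mul (hol_partial j hg); exact: hol_mul (hB i j) (hol_partial i hf).
have b0 : bracket B f g u = 0.
  by rewrite /bracket big1// => i _; rewrite big1// => j _; rewrite B0 mxE !mul0r.
have l1 := lead_linear v hb b0.
rewrite dd_unlock in l1; apply/esym; apply: (lead_inj l1).
rewrite /bracket; apply: (lead_sum _) => i; apply: (lead_sum _) => j.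
rewrite !derive_derive; [|exact: hol_at hg|exact: hol_at hf].
have := leadM (leadM (lead_bivect hB B0 v i j) (val0 _ (hol_partial i hf))) (val0 _ (hol_partial j hg)).
by rewrite !addn0.
Qed.

Lemma lin_bivect_linear (B : V -> 'M[C]_n) (u : V) :
  (forall i j, hol (fun x => B x i j) u) -> linear (lin_bivect u B).
Proof.
move=> hB c v w; rewrite [c *: v + w]addrC [RHS]addrC; apply/matrixP => i j.
by have E := nbhs_singleton (dd_dir c w v (hB i j)); rewrite !mxE; exact: E.
Qed.

End Linearization.

Lemma lowest_degree_inj (C : numFieldType) n (J : Type) (F : J -> 'rV[C]_n -> C) u e e' :
  lowest_degree F u e -> lowest_degree F u e' -> e = e'.
Proof.
move=> [[j [a [da na]]] h] [[j' [a' [da' na']]] h']; apply/eqP; rewrite eqn_leq.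
apply/andP; split; rewrite leqNgt; apply/negP => lt.
  by move/eqP: na'; apply; apply: h; rewrite da'.
by move/eqP: na; apply; apply: h'; rewrite da.
Qed.

Section MainProof.
Context {R : realType} {m n : nat} {P : cmanifold (cplx R) n} { pi : poisson P}.
Local Notation C := (cplx R).
Variables (T : torus_action m pi) (L : set P) (r : nat) (X : 'M[C]_(n - r.*2, m)).
Hypothesis cP : connected [set: P].
Hypothesis leafL : T_leaf T L.
Hypothesis openL : open L.
Hypothesis denseL : dense L.
Hypothesis rank_r : poisson_rank pi = r.*2.
Hypothesis basisX : complement_basis X (lie_stabilizer T L).
Variables (p0 : P) (z : chart C n P).
Hypothesis zp0 : chart_at p0 z.
Variable phi : 'I_n -> P -> C.
Hypothesis logphi : log_canonical T phi.

Local Notation u0 := (cmap z p0).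
Local Notation phiz := (fun j => phi j \o cinv z).

Let hphi : forall j, holomorphic_fun (phi j). Proof. by have [] := logphi. Qed.

Lemma rank_dim : (r + r + (n - r.*2))%N = n.
Proof.
rewrite addnn subnKC // -rank_r; apply: max_rank_lub => A _; exact: rank_leq_row.
Qed.

Lemma log_canonical_orders : exists e f d (Lam : 'M[C]_n) (cc : 'M[C]_(n - r.*2, n)),
  [/\ exact_ord (fun x => \det (jacobian_mx phiz x)) u0 e,
      forall j, exact_ord (phi j \o cinv z) u0 (f j),
      exact_ord (fun x => pfaffian T r X z x [set: 'I_n]%SET) u0 d,
      (e + d)%N = (\sum_j f j)%N & [/\ \det (bordered Lam cc) != 0,
      \forall x \near u0, (jacobian_mx phiz x)^T *m bivect pi z x *m jacobian_mx phiz x =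
         diag_phi phiz x *m Lam *m diag_phi phiz x &
      \forall x \near u0, sigma_mx T X z x *m jacobian_mx phiz x = cc *m diag_phi phiz x]].
Proof.
have [Lam [cc [hB hs skL rL inj]]] := log_canonical_constants logphi cP leafL denseL openL basisX.
have [_ _ nd _] := logphi.
have [e eD] := exact_ord_jac hphi cP nd zp0.
have [f ef] := exact_ord_phi hphi cP nd zp0.
have nB := near_chart_all (Q := fun _ x => (jacobian_mx phiz x)^T *m bivect pi z x *m jacobian_mx phiz x =
  diag_phi phiz x *m Lam *m diag_phi phiz x) zp0 (fun q zq => hB q z zq).
have ns := near_chart_all (Q := fun _ x => sigma_mx T X z x *m jacobian_mx phiz x = cc *m diag_phi phiz x)
  zp0 (fun q zq => hs q z zq).
have rk : \rank (col_mx Lam cc) = n by rewrite (rank_col_mx inj) rL rank_r -[RHS]rank_dim addnn.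
have rL2 : \rank Lam = (r + r)%N by rewrite rL rank_r addnn.
have skew : \forall x \near u0, (bivect pi z x)^T = - bivect pi z x /\ (\rank (bivect pi z x) <= r + r)%N.
  apply: (near_chart_all (Q := fun _ x => (bivect pi z x)^T = - bivect pi z x /\
    (\rank (bivect pi z x) <= r + r)%N) zp0) => q zq; split; first exact: bivect_anti.
  by rewrite addnn -rank_r; exact: (leaf_poisson_rank leafL denseL p0).2.
have [d ed Ed] := @exact_ord_pfaffian _ _ _ u0 phiz (bivect pi z) (sigma_mx T X z) Lam cc
  (fun i j => hol_bivect pi i j zp0) (fun i j => hol_sigma_mx T X i j zp0)
  (fun j => hol_chart (hphi j) zp0) nB ns e f eD ef r rank_dim skew skL (eq_leq rL2)
  (pfq_neq0 rank_dim skL rL2 rk).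
exists e, f, d, Lam, cc; split; [exact: eD | exact: ef | | exact: Ed | ].
  have -> : (fun x => pfaffian T r X z x [set: 'I_n]%SET) =
    (fun x => pfq r (bivect pi z x) (sigma_mx T X z x) [set: 'I_n]%SET).
    by apply/funext => x; rewrite pfaffianE.
  exact: ed.
by split; [exact: det_bordered_neq0 | exact: nB | exact: ns].
Qed.

Lemma pfaffian_log_degrees e f d :
  exact_ord (fun x => \det (jacobian_mx phiz x)) u0 e ->
  (forall j, exact_ord (phi j \o cinv z) u0 (f j)) ->
  exact_ord (fun x => pfaffian T r X z x [set: 'I_n]%SET) u0 d ->
  (e + d)%N = (\sum_j f j)%N ->
  low_degree_log_volume phi p0 z ((e + n)%N%:Z - (\sum_j f j)%N%:Z) /\
  low_degree_multivect n (pfaffian T r X) p0 z (- ((e + n)%N%:Z - (\sum_j f j)%N%:Z)).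
Proof.
move=> eD ef ed Ed; split.
  exists e, (\sum_j f j)%N; split; last by rewrite PoszD.
    apply: top_form_degree.
    - by move=> x; exact: homog_d_wedge.
    - exact: hol_d_wedge.
    - by move: eD; congr (exact_ord _ _ _); apply/funext => x; rewrite d_wedge_top.
  have eP := exact_prod_phi (fun j => hol_chart (hphi j) zp0) ef.
  apply/lowest_degreeP => [_|]; first exact: (hol_prod_phi (fun j => hol_chart (hphi j) zp0)).
  by split=> [_|]; [exact: eP.1 | exists tt; exact: eP.2].
exists d; split; last by rewrite -Ed; lia.
have -> : pfaffian T r X z = fun x => pfq r (bivect pi z x) (sigma_mx T X z x).
  by apply/funext => x; exact: pfaffianE.
apply: top_form_degree.
- have E : (2 * r + (n - r.*2))%N = n by rewrite mul2n -[RHS]rank_dim addnn.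
  by move=> x; have := @homog_pfq C n r _ (bivect pi z x) (sigma_mx T X z x); rewrite E.
- apply: hol_pfq => i j; [exact: hol_bivect | exact: hol_sigma_mx].
have <- : (fun x => pfaffian T r X z x [set: 'I_n]%SET) =
    (fun x => pfq r (bivect pi z x) (sigma_mx T X z x) [set: 'I_n]%SET).
  by apply/funext => x; rewrite pfaffianE.
exact: ed.
Qed.

Lemma pfaffian_log_volume : exists2 d : int, low_degree_log_volume phi p0 z d &
  low_degree_multivect n (pfaffian T r X) p0 z (- d).
Proof.
have [e [f [d [Lam [cc [eD ef ed Ed _]]]]]] := log_canonical_orders.
have [h1 h2] := pfaffian_log_degrees eD ef ed Ed.
by exists ((e + n)%N%:Z - (\sum_j f j)%N%:Z).
Qed.

Lemma linearization_degree : T_fixed T p0 -> poisson_zero pi p0 ->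
  exists2 pi0, is_linearization pi p0 z pi0 &
  exists2 d : int, low_degree_log_volume phi p0 z d /\
    low_degree_multivect n (pfaffian T r X) p0 z (- d) &
  d%:~R = 2^-1 * (max_rank (range pi0))%:R :> rat.
Proof.
move=> fp0 zero0.
have [e [f [d [Lam [cc [eD ef ed Ed [nz nB ns]]]]]]] := log_canonical_orders.
have hB i j : hol (fun x => bivect pi z x i j) u0 by exact: hol_bivect.
have B0 : bivect pi z u0 = 0 by exact: zero0.
have s0 : sigma_mx T X z u0 = 0.
  apply/row_matrixP => i; rewrite rowK row0 (cmapK zp0.2); exact: infinitesimal_fixed.
pose linM := GRing.isLinear.Build _ _ _ _ _ (lin_bivect_linear hB).
pose pi0 : {linear 'rV[C]_n -> 'M[C]_n} := HB.pack (lin_bivect u0 (bivect pi z)) linM.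
exists pi0.
  by move=> g h hg hh v; exact: (lin_bivect_bracket v hB B0 hg hh).
exists ((e + n)%N%:Z - (\sum_j f j)%N%:Z); first exact: pfaffian_log_degrees ed Ed.
have hphiz j : hol (phi j \o cinv z) u0 by exact: hol_chart.
have le v := linearization_rank_le hB hphiz nB eD ef B0 v.
have [v ge] := linearization_rank_ge hB (fun i j => hol_sigma_mx T X i j zp0) hphiz nB ns eD ef B0 s0 nz.
have E : (max_rank (range pi0) + (\sum_j f j).*2)%N = (e + n).*2.
  have sub_le (a b c : nat) : (a + b <= c)%N -> (a <= c - b)%N by lia.
  have sandwich (a b c t : nat) : (a <= c - b)%N -> (c <= t + b)%N -> (t <= a)%N ->
    (t + b <= c)%N -> (a + b = c)%N by lia.
  apply: sandwich ge _ (le v); last by apply: max_rank_bound; exists v.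
  by apply: max_rank_lub => A [v' _ <-]; exact: sub_le (le v').
have E2 : (max_rank (range pi0))%:Z = 2 * ((e + n)%N%:Z - (\sum_j f j)%N%:Z).
  by move: (max_rank _) (\sum_j f j)%N E => a b; lia.
have E3 : (max_rank (range pi0))%:R = ((max_rank (range pi0))%:Z)%:~R :> rat by [].
by rewrite E3 E2 rmorphM /= mulKf.
Qed.

End MainProof.

Theorem theoremC (R : realType) (m n : nat) (P : cmanifold (cplx R) n)
    (pi : poisson P) (T : torus_action m pi) (L : set P) (Pf : ext_field) :
  connected [set: P] ->
  T_leaf T L -> open L -> dense L ->
  is_T_pfaffian T L Pf ->
  (* Part 1 *)
  ((forall Phi, log_canonical T Phi ->
      forall p0 z, chart_at p0 z ->
      exists2 d : int, low_degree_log_volume Phi p0 z d &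
                       low_degree_multivect n Pf p0 z (- d)) /\
   (forall p0 z, chart_at p0 z -> poisson_zero pi p0 ->
      pfaffian_identity pi Pf p0 z ->
      forall Phi, log_canonical T Phi -> property_I pi Phi p0 z)) /\
  (* Part 2 *)
  ((exists Phi, log_canonical T Phi) ->
   forall p0 z, chart_at p0 z -> T_fixed T p0 -> poisson_zero pi p0 ->
     pfaffian_identity pi Pf p0 z /\
     forall Phi, log_canonical T Phi -> property_I pi Phi p0 z).
Proof.
move=> cP leafL openL denseL [r [rank_r [X basisX ->]]].
have part1 Phi p0 z : log_canonical T Phi -> chart_at p0 z ->
    exists2 d : int, low_degree_log_volume Phi p0 z d &
                     low_degree_multivect n (pfaffian T r X) p0 z (- d).
  by move=> logPhi zp0; exact: (pfaffian_log_volume cP leafL openL denseL rank_r basisX zp0 logPhi).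
have identity_property p0 z : chart_at p0 z -> poisson_zero pi p0 ->
    pfaffian_identity pi (pfaffian T r X) p0 z ->
    forall Phi, log_canonical T Phi -> property_I pi Phi p0 z.
  move=> zp0 zero0 [pi0 lin [d [e [le ->]] Ed]] Phi logPhi; split => //.
  exists pi0 => //; have [d' logd [e' [le' dE]]] := part1 Phi p0 z logPhi zp0.
  exists d' => //; apply: oppr_inj; rewrite -Ed (lowest_degree_inj le le') -dE.
  by rewrite rmorphN.
split; first by split => [Phi logPhi p0 z|p0 z]; [exact: part1 | exact: identity_property].
move=> [Phi logPhi] p0 z zp0 fix0 zero0.
have ident : pfaffian_identity pi (pfaffian T r X) p0 z.
  have [pi0 lin [d [_ pfd] Ed]] :=
    linearization_degree cP leafL openL denseL rank_r basisX zp0 logPhi fix0 zero0.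
  by exists pi0 => //; exists (- d) => //; rewrite rmorphN /= Ed.
by split => //; exact: identity_property.
Qed.
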